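(* Suppose that the parameters $p,q,r,s,v$ satisfy $0<q\le p<\infty$, $0<r\le\infty$, $1\le s<\infty$, $0<v\le1$, $q<1$, $p<s$, and $v<\min(q,r)$. Write $d_v=[n(1/v-1)]$. Assume that $\{Q_j\}_{j=1}^\infty\subset\mathcal{Q}(\mathbb{R}^n)$, $\{a_j\}_{j=1}^\infty\subset\mathcal{M}^s_1(\mathbb{R}^n)\cap\mathcal{P}_{d_v}(\mathbb{R}^n)^\perp$ and $\{\lambda_j\}_{j=1}^\infty\subset[0,\infty)$ fulfill $$\|a_j\|_{\mathcal{M}^s_1}\le|Q_j|^{\frac1s},\quad\mathrm{supp}(a_j)\subset Q_j\quad(j\in\mathbb{N}),\qquad\left\|\left(\sum_{j=1}^\infty(\lambda_j\chi_{Q_j})^v\right)^{\frac1v}\right\|_{\mathcal{M}^p_{q,r}}<\infty.$$ Then $f=\sum_{j=1}^\infty\lambda_ja_j$ converges in $\mathcal{S}'(\mathbb{R}^n)$ and satisfies $$\|f\|_{H\mathcal{M}^p_{q,r}}\le C\left\|\left(\sum_{j=1}^\infty(\lambda_j\chi_{Q_j})^v\right)^{\frac1v}\right\|_{\mathcal{M}^p_{q,r}},$$ where $C>0$ depends only on $n,p,q,r,s,v$.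
   Context: $[x]$ is the integer part of $x$ and $\mathbb{N}_0=\mathbb{N}\cup\{0\}$. $L^0(\mathbb{R}^n)$ is the set of all measurable functions on $\mathbb{R}^n$, $\mathcal{Q}(\mathbb{R}^n)$ is the family of all cubes in $\mathbb{R}^n$ with sides parallel to the coordinate axes, $|E|$ is Lebesgue measure, $\chi_E$ is the indicator function of $E$, and $\mathcal{S}'(\mathbb{R}^n)$ is the space of tempered distributions. For measurable $f$ put $\lambda_f(\alpha)=|\{x:|f(x)|>\alpha\}|$ ($\alpha>0$) and $f^\ast(t)=\inf\{\alpha>0:\lambda_f(\alpha)\le t\}$ ($t>0$). The Lorentz quasi-norm is $\|f\|_{L^{q,r}}=\left(\int_0^\infty(t^{1/q}f^\ast(t))^r\frac{dt}{t}\right)^{1/r}$ for $0<q,r<\infty$ and $\|f\|_{L^{q,\infty}}=\sup_{t>0}t^{1/q}f^\ast(t)$. For $0<q\le p<\infty$, $0<r\le\infty$, the Morrey-Lorentz space $\mathcal{M}^p_{q,r}(\mathbb{R}^n)$ is the set of $f\in L^0(\mathbb{R}^n)$ with $\|f\|_{\mathcal{M}^p_{q,r}}=\sup_{Q\in\mathcal{Q}(\mathbb{R}^n)}|Q|^{\frac1p-\frac1q}\|f\chi_Q\|_{L^{q,r}}<\infty$. The Morrey space is $\mathcal{M}^p_q(\mathbb{R}^n)=\mathcal{M}^p_{q,q}(\mathbb{R}^n)$ (same quasi-norm); in particular $\|f\|_{\mathcal{M}^s_1}=\sup_{Q}|Q|^{\frac1s-1}\int_Q|f(x)|\,dx$.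 For $K\in\mathbb{N}_0$, $\mathcal{P}_K(\mathbb{R}^n)^\perp$ denotes the set of all $f\in L^0(\mathbb{R}^n)$ for which $\langle\cdot\rangle^Kf\in L^1(\mathbb{R}^n)$ and $\int_{\mathbb{R}^n}x^\alpha f(x)\,dx=0$ for every $\alpha\in\mathbb{N}_0^n$ with $|\alpha|\le K$, where $\langle x\rangle=(1+|x|^2)^{1/2}$. The Hardy-Morrey-Lorentz space $H\mathcal{M}^p_{q,r}(\mathbb{R}^n)$ is the set of all $f\in\mathcal{S}'(\mathbb{R}^n)$ with $\|f\|_{H\mathcal{M}^p_{q,r}}=\|\sup_{t>0}|e^{t\Delta}f|\|_{\mathcal{M}^p_{q,r}}<\infty$, where $e^{t\Delta}f(x)=\left\langle\frac{1}{\sqrt{(4\pi t)^n}}\exp\left(-\frac{|x-\cdot|^2}{4t}\right),f\right\rangle$ for $x\in\mathbb{R}^n$, $t>0$. *)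

(* Defs.v *)
From HB Require Import structures.
From mathcomp Require Import all_boot all_order all_algebra.
From mathcomp Require Import complex.
From mathcomp Require Import all_classical all_reals all_analysis.

Set Implicit Arguments.
Unset Strict Implicit.
Unset Printing Implicit Defensive.

Import Order.TTheory GRing.Theory Num.Theory.
Import numFieldNormedType.Exports.

Local Open Scope classical_set_scope.
Local Open Scope ring_scope.

Local Notation Re := complex.Re.
Local Notation Im := complex.Im.
Local Notation normc := ComplexField.Normc.normc.

(* The library has no Lebesgue measure on R^n. It is built here on 'rV[R]_n as
   the completion of the n-fold product of the one-dimensional measure. *)

Definition rV_display : measure_display -> measure_display.
Proof. exact. Qed.

Section rV_measurable.
Context {d : measure_display} {T : sigmaRingType d} {n : nat}.

Let coors : 'I_n -> 'rV[T]_n -> T := fun i x => x ord0 i.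

Let rV_set0 : g_sigma_preimage coors set0.
Proof. exact: sigma_algebra0. Qed.

Let rV_setC A : g_sigma_preimage coors A -> g_sigma_preimage coors (~` A).
Proof. exact: sigma_algebraC. Qed.

Let rV_bigcup (F : _^nat) : (forall i, g_sigma_preimage coors (F i)) ->
  g_sigma_preimage coors (\bigcup_i F i).
Proof. exact: sigma_algebra_bigcup. Qed.

HB.instance Definition _ := @isMeasurable.Build (rV_display d)
  'rV[T]_n (g_sigma_preimage coors) rV_set0 rV_setC rV_bigcup.

End rV_measurable.

Section rV_measurable_fun.
Context {R : realType}.

Lemma measurable_rV_coord (n : nat) (i : 'I_n) :
  measurable_fun [set: 'rV[R]_n] (fun x : 'rV[R]_n => x ord0 i).
Proof.
move=> _ Y mY; rewrite setTI; apply: sub_sigma_algebra => /=.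
rewrite -bigcup_seq/=; exists i => /=; first by rewrite mem_index_enum.
by exists Y => //; rewrite setTI.
Qed.

Lemma measurable_fun_rV d (T : measurableType d) (n : nat) (f : T -> 'rV[R]_n) :
  (forall i, measurable_fun [set: T] (fun x => f x ord0 i)) ->
  measurable_fun [set: T] f.
Proof.
move=> mf _ A mA.
suff : g_sigma_preimage (fun i x => f x ord0 i) `<=` (measurable : set (set T)).
  by apply; rewrite (g_sigma_preimage_comp (fun i (x : 'rV[R]_n) => x ord0 i) f);
    exists A.
apply: smallest_sub; first exact: sigma_algebra_measurable.
case: n => [|n] in f mf A mA *; first by rewrite big_ord0.
rewrite -bigcup_mkord_ord; apply: bigcup_sub => i Ii.
by move=> B [C mC <-]; exact: mf.
Qed.

Definition rV_cons (n : nat) (x : R * 'rV[R]_n) : 'rV[R]_n.+1 :=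
  \row_i if unlift ord0 i is Some j then x.2 ord0 j else x.1.

Definition rV_uncons (n : nat) (y : 'rV[R]_n.+1) : R * 'rV[R]_n :=
  (y ord0 ord0, \row_j y ord0 (lift ord0 j)).

Lemma rV_consK (n : nat) : cancel (@rV_cons n) (@rV_uncons n).
Proof.
move=> [a x]; rewrite /rV_uncons /rV_cons mxE unlift_none/=; congr pair.
by apply/rowP => j; rewrite !mxE liftK.
Qed.

Lemma rV_unconsK (n : nat) : cancel (@rV_uncons n) (@rV_cons n).
Proof.
move=> y; apply/rowP => i; rewrite mxE /=.
by case: unliftP => [j ->|->]//; rewrite mxE.
Qed.

Lemma measurable_rV_cons (n : nat) :
  measurable_fun [set: measurableTypeR R * 'rV[R]_n] (@rV_cons n).
Proof.
apply: measurable_fun_rV => i; rewrite /rV_cons.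
case: (unliftP ord0 i) => [j|] ->.
  rewrite [X in measurable_fun _ X](_ : _ =
    (fun x : 'rV[R]_n => x ord0 j) \o snd).
    by apply: measurableT_comp => //; exact: measurable_rV_coord.
  by apply/funext => x /=; rewrite mxE liftK.
rewrite [X in measurable_fun _ X](_ : _ = fst)//.
by apply/funext => x /=; rewrite mxE unlift_none.
Qed.

Lemma measurable_rV_uncons (n : nat) :
  measurable_fun [set: 'rV[R]_n.+1]
    (@rV_uncons n : _ -> measurableTypeR R * 'rV[R]_n).
Proof.
apply/measurable_fun_pairP; split; first exact: measurable_rV_coord.
apply: measurable_fun_rV => j.
under [X in measurable_fun _ X]eq_fun do rewrite mxE.
exact: measurable_rV_coord.
Qed.

End rV_measurable_fun.

Section product_step.
Context {R : realType} {n : nat}.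
Variable mu : {sigma_finite_measure set 'rV[R]_n -> \bar R}.

Let prod : {measure set (measurableTypeR R * 'rV[R]_n)%type -> \bar R} :=
  (@lebesgue_measure R \x mu)%E.

Definition product_step : set 'rV[R]_n.+1 -> \bar R :=
  pushforward prod (@rV_cons R n).

Let measurable_preimage A :
  measurable A -> measurable (@rV_cons R n @^-1` A : set (measurableTypeR R * 'rV[R]_n)%type).
Proof.
by move=> mA; rewrite -[X in measurable X]setTI; apply: measurable_rV_cons.
Qed.

Let product_step0 : product_step set0 = 0%E.
Proof. by rewrite /product_step /pushforward preimage_set0 measure0. Qed.

Let product_step_ge0 A : (0 <= product_step A)%E.
Proof. by rewrite /product_step /pushforward measure_ge0. Qed.

Let product_step_sigma_additive : semi_sigma_additive product_step.
Proof.
move=> F mF tF mUF; rewrite /product_step /pushforward preimage_bigcup.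
apply: measure_semi_sigma_additive.
- by move=> k; exact: measurable_preimage.
- apply/trivIsetP => /= i j _ _ ij; rewrite -preimage_setI.
  by move/trivIsetP : tF => /(_ _ _ _ _ ij) ->//; rewrite preimage_set0.
- by rewrite -preimage_bigcup; exact: measurable_preimage.
Qed.

HB.instance Definition _ := isMeasure.Build _ _ _ product_step
  product_step0 product_step_ge0 product_step_sigma_additive.

Let product_step_sigma_finite : sigma_finite setT product_step.
Proof.
have [F TF mF] : sigma_finite setT prod.
  have /sigma_finiteP[F [TF ndF Foo]] := sigma_finiteT (@lebesgue_measure R).
  have /sigma_finiteP[G [TG ndG Goo]] := sigma_finiteT mu.
  exists (fun k => F k `*` G k).
    rewrite -setXTT TF TG predeqE => -[x y]; split.
      move=> [/= [i _ Fx] [k _ Gky]]; exists (maxn i k) => //; split.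
      - by move: x Fx; exact/subsetPset/ndF/leq_maxl.
      - by move: y Gky; exact/subsetPset/ndG/leq_maxr.
    by move=> [i _ []/= ? ?]; split; exists i.
  move=> k; have [? ?] := Foo k; have [? ?] := Goo k.
  split; first exact: measurableX.
  by rewrite /prod/= product_measure1E// lte_mul_pinfty// ge0_fin_numE.
exists (fun k => @rV_uncons R n @^-1` F k).
  by rewrite -preimage_bigcup -TF preimage_setT.
move=> k; have [mFk Fkoo] := mF k; split.
  by rewrite -[X in measurable X]setTI; exact: measurable_rV_uncons.
rewrite /product_step /pushforward -comp_preimage.
by rewrite (_ : _ \o _ = id) ?preimage_id//; apply/funext => x; exact: rV_consK.
Qed.

HB.instance Definition _ := Measure_isSigmaFinite.Build _ _ _ product_step
  product_step_sigma_finite.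

End product_step.

Section lebesgue_rV.
Context {R : realType}.

Fixpoint borel_lebesgue_rV (n : nat) :
    {sigma_finite_measure set 'rV[R]_n -> \bar R} :=
  if n is m.+1 then product_step (borel_lebesgue_rV m)
  else \d_(0 : 'rV[R]_0).

Context (n : nat).

(* The Caratheodory sets of the outer measure induced by the product measure
   are exactly the Lebesgue measurable subsets of 'rV[R]_n. *)
Definition lebesgue_space : measurableType _ :=
  caratheodory_type ((borel_lebesgue_rV n)^*)%mu.

Definition lebesgue_rV : {measure set lebesgue_space -> \bar R} :=
  @completed_measure_extension _ _ _ (borel_lebesgue_rV n).

End lebesgue_rV.

Section complex_functions.
Context {R : realType} {n : nat}.
Implicit Types (f : 'rV[R]_n -> R[i]) (x : 'rV[R]_n).

Definition cmeasurable f :=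
  measurable_fun setT (fun x : lebesgue_space n => Re (f x)) /\
  measurable_fun setT (fun x : lebesgue_space n => Im (f x)).

Definition cintegrable f :=
  (lebesgue_rV n).-integrable setT (fun x => (Re (f x))%:E) /\
  (lebesgue_rV n).-integrable setT (fun x => (Im (f x))%:E).

Definition cintegral f : R[i] :=
  (Rintegral (lebesgue_rV n) setT (fun x => Re (f x)) +i*
   Rintegral (lebesgue_rV n) setT (fun x => Im (f x)))%C.

Definition modulus f : 'rV[R]_n -> \bar R := fun x => (normc (f x))%:E.

Definition csupport f : set 'rV[R]_n := closure [set x | f x != 0].

(* The library norm on 'rV[R]_n is the maximum norm. *)
Definition enorm x : R := Num.sqrt (\sum_i x ord0 i ^+ 2).

Definition japanese x : R := Num.sqrt (1 + enorm x ^+ 2).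

Definition monomial (alpha : 'I_n -> nat) x : R := \prod_i x ord0 i ^+ alpha i.

Definition vanishing_moments (K : nat) : set ('rV[R]_n -> R[i]) :=
  [set f | [/\ cmeasurable f,
    cintegrable (fun x => ((japanese x ^+ K)%:C)%C * f x) &
    forall alpha : 'I_n -> nat, (\sum_i alpha i <= K)%N ->
      cintegral (fun x => ((monomial alpha x)%:C)%C * f x) = 0]].

End complex_functions.

(* The quasi-norms are defined on extended real functions, so that they apply
   to infinite sums and to suprema of nonnegative functions. *)
Section morrey_lorentz.
Context {R : realType} {n : nat}.
Implicit Types (g : 'rV[R]_n -> \bar R).
Local Open Scope ereal_scope.

Definition distribution_function g (alpha : R) : \bar R :=
  lebesgue_rV n [set x | alpha%:E < `|g x|].

Definition rearrangement g (t : R) : \bar R :=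
  ereal_inf [set alpha%:E | alpha in
    [set alpha : R | (0 < alpha)%R /\ distribution_function g alpha <= t%:E]].

Definition lorentz_norm (q : R) (r : \bar R) g : \bar R :=
  match r with
  | r%:E =>
      (\int[lebesgue_measure]_(t in `]0%R, +oo[)
         (((t `^ q^-1)%:E * rearrangement g t) `^ r * (t^-1)%:E)) `^ r^-1
  | +oo =>
      ereal_sup [set (t `^ q^-1)%:E * rearrangement g t
                | t in [set t : R | (0 < t)%R]]
  | -oo => 0
  end.

Definition cube (c : 'rV[R]_n) (l : R) : set 'rV[R]_n :=
  [set x | forall i, (c ord0 i <= x ord0 i <= c ord0 i + l)%R].

Definition cubes : set (set 'rV[R]_n) :=
  [set Q | exists (c : 'rV[R]_n) (l : R), (0 < l)%R /\ Q = cube c l].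

Definition morrey_lorentz_norm (p q : R) (r : \bar R) g : \bar R :=
  ereal_sup [set (lebesgue_rV n Q) `^ (p^-1 - q^-1)%R *
                 lorentz_norm q r (fun x => g x * (\1_Q x)%:E) | Q in cubes].

Definition morrey_norm (p q : R) (f : 'rV[R]_n -> R[i]) : \bar R :=
  morrey_lorentz_norm p q q%:E (modulus f).

Definition morrey (p q : R) : set ('rV[R]_n -> R[i]) :=
  [set f | cmeasurable f /\ morrey_norm p q f < +oo].

Definition lv_sum (v : R) (lambda : nat -> R) (Q : nat -> set 'rV[R]_n)
    (x : 'rV[R]_n) : \bar R :=
  (\sum_(0 <= j <oo) ((lambda j * \1_(Q j) x)%R `^ v)%:E) `^ v^-1.

End morrey_lorentz.

Section tempered_distributions.
Context {R : realType} {n : nat}.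
Implicit Types (phi psi : 'rV[R]_n -> R[i]) (u : 'rV[R]_n -> R).

(* Iterated partial derivatives are indexed by words of directions instead of
   multi-indices: the order of differentiation is immaterial for a smooth
   function, and quantifying over all words avoids fixing one. *)
Definition partial (s : seq 'I_n) u : 'rV[R]_n -> R :=
  foldr (fun i w => 'D_(delta_mx ord0 i) w) u s.

Definition smooth u := forall s : seq 'I_n,
  continuous (partial s u) /\
  forall i x, derivable (partial s u) x (delta_mx ord0 i).

Definition cpartial (s : seq 'I_n) phi : 'rV[R]_n -> R[i] := fun x =>
  (partial s (fun y => Re (phi y)) x +i* partial s (fun y => Im (phi y)) x)%C.

Definition schwartz_norm (N : nat) phi : \bar R :=
  ereal_sup [set (japanese z.2 ^+ N * normc (cpartial z.1 phi z.2))%:E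
            | z in [set z : seq 'I_n * 'rV[R]_n | (size z.1 <= N)%N]].

Definition schwartz : set ('rV[R]_n -> R[i]) :=
  [set phi | [/\ smooth (fun x => Re (phi x)), smooth (fun x => Im (phi x)) &
    forall N, (schwartz_norm N phi < +oo)%E]].

(* The values of a tempered distribution outside [schwartz] are irrelevant. *)
Definition tempered_distribution : set (('rV[R]_n -> R[i]) -> R[i]) :=
  [set F |
    (forall (c : R[i]) phi psi, schwartz phi -> schwartz psi ->
      F (fun x => c * phi x + psi x) = c * F phi + F psi) /\
    exists (N : nat) (M : R), forall phi, schwartz phi ->
      ((normc (F phi))%:E <= M%:E * schwartz_norm N phi)%E].

Definition regular_distribution (f : 'rV[R]_n -> R[i]) phi : R[i] :=
  cintegral (fun x => f x * phi x).

Definition tempered_cvg (Fs : nat -> ('rV[R]_n -> R[i]) -> R[i])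
    (F : ('rV[R]_n -> R[i]) -> R[i]) :=
  forall phi, schwartz phi ->
    (fun k => normc (Fs k phi - F phi)) @ \oo --> (0 : R).

Definition heat_kernel (t : R) (x y : 'rV[R]_n) : R[i] :=
  (((Num.sqrt ((4 * pi * t) ^+ n))^-1 *
    expR (- (enorm (x - y) ^+ 2 / (4 * t))))%:C)%C.

Definition heat (F : ('rV[R]_n -> R[i]) -> R[i]) (t : R) (x : 'rV[R]_n) : R[i] :=
  F (heat_kernel t x).

Definition heat_maximal (F : ('rV[R]_n -> R[i]) -> R[i]) (x : 'rV[R]_n)
    : \bar R :=
  ereal_sup [set (normc (heat F t x))%:E | t in [set t : R | 0 < t]].

Definition hardy_morrey_lorentz_norm (p q : R) (r : \bar R)
    (F : ('rV[R]_n -> R[i]) -> R[i]) : \bar R :=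
  morrey_lorentz_norm p q r (heat_maximal F).

End tempered_distributions.

(* Main.v *)
(* A kernel [phi] of size [t ^- n] concentrated at distance [t] from [x] (a heat
   kernel, or a Schwartz function with [|x| <= 1] and [t = 1]) acts on an atom
   [a_j] living on the cube [Q_j] of center [c_j] and radius [rho_j]. Close to
   [Q_j] the action is bounded by a grid maximal function of [|a_j|]. Away from
   [Q_j] the vanishing moments allow the subtraction of a polynomial of degree
   [d_v] from [phi], which gives the decay [(rho_j / |x - c_j|) ^ D] where
   [D = n + d_v + 1 > n / v > n / q]. Hence, for [q < w < 1], the [w]-th power
   of the total action at [x] is at most
   [sum_j lambda_j ^ w * sum_k B j k x], where [B j k] lives on the dilate
   [2 ^ k Q_j] and has its integrals controlled by the Morrey norm of [a_j].
   Let [F] be the function [lv_sum v lambda Q] and fix a test cube [P]. The pairs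
   with [2 ^ k Q_j] smaller than [P] are split at a level [f] of the
   rearrangement of [F]: the cubes more than half covered by [F > f] have dilates
   contained in a small set (Vitali), and the remaining ones have a total mass
   bounded by the integral of [F ^ w] over [F <= f]. The larger cubes are treated
   by the same mass bound at their own scale, and [p < s] makes the sum over the
   scales converge. Sampling rearrangements at powers of [2] turns the Lorentz
   quasi-norm into a weighted [l ^ r] norm and these bounds into geometric series
   of shifts. Finally the majorant, being locally of finite quasi-norm, is finite
   at some point of the unit cube, which bounds the action on all Schwartz
   functions at once. *)

From HB Require Import structures.
Require Import Defs.
From mathcomp Require Import all_boot all_order all_algebra complex.
From mathcomp Require Import all_classical all_reals all_analysis measurable_realfun.
From mathcomp Require Import ring lra zify.

Set Implicit Arguments.
Unset Strict Implicit.
Unset Printing Implicit Defensive.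

Import Order.TTheory GRing.Theory Num.Theory.
Import numFieldNormedType.Exports.

Local Open Scope classical_set_scope.
Local Open Scope ring_scope.

(** * Cubes and Lebesgue measure *)

(** Since q < 1, neither duality nor boundedness of the maximal operator is available. The estimate
    is therefore a pointwise inequality between rearrangements: at 2^(l+M) that of the majorant is
    at most a constant times the larger of a supremum of shifted, weighted samples of that of F and
    a power of 2^l. Suprema of geometrically decaying shifts are bounded in weighted l^r for every
    r, so r < 1 and r = +oo need no separate theory. The exponent w is constrained on several sides.
    With w < 1 the w-th power of a maximal function is locally integrable (Kolmogorov); with w > q
    the series of 2^i f(2^i t)^w converges when f(t) is of size t^(-1/q); with v <= w the sum of
    lambda_j^w over the cubes containing x is at most F(x)^w. For the dilates by 2^k the splitting
    level is the rearrangement of F at 2^(l-k(n+1)): the dilates of the dense cubes then cover a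
    measure of order 2^(kn) 2^(l-k(n+1)) = 2^(l-k), which is summable, and the mass of the other
    cubes is summable in k as soon as (n+1) w / q < w D + 1. At w = q this says D > n / q, so it
    persists for w slightly above q. *)

Lemma le_of_eq d (T : porderType d) (x y : T) : x = y -> (x <= y)%O.
Proof. by move=> ->. Qed.

Section lebesgue_rV_facts.
Context {R : realType} {n : nat}.
Local Notation mu := (@lebesgue_rV R n).
Local Notation LT := (@lebesgue_space R n).
Implicit Types (A B : set 'rV[R]_n).

(** By computation [lebesgue_rV] is the outer measure, which is defined on every set. Monotonicity
    and subadditivity thus hold without measurability, and level sets of arbitrary functions are
    allowed. *)
Lemma le_mu A B : A `<=` B -> (mu A <= mu B)%E.
Proof. exact: le_mu_ext. Qed.

Lemma mu_ge0 A : (0 <= mu A)%E.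
Proof. exact: mu_ext_ge0. Qed.

Lemma mu_subU A B : (mu (A `|` B) <= mu A + mu B)%E.
Proof. exact: (outer_measureU2 (borel_lebesgue_rV n)^*%mu). Qed.

Lemma mu_bigcup_le (F : nat -> set 'rV[R]_n) :
  (mu (\bigcup_i F i) <= \sum_(i <oo) mu (F i))%E.
Proof. exact: (outer_measure_sigma_subadditive (borel_lebesgue_rV n)^*%mu). Qed.

Lemma borel_lebesgue A : measurable A -> measurable (A : set LT).
Proof. exact: caratheodory_measurable_mu_ext. Qed.

Lemma mu_borel A : measurable A -> mu A = borel_lebesgue_rV n A.
Proof. exact: measurable_mu_extE. Qed.

(** The norm is the maximum norm, so its closed balls are the cubes. Centre and radius turn
    inclusions of cubes into triangle inequalities. *)
Definition qb (c : 'rV[R]_n) (rho : R) : set 'rV[R]_n :=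
  [set y | `|y - c| <= rho].

Lemma rV_norm_le (x : 'rV[R]_n) (rho : R) : 0 <= rho ->
  (`|x| <= rho) <-> forall i, `|x ord0 i| <= rho.
Proof.
move=> r0; have -> : `|x| = mx_norm x by [].
rewrite mx_normrE; split.
  move/bigmax_leP => [_ h] i; exact: (h (ord0, i) isT).
move=> h; apply/bigmax_leP; split => //= -[i j] _; rewrite /= (ord1 i); exact: h.
Qed.

Lemma rV_coord_le (x : 'rV[R]_n) i : `|x ord0 i| <= `|x|.
Proof. by have /rV_norm_le := lexx `|x|; apply. Qed.

Lemma qb_cube c rho : 0 <= rho ->
  qb c rho = cube (\row_i (c ord0 i - rho)) (2 * rho).
Proof.
move=> r0; apply/seteqP; split => y /=; rewrite /qb /cube/= rV_norm_le//.
  by move=> h i; have := h i; rewrite !mxE ler_norml => /andP[? ?]; apply/andP; split; lra.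
by move=> h i; have := h i; rewrite !mxE ler_norml => /andP[? ?]; apply/andP; split; lra.
Qed.

Lemma cube_qb c (l : R) : 0 <= l -> cube c l = qb (\row_i (c ord0 i + l / 2)) (l / 2).
Proof.
move=> l0; rewrite qb_cube ?divr_ge0//; congr cube; last by field.
by apply/rowP => i; rewrite !mxE addrK.
Qed.

End lebesgue_rV_facts.

Lemma cubeS (R : realType) n (c : 'rV[R]_n.+1) l :
  @rV_cons R n @^-1` (cube c l) =
  `[c ord0 ord0, c ord0 ord0 + l] `*` cube (\row_j c ord0 (lift ord0 j)) l.
Proof.
apply/seteqP; split => -[a x]; rewrite /cube/= /rV_cons /=.
  move=> h; split; first by have := h ord0; rewrite mxE unlift_none /= in_itv.
  by move=> i; have := h (lift ord0 i); rewrite !mxE liftK.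
move=> [h1 h2] i; rewrite mxE; case: (unliftP ord0 i) => [j ->|->].
  by have := h2 j; rewrite mxE.
by move: h1; rewrite in_itv.
Qed.

Lemma measurable_cube (R : realType) n (c : 'rV[R]_n) l :
  measurable (cube c l).
Proof.
have -> : cube c l = \bigcap_(i in [set: 'I_n])
    ((fun x : 'rV[R]_n => x ord0 i) @^-1` `[c ord0 i, c ord0 i + l]).
  apply/seteqP; split => x /=.
    by move=> h i _ /=; rewrite in_itv/=; exact: h.
  by move=> h i; have := h i I; rewrite /= in_itv.
apply: fin_bigcap_measurable => // i _.
by rewrite -[X in measurable X]setTI; exact: measurable_rV_coord.
Qed.

Lemma borel_cube (R : realType) n (c : 'rV[R]_n) (l : R) : 0 <= l ->
  borel_lebesgue_rV n (cube c l) = (l ^+ n)%:E.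
Proof.
move=> l0; elim: n c => [|n ih] c /=.
  by rewrite diracE expr0 mem_set// => -[].
rewrite /product_step /pushforward cubeS.
rewrite [LHS](product_measure1E lebesgue_measure (borel_lebesgue_rV n))//; last first.
  exact: measurable_cube.
have E : lebesgue_measure `[c ord0 ord0, c ord0 ord0 + l]%classic = l%:E :> \bar R.
  rewrite lebesgue_measure_itv /= lte_fin ltrDl.
  case: ltP => [l1|l1]; first by rewrite -EFinD addrAC subrr add0r.
  by congr EFin; apply/eqP; rewrite eq_le l0 l1.
by rewrite [X in (X * _)%E]E ih -EFinM exprS.
Qed.

Section qb_facts.
Context {R : realType} {n : nat}.
Local Notation mu := (@lebesgue_rV R n).
Local Notation LT := (@lebesgue_space R n).

Lemma measurable_qb_borel (c : 'rV[R]_n) rho : measurable (qb c rho).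
Proof.
have [r0|r0] := leP 0 rho; first by rewrite qb_cube//; exact: measurable_cube.
rewrite (_ : qb _ _ = set0)//; apply/seteqP; split => // x /=.
by rewrite /qb/= leNgt (lt_le_trans r0).
Qed.

Lemma measurable_qb (c : 'rV[R]_n) rho : measurable (qb c rho : set LT).
Proof. by apply: borel_lebesgue; exact: measurable_qb_borel. Qed.

Lemma mu_qb (c : 'rV[R]_n) rho : 0 <= rho -> mu (qb c rho) = ((2 * rho) ^+ n)%:E.
Proof.
move=> r0; rewrite mu_borel; last exact: measurable_qb_borel.
by rewrite qb_cube// borel_cube// mulr_ge0.
Qed.

Lemma qb_sub (c c' : 'rV[R]_n) rho rho' : `|c - c'| + rho <= rho' ->
  qb c rho `<=` qb c' rho'.
Proof.
move=> h x /=; rewrite /qb/= => hx; apply: le_trans h.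
by rewrite -(subrKA c) (le_trans (ler_normD _ _))// addrC lerD2l.
Qed.

End qb_facts.

(** * Dyadic grid and Vitali covering *)

Section dyadic_grid.
Context {R : realType} {n : nat}.
Local Notation mu := (@lebesgue_rV R n).
Local Notation LT := (@lebesgue_space R n).

Lemma exp2z_gt0 (l : int) : 0 < (2 : R) ^ l.
Proof. by rewrite exprz_gt0. Qed.

Lemma exp2z_bracket (x : R) : 0 < x -> exists l : int, 2 ^ l <= x < 2 ^ (l + 1).
Proof.
move=> x0; have l2 : 0 < ln (2 : R) by rewrite ln_gt0// ltr1n.
exists (Num.floor (ln x / ln 2)).
rewrite -!powR_intmul// /powR pnatr_eq0 /=.
have /andP[h1 h2] := mem_rg1_floor (ln x / ln 2).
rewrite -{2 3}(lnK x0) ler_expR ltr_expR -ler_pdivlMr// h1/=.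
by rewrite intrD -ltr_pdivrMr.
Qed.

(** Pairs of a scale l and a lattice point z are enumerated by [nat], so that unions over the grid
    are countable. The radius 2^(l+1) is twice the mesh: the cubes overlap enough to swallow any
    cube of radius at most 2^l. Indices that encode no pair get the cube of radius 1 about 0. *)
Definition grid_center (k : nat) : 'rV[R]_n :=
  if (unpickle k : option (int * 'rV[int]_n)) is Some lz then
    \row_i (2 ^ lz.1 * (lz.2 ord0 i)%:~R) else 0.

Definition grid_radius (k : nat) : R :=
  if (unpickle k : option (int * 'rV[int]_n)) is Some lz then 2 ^ lz.1 * 2 else 1.

Definition grid_cube (k : nat) : set 'rV[R]_n := qb (grid_center k) (grid_radius k).

Lemma grid_radius_gt0 k : 0 < grid_radius k.
Proof.
rewrite /grid_radius; case: unpickle => [lz|]//.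
by rewrite mulr_gt0// exp2z_gt0.
Qed.

Lemma grid_cube_sup (x : 'rV[R]_n) rho (l : int) : rho <= 2 ^ l ->
  exists k, qb x rho `<=` grid_cube k /\ grid_radius k = 2 ^ l * 2.
Proof.
move=> rl; pose z : 'rV[int]_n := \row_i Num.floor (x ord0 i / 2 ^ l).
exists (pickle (l, z)); rewrite /grid_cube /grid_center /grid_radius pickleK/=.
split=> //; apply: qb_sub; rewrite mulr_natr mulr2n lerD//.
apply/rV_norm_le; first exact/ltW/exp2z_gt0.
move=> i; rewrite !mxE; have /andP[h1 h2] := mem_rg1_floor (x ord0 i / 2 ^ l).
move: h1 h2; rewrite ler_pdivlMr ?exp2z_gt0// ltr_pdivrMr ?exp2z_gt0//.
rewrite -[1 + 1]/(2 : R) mulrDl mul1r => h1 h2.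
by rewrite ler_norml; apply/andP; split; have := exp2z_gt0 l; nra.
Qed.

Lemma open_bigcup_grid (U : set 'rV[R]_n) : open U ->
  U = \bigcup_(k in [set k | grid_cube k `<=` U]) grid_cube k.
Proof.
move=> oU; apply/seteqP; split => [x Ux|x [k /= kU /kU]//].
have /nbhs_ballP[e /= e0 eU] := open_nbhs_nbhs (conj oU Ux).
have [l /andP[le le2]] := exp2z_bracket (divr_gt0 e0 (ltr0n _ 8)).
have [k [xk rk]] := @grid_cube_sup x 0 l (ltW (exp2z_gt0 l)).
have Qx : grid_cube k x by apply: xk; rewrite /qb/= subrr normr0.
exists k => //= y yk; apply: eU; rewrite -ball_normE /ball_/=.
rewrite -(subrKA (grid_center k)) (le_lt_trans (ler_normD _ _))//.
have h1 : `|x - grid_center k| <= grid_radius k by [].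
have h2 : `|grid_center k - y| <= grid_radius k by rewrite distrC.
rewrite (le_lt_trans (lerD h1 h2))// rk; have := exp2z_gt0 l.
by move: le; rewrite ler_pdivlMr//; lra.
Qed.

Lemma measurable_open_rV (U : set 'rV[R]_n) : open U -> measurable (U : set LT).
Proof.
move=> /open_bigcup_grid ->; apply: bigcup_measurable => k _.
exact: measurable_qb.
Qed.

Lemma measurable_continuous_rV (f : 'rV[R]_n -> R) : continuous f ->
  measurable_fun [set: LT] f.
Proof.
move=> cf; apply: (measurability _ (RGenOInfty.measurableE R)) => _ [_ [a ->] <-].
rewrite setTI; apply: measurable_open_rV.
by move/continuousP : cf; apply; exact: interval_open.
Qed.

End dyadic_grid.

Section covering.
Context {R : realType} {n : nat}.
Local Notation mu := (@lebesgue_rV R n).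
Local Notation LT := (@lebesgue_space R n).
Variable g : LT -> \bar R.
Hypothesis mg : measurable_fun [set: LT] g.
Hypothesis g0 : forall x, (0 <= g x)%E.

Variables (c : nat -> 'rV[R]_n) (r : nat -> R).

Let U (s : seq nat) : set 'rV[R]_n :=
  [set x | exists2 i, i \in s & qb (c i) (r i) x].

Let mU s : measurable (U s : set LT).
Proof.
elim: s => [|b s ih].
  by rewrite (_ : U [::] = set0)//; apply/seteqP; split => // x [].
rewrite (_ : U (b :: s) = qb (c b) (r b) `|` U s); first exact: measurableU (measurable_qb _ _) ih.
apply/seteqP; split => x /=.
  by move=> [b']; rewrite inE => /predU1P[->|bs] h; [left|right; exists b'].
by move=> [h|[b' bs h]]; [exists b => //; rewrite mem_head|exists b' => //; rewrite inE bs orbT].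
Qed.

Let max_radius (s : seq nat) : s != [::] ->
  exists2 b, b \in s & forall b', b' \in s -> r b' <= r b.
Proof.
elim: s => // b [_ _|b1 s ih _].
  by exists b; rewrite ?mem_head// => b'; rewrite inE => /eqP ->.
have [//|m ms mmax] := ih; have [mb|bm] := leP (r m) (r b).
  exists b; first exact: mem_head.
  by move=> b'; rewrite inE => /predU1P[->//|/mmax /le_trans]; apply.
exists m; first by rewrite inE ms orbT.
by move=> b'; rewrite inE => /predU1P[->|/mmax//]; exact: ltW.
Qed.

(** Greedy selection: a cube of largest radius is kept, every cube meeting it lies in its triple,
    and the induction applies to the cubes disjoint from it. Disjointness lets the integrals of [g]
    add up. *)
Lemma vitali_finite (s : seq nat) :
  (forall b, b \in s -> 0 <= r b) ->
  (forall b, b \in s -> (mu (qb (c b) (r b)) <= \int[mu]_(x in qb (c b) (r b)) g x)%E) ->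
  (mu (U s) <= (3 ^+ n)%:E * \int[mu]_(x in U s) g x)%E.
Proof.
have [m] := ubnP (size s); elim: m s => // m ih s sm r0 H.
have [->|/max_radius[b bs bmax]] := eqVneq s [::].
  rewrite (_ : U [::] = set0); last by apply/seteqP; split => // x [].
  by rewrite [leLHS]measure0 integral_set0 mule0.
pose s' := [seq b' <- s | `[< qb (c b') (r b') `&` qb (c b) (r b) = set0 >]].
have bb : qb (c b) (r b) (c b) by rewrite /qb/= subrr normr0 r0.
have s's b' : b' \in s' -> b' \in s by rewrite mem_filter => /andP[].
(* The chosen cube meets itself, because it contains its centre, and so it is filtered out. *)
have sz : (size s' < size s)%N.
  rewrite size_filter -(count_predT s) ltn_neqAle.
  rewrite sub_count// andbT; apply/negP => /eqP e.
  have : all (fun b' => `[< qb (c b') (r b') `&` qb (c b) (r b) = set0 >]) s.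
    by rewrite all_count e count_predT.
  by move/allP/(_ _ bs)/asboolP; rewrite setIid => /seteqP[/(_ _ bb)].
have H' := ih s' (leq_trans sz sm) (fun b' h => r0 _ (s's _ h)) (fun b' h => H _ (s's _ h)).
have dis : [disjoint qb (c b) (r b) & U s'].
  apply/eqP/seteqP; split => // x [bx [b']]; rewrite mem_filter => /andP[/asboolP e _] b'x.
  by move/seteqP : e => [/(_ x) e _]; exact: e.
apply: (@le_trans _ _ (mu (qb (c b) (3 * r b) `|` U s'))).
  apply: le_mu => x [b' b's b'x].
  have [e|/eqP/set0P[y [yb' yb]]] := pselect (qb (c b') (r b') `&` qb (c b) (r b) = set0).
    by right; exists b' => //; rewrite mem_filter b's andbT; apply/asboolP.
  left; rewrite /qb/=; have le_r := bmax _ b's.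
  have e : x - c b = (x - c b') + ((c b' - y) + (y - c b)) by rewrite !subrKA.
  rewrite e (le_trans (ler_normD _ _))//; have := ler_normD (c b' - y) (y - c b).
  have h1 : `|x - c b'| <= r b' by [].
  have h2 : `|c b' - y| <= r b' by rewrite distrC.
  have h3 : `|y - c b| <= r b by [].
  lra.
apply: (le_trans (mu_subU _ _)).
have b20 : 0 <= r b by exact: r0.
have -> : mu (qb (c b) (3 * r b)) = ((3 ^+ n)%:E * mu (qb (c b) (r b)))%E.
  by rewrite !mu_qb ?mulr_ge0// -EFinM -exprMn mulrCA.
apply: (@le_trans _ _ ((3 ^+ n)%:E * \int[mu]_(x in qb (c b) (r b) `|` U s') g x)%E).
  rewrite ge0_integral_setU//; try exact: mU; try exact: measurable_qb; try exact: measurable_funTS.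
  rewrite ge0_muleDr ?integral_ge0// leeD// lee_wpmul2l ?lee_fin ?exprn_ge0//.
  exact: H.
rewrite lee_wpmul2l ?lee_fin ?exprn_ge0//; apply: ge0_subset_integral => //.
- by apply: measurableU; [exact: measurable_qb|exact: mU].
- exact: measurable_funTS.
- by move=> x [h|[b' /s's b's h]]; [exists b|exists b'].
Qed.

Lemma vitali_countable (J : set nat) :
  (forall i, J i -> 0 <= r i) ->
  (forall i, J i -> (mu (qb (c i) (r i)) <= \int[mu]_(x in qb (c i) (r i)) g x)%E) ->
  (mu (\bigcup_(i in J) qb (c i) (r i)) <= (3 ^+ n)%:E * \int[mu]_x g x)%E.
Proof.
move=> r0 H.
pose s N := [seq i <- iota 0 N | `[< J i >]].
have sP N i : i \in s N <-> (i < N)%N /\ J i.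
  rewrite mem_filter mem_iota/= add0n; split.
    by move=> /andP[/asboolP].
  by move=> [-> Ji]; rewrite andbT; apply/asboolP.
have -> : \bigcup_(i in J) qb (c i) (r i) = \bigcup_N U (s N).
  apply/seteqP; split => x.
    by move=> [i Ji ix]; exists i.+1 => //; exists i => //; apply/sP.
  by move=> [N _ [i /sP[_ Ji] h]]; exists i.
have ndU : nondecreasing_seq (U \o s).
  move=> N M NM; apply/subsetPset => x [i /sP[iN Ji] h].
  by exists i => //; apply/sP; split => //; exact: leq_trans NM.
have := @nondecreasing_cvg_mu _ LT R mu (U \o s) (fun N => mU _)
  (bigcupT_measurable _ (fun N => mU _)) ndU.
move=> /(cvg_lim (@ereal_hausdorff R)) <-.
apply: lime_le.
  apply/ereal_nondecreasing_is_cvgn => N M NM; apply: le_mu.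
  exact/subsetPset/ndU.
apply: nearW => N /=; apply: (le_trans (@vitali_finite (s N) _ _)).
- by move=> b /sP[_ Ji]; exact: r0.
- by move=> b /sP[_ Ji]; exact: H.
- rewrite lee_wpmul2l ?lee_fin ?exprn_ge0//; exact: ge0_subset_integral.
Qed.

End covering.

Section weak_type.
Context {R : realType} {n : nat}.
Local Notation mu := (@lebesgue_rV R n).
Local Notation LT := (@lebesgue_space R n).
Variable g : LT -> \bar R.

(** The set where the maximal function over grid cubes exceeds [A]. The maximal function itself is
    never formed; only these countable unions of cubes are used. *)
Definition grid_level_set (A : R) : set 'rV[R]_n :=
  \bigcup_(k in [set k | (A%:E * mu (grid_cube k) < \int[mu]_(x in grid_cube k) g x)%E])
    grid_cube k.

Lemma measurable_grid_level_set A : measurable (grid_level_set A : set LT).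
Proof. by apply: bigcup_measurable => k _; exact: measurable_qb. Qed.

Hypothesis mg : measurable_fun [set: LT] g.
Hypothesis g0 : forall x, (0 <= g x)%E.

(** The covering lemma applied to [g] divided by [A]: each selected cube has measure at most the
    integral of that quotient over it. *)
Lemma weak_type_grid (A : R) : 0 < A ->
  (A%:E * mu (grid_level_set A) <= (3 ^+ n)%:E * \int[mu]_x g x)%E.
Proof.
move=> A0; pose h (x : LT) := ((A^-1)%:E * g x)%E.
have Ai0 : (0 <= A^-1)%R by rewrite invr_ge0 ltW.
have mh : measurable_fun [set: LT] h by exact: measurable_funeM.
have h0 x : (0 <= h x)%E by rewrite mule_ge0// lee_fin.
have ih D : measurable (D : set LT) ->
    (\int[mu]_(x in D) h x = (A^-1)%:E * \int[mu]_(x in D) g x)%E.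
  by move=> mD; rewrite ge0_integralZl_EFin//; exact: measurable_funTS.
have H := @vitali_countable R n h mh h0 grid_center grid_radius
  [set k | (A%:E * mu (grid_cube k) < \int[mu]_(x in grid_cube k) g x)%E]
  (fun k _ => ltW (grid_radius_gt0 k)).
rewrite ih// in H.
rewrite -(@lee_pmul2l _ (A^-1)%:E) ?lte_fin ?invr_gt0//.
rewrite muleA -EFinM mulVf ?gt_eqF// mul1e muleCA; apply: H => k /= /ltW hk.
rewrite ih; last exact: measurable_qb.
rewrite -(@lee_pmul2l _ A%:E) ?lte_fin// muleA -EFinM divff ?gt_eqF// mul1e.
exact: hk.
Qed.

End weak_type.

(** * Rearrangements and discrete Lorentz norms *)

Section nonmeasurable_integral.
Context d (T : measurableType d) (R : realType) (mu : {measure set T -> \bar R}).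
Local Open Scope ereal_scope.

(* The library version asks for measurability of both functions. *)
Lemma ge0_le_integral_nomeas (D : set T) (f g : T -> \bar R) :
  (forall x, D x -> 0 <= f x) -> (forall x, D x -> f x <= g x) ->
  \int[mu]_(x in D) f x <= \int[mu]_(x in D) g x.
Proof.
move=> f0 fg; rewrite integral_mkcond [leRHS]integral_mkcond.
have h1 x : 0 <= (f \_ D) x by exact: erestrict_ge0.
have h2 x : (f \_ D) x <= (g \_ D) x by exact: lee_restrict.
rewrite !ge0_integralTE//; last by move=> x; exact: le_trans (h1 x) (h2 x).
apply: le_ereal_sup => _ [h /= hf <-]; exists h => // x.
exact: le_trans (hf x) (h2 x).
Qed.

Lemma measure_bigcup_le (F : nat -> set T) (M : \bar R) :
  (forall k, measurable (F k)) -> nondecreasing_seq F ->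
  (forall k, mu (F k) <= M) -> mu (\bigcup_k F k) <= M.
Proof.
move=> mF ndF FM.
have := @nondecreasing_cvg_mu _ T R mu F mF (bigcupT_measurable _ mF) ndF.
move=> /(cvg_lim (@ereal_hausdorff R)) <-; apply: lime_le; last exact: nearW.
apply/ereal_nondecreasing_is_cvgn => N M' NM; apply: le_measure; rewrite ?inE//.
exact/subsetPset/ndF.
Qed.

End nonmeasurable_integral.

Section dyadic_integral.
Context {R : realType}.
Local Open Scope ereal_scope.
Local Notation lam := (@lebesgue_measure R).

(** A fixed bijection from [nat] to the integers, through which sums over all dyadic scales become
    series and inherit interchange and scaling. *)
Definition int_of_idx (k : nat) : int := if odd k then Negz k./2 else Posz k./2.

Definition idx_of_int (l : int) : nat :=
  match l with Posz k => k.*2 | Negz k => k.*2.+1 end.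

Lemma int_of_idxK : cancel int_of_idx idx_of_int.
Proof.
move=> k; rewrite /int_of_idx -[in RHS](odd_double_half k).
by case: (odd k).
Qed.

Lemma idx_of_intK : cancel idx_of_int int_of_idx.
Proof.
by case=> k; rewrite /int_of_idx /= ?odd_double//= ?uphalf_double ?doubleK.
Qed.

Lemma set_bij_int_of_idx : set_bij [set: nat] [set: int] int_of_idx.
Proof.
rewrite setTT_bijective; exact: Bijective int_of_idxK idx_of_intK.
Qed.

Lemma esum_int_series (a : int -> \bar R) : (forall l, 0 <= a l) ->
  \esum_(l in [set: int]) a l = \sum_(k <oo) a (int_of_idx k).
Proof.
move=> a0; rewrite (reindex_esum [set: nat] _ int_of_idx); last exact: set_bij_int_of_idx.
by rewrite nneseries_esumT.
Qed.

Lemma esum_int_shift (a : int -> \bar R) (m : int) :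
  \esum_(l in [set: int]) a (l + m)%R = \esum_(l in [set: int]) a l.
Proof.
rewrite [RHS](reindex_esum [set: int] _ (fun l => l + m)%R)//.
by rewrite setTT_bijective; exists (fun l => l - m)%R => l; rewrite ?addrK ?subrK.
Qed.

Definition dyadic_itv (l : int) : set R := `[(2 ^ l)%R, (2 ^ (l + 1))%R[%classic.

Definition dyadic_level (t : R) : int := xget (Posz 0) [set l | dyadic_itv l t].

Lemma exp2zS (l : int) : ((2 : R) ^ (l + 1) = 2 * 2 ^ l)%R.
Proof. by rewrite expfzDr ?pnatr_eq0// expr1z mulrC. Qed.

Lemma dyadic_itv_inj l m t : dyadic_itv l t -> dyadic_itv m t -> l = m.
Proof.
rewrite /dyadic_itv/= !in_itv/= => /andP[h1 h2] /andP[h3 h4].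
have := le_lt_trans h1 h4; have := le_lt_trans h3 h2.
by rewrite !ltr_eXz2l ?ltr1n// !ltzD1 => ? ?; apply/eqP; rewrite eq_le; apply/andP.
Qed.

Lemma dyadic_levelP t : (0 < t)%R -> dyadic_itv (dyadic_level t) t.
Proof.
move=> t0; rewrite /dyadic_level; case: xgetP => [l -> //|] /=.
have [l h] := exp2z_bracket t0.
by move=> /(_ l); rewrite /dyadic_itv /= in_itv /= h => /(_ isT).
Qed.

Lemma dyadic_levelE l t : dyadic_itv l t -> dyadic_level t = l.
Proof.
move=> h; apply: dyadic_itv_inj (h); apply: dyadic_levelP.
by move: h; rewrite /dyadic_itv/= in_itv/= => /andP[/(lt_le_trans (exp2z_gt0 l))].
Qed.

Lemma integral_dyadic_step (a : int -> \bar R) : (forall l, 0 <= a l) ->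
  \int[lam]_(t in `]0%R, +oo[) a (dyadic_level t) =
  \esum_(l in [set: int]) (a l * (2 ^ l)%:E).
Proof.
move=> a0.
have E : `]0%R, +oo[%classic = \bigcup_k dyadic_itv (int_of_idx k).
  apply/seteqP; split => t /=.
    rewrite in_itv/= andbT => /dyadic_levelP h; exists (idx_of_int (dyadic_level t)) => //.
    by rewrite idx_of_intK.
  move=> [k _]; rewrite /dyadic_itv/= !in_itv/= andbT => /andP[+ _].
  exact/lt_le_trans/exp2z_gt0.
have mJ l : measurable (dyadic_itv l) by exact: measurable_itv.
have mE l : lam `[(2 ^ l)%R, (2 ^ (l + 1))%R[%classic = (2 ^ l)%:E.
  rewrite lebesgue_measure_itv/= lte_fin ltr_eXz2l ?ltr1n// ltzD1 lexx.
  by rewrite -EFinB exp2zS mulr_natl mulr2n addrK.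
have eqJ k : {in dyadic_itv (int_of_idx k), cst (a (int_of_idx k)) =1 (a \o dyadic_level)}.
  by move=> t /set_mem h /=; rewrite (dyadic_levelE h).
rewrite esum_int_series; last by move=> l; rewrite mule_ge0// lee_fin ltW// exp2z_gt0.
rewrite E ge0_integral_bigcup//.
- apply: eq_eseriesr => k _.
  transitivity (\int[lam]_(t in dyadic_itv (int_of_idx k)) cst (a (int_of_idx k)) t).
    by apply: eq_integral => t /set_mem h; rewrite (dyadic_levelE h).
  rewrite integral_cst; last exact: mJ.
  congr (_ * _); exact: mE.
- by move=> k; exact: mJ.
- apply/measurable_fun_bigcup => [k|k]; first exact: mJ.
  exact: eq_measurable_fun (eqJ k) _.
- apply/trivIsetP => i j _ _ ij; apply/seteqP; split => // t [h1 h2].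
  by move/eqP : ij; apply; apply: (can_inj int_of_idxK); exact: dyadic_itv_inj h1 h2.
Qed.

End dyadic_integral.

Section rearrangement_facts.
Context {R : realType} {n : nat}.
Local Notation mu := (@lebesgue_rV R n).
Local Notation LT := (@lebesgue_space R n).
Implicit Types (g h : 'rV[R]_n -> \bar R).
Local Open Scope ereal_scope.

Lemma rearrangement_ge0 g t : 0 <= rearrangement g t.
Proof. by apply: le_ereal_inf_tmp => _ [a [/ltW a0 _] <-]; rewrite lee_fin. Qed.

Lemma rearrangement_le g t (a : R) : (0 < a)%R ->
  distribution_function g a <= t%:E -> rearrangement g t <= a%:E.
Proof. by move=> a0 ha; apply: ereal_inf_lbound; exists a. Qed.

Lemma rearrangement_noninc g t t' : (t <= t')%R ->
  rearrangement g t' <= rearrangement g t.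
Proof.
move=> tt'; apply: le_ereal_inf => _ [a [a0 ha] <-]; exists a => //; split => //.
by rewrite (le_trans ha)// lee_fin.
Qed.

Lemma distribution_function_le g h a : (forall x, `|g x| <= `|h x|) ->
  distribution_function g a <= distribution_function h a.
Proof. by move=> gh; apply: le_mu => x /= /lt_le_trans; apply. Qed.

Lemma distribution_function_noninc g (a b : R) : (a <= b)%R ->
  distribution_function g b <= distribution_function g a.
Proof. by move=> ab; apply: le_mu => x /=; apply: le_lt_trans; rewrite lee_fin. Qed.

Lemma le_rearrangement g h t : (forall x, `|g x| <= `|h x|) ->
  rearrangement g t <= rearrangement h t.
Proof.
move=> gh; apply: le_ereal_inf => _ [a [a0 ha] <-]; exists a => //; split => //.
exact: le_trans (distribution_function_le _ gh) ha.
Qed.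

Lemma rearrangement_lt g t (a : R) : rearrangement g t < a%:E ->
  distribution_function g a <= t%:E.
Proof.
move=> /ereal_inf_lt[_ [b [b0 hb] <-]]; rewrite lte_fin => /ltW ba.
exact: le_trans (distribution_function_noninc _ ba) hb.
Qed.

(** The infimum defining the rearrangement need not be attained a priori. The strict level set is
    the increasing union of those at slightly higher levels, each of measure at most [t];
    measurability gives continuity from below. *)
Lemma mu_gt_rearrangement g t : measurable_fun [set: LT] g -> (0 <= t)%R ->
  mu [set x | rearrangement g t < `|g x| ] <= t%:E.
Proof.
move=> mg t0; have := rearrangement_ge0 g t.
case E : (rearrangement g t) => [a| |]//= a0; last first.
  rewrite (_ : [set x | _] = set0) ?measure0 ?lee_fin//.
  by apply/seteqP; split => // x /=; rewrite ltNge leey.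
have -> : [set x | a%:E < `|g x| ] =
    \bigcup_k [set x | (a + k.+1%:R^-1)%:E < `|g x| ].
  apply/seteqP; split => x /=; last first.
    by move=> [k _ /=]; apply: le_lt_trans; rewrite lee_fin lerDl.
  case E2 : (`|g x|) => [b| |]//; last by exists 0%N => //=; rewrite E2 ltry.
  rewrite lte_fin => ab; have /ltr_add_invr[k hk] := ab.
  by exists k => //=; rewrite E2 lte_fin.
apply: measure_bigcup_le.
- move=> k; have mag : measurable_fun [set: LT] (abse \o g) by exact: measurableT_comp.
  by have := emeasurable_fun_o_infty measurableT mag (a + k.+1%:R^-1)%:E; rewrite setTI.
- move=> k m km; apply/subsetPset => x /=; apply: le_lt_trans.
  by rewrite lee_fin lerD2l lef_pV2 ?posrE// ler_nat.
- move=> k; apply: rearrangement_lt; rewrite E lte_fin ltrDl.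
  by rewrite invr_gt0.
Qed.

Lemma rearrangementZ_le g t (C : R) : (0 < C)%R ->
  rearrangement (fun x => C%:E * g x) t <= C%:E * rearrangement g t.
Proof.
move=> C0; rewrite -lee_pdivrMl// le_ereal_inf_tmp// => _ [a [a0 ha] <-].
rewrite lee_pdivrMl// -EFinM; apply: rearrangement_le; first by rewrite mulr_gt0.
apply: le_trans ha; apply: le_mu => x /=.
by rewrite abseM gee0_abs ?lee_fin ?ltW// EFinM lte_pmul2l.
Qed.

Lemma rearrangement_eq0 g t (A : set 'rV[R]_n) : (forall x, ~ A x -> g x = 0) ->
  mu A <= t%:E -> rearrangement g t = 0.
Proof.
move=> gA At; apply/eqP; rewrite eq_le rearrangement_ge0 andbT.
apply/lee_addgt0Pr => e e0; rewrite add0e; apply: rearrangement_le => //.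
apply: le_trans At; apply: le_mu => x /=; apply: contraPP => /gA ->.
by rewrite abse0 lte_fin; apply/negP; rewrite -leNgt ltW.
Qed.

End rearrangement_facts.

Section ereal_tools.
Context {R : realType}.
Local Open Scope ereal_scope.
Implicit Types (x y : \bar R) (r : R).

Lemma lee_poweR r x y : (0 <= r)%R -> 0 <= x -> x <= y -> x `^ r <= y `^ r.
Proof.
move=> r0 x0 xy; apply: gt0_ler_poweR => //; rewrite in_itv/= leey andbT//.
exact: le_trans x0 xy.
Qed.

Lemma poweRK r x : r != 0%R -> 0 <= x -> (x `^ r) `^ r^-1 = x.
Proof. by move=> r0 x0; rewrite -poweRrM divff// poweRe1. Qed.

Lemma poweRVK r x : r != 0%R -> 0 <= x -> (x `^ r^-1) `^ r = x.
Proof. by move=> r0 x0; rewrite -poweRrM mulVf// poweRe1. Qed.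

Lemma lee_poweRK r x y : (0 < r)%R -> 0 <= x -> 0 <= y ->
  x `^ r <= y -> x <= y `^ r^-1.
Proof.
move=> r0 x0 y0 xy; rewrite -(@poweRK r x) ?gt_eqF//.
by apply: lee_poweR => //; [rewrite invr_ge0 ltW|exact: poweR_ge0].
Qed.

Lemma lee_poweRVK r x y : (0 < r)%R -> 0 <= x -> 0 <= y ->
  x `^ r^-1 <= y -> x <= y `^ r.
Proof.
by move=> r0 x0 y0 xy; rewrite -[r in y `^ r]invrK; apply: lee_poweRK => //; rewrite invr_gt0.
Qed.

Lemma esum_intZ (a : int -> \bar R) (c : R) : (0 <= c)%R -> (forall l, 0 <= a l) ->
  \esum_(l in [set: int]) (c%:E * a l) = c%:E * \esum_(l in [set: int]) a l.
Proof.
move=> c0 a0; rewrite !esum_int_series//; last by move=> l; rewrite mule_ge0.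
exact: nneseriesZl.
Qed.

Lemma nneseries_term (u : nat -> \bar R) m : (forall k, 0 <= u k) ->
  u m <= \sum_(k <oo) u k.
Proof.
move=> u0; rewrite (nneseriesD1 (n := m))// leeDl//.
by apply: nneseries_ge0.
Qed.

Lemma nneseries_geometric (x : R) : (0 <= x < 1)%R ->
  \sum_(k <oo) (x ^+ k)%:E = ((1 - x)^-1)%:E.
Proof.
move=> /andP[x0 x1]; apply/cvg_lim => //.
have H : (`|x| < 1)%R by rewrite ger0_norm.
have := cvg_geometric_series (a := 1%R) H; rewrite div1r => {}H.
rewrite (_ : (fun k => _) = EFin \o series (geometric 1 x)).
  by apply: cvg_EFin H; exact: nearW.
apply/funext => k /=; rewrite /series/= -sumEFin; apply: eq_bigr => i _.
by rewrite mul1r.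
Qed.

End ereal_tools.

Section dyadic_lorentz.
Context {R : realType}.
Local Open Scope ereal_scope.
Implicit Types (q A B : R) (r : \bar R) (h : int -> \bar R).

Definition dweight q (l : int) : R := (2 `^ (l%:~R / q))%R.

(* [dyadic_lorentz q r h A] bounds by [A] the discrete Lorentz quasi-norm of
   the samples [h l] of a rearrangement at the points [2 ^ l]. *)
Definition dyadic_lorentz q r h A : Prop :=
  match r with
  | r0%:E => \esum_(l in [set: int]) ((dweight q l)%:E * h l) `^ r0 <= (A `^ r0)%:E
  | +oo => forall l, (dweight q l)%:E * h l <= A%:E
  | -oo => True
  end.

Lemma dweight_gt0 q l : (0 < dweight q l)%R.
Proof. by rewrite powR_gt0. Qed.

Lemma dweightD q l m : dweight q (l + m) = (dweight q l * dweight q m)%R.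
Proof. by rewrite /dweight intrD mulrDl powRD// pnatr_eq0 implybT. Qed.

Lemma dweight1E q : dweight q 1 = (2 `^ q^-1)%R.
Proof. by rewrite /dweight div1r. Qed.

Lemma powR_exp2z q (l : int) : ((2 ^ l) `^ q^-1 = dweight q l)%R.
Proof. by rewrite /dweight powRrM -powR_intmul. Qed.

Lemma dyadic_term_ge0 q l (x : \bar R) : 0 <= x -> 0 <= (dweight q l)%:E * x.
Proof. by move=> h0; rewrite mule_ge0// lee_fin ltW// dweight_gt0. Qed.

Lemma dyadic_lorentz_le q r h h' A A' : 0 < r -> (0 <= A)%R -> (A <= A')%R ->
  (forall l, 0 <= h' l <= h l) -> dyadic_lorentz q r h A -> dyadic_lorentz q r h' A'.
Proof.
move=> + A0 AA' hh'; case: r => [r| |]//=.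
  rewrite lte_fin => r0 H.
  apply: (@le_trans _ _ (A `^ r)%:E); last first.
    by rewrite lee_fin ge0_ler_powR ?nnegrE ?(ltW r0)//; exact: le_trans AA'.
  apply: le_trans H; apply: le_esum => l _; have /andP[h0 hl] := hh' l.
  apply: lee_poweR; [exact: ltW|exact: dyadic_term_ge0|].
  by rewrite lee_wpmul2l// lee_fin ltW// dweight_gt0.
move=> _ H l; have /andP[h0 hl] := hh' l.
apply: (@le_trans _ _ A%:E); last by rewrite lee_fin.
by apply: le_trans (H l); rewrite lee_wpmul2l// lee_fin ltW// dweight_gt0.
Qed.

Lemma dyadic_lorentz_weak q r h A l : 0 < r -> (0 <= A)%R -> (forall l, 0 <= h l) ->
  dyadic_lorentz q r h A -> (dweight q l)%:E * h l <= A%:E.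
Proof.
move=> + A0 h0; case: r => [r| |]//=; rewrite lte_fin => r0 H.
have t0 m : 0 <= ((dweight q m)%:E * h m) `^ r by exact: poweR_ge0.
have := nneseries_term (idx_of_int l) (fun k => t0 (int_of_idx k)).
rewrite idx_of_intK -(esum_int_series t0) => /le_trans/(_ H).
move=> h1; rewrite -[leRHS](@poweRK _ r) ?lee_fin ?gt_eqF//.
by apply: lee_poweRK => //; [exact: dyadic_term_ge0|exact: poweR_ge0].
Qed.

(** The discrete form of the dilation t -> 2^m t: the weight factors, and a sum over all integers is
    invariant under translation. *)
Lemma dyadic_lorentz_shift q r h A m : (0 <= A)%R -> (forall l, 0 <= h l) ->
  dyadic_lorentz q r h A ->
  dyadic_lorentz q r (fun l => h (l + m)%R) (dweight q (- m) * A).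
Proof.
move=> A0 h0; have E l : dweight q l = (dweight q (- m) * dweight q (l + m))%R.
  by rewrite -dweightD addrC addrK.
have w0 := ltW (dweight_gt0 q (- m)); case: r => [r| |]//=.
  move=> H; rewrite powRM// EFinM.
  rewrite (eq_esum (b := fun l => ((dweight q (- m)) `^ r)%:E *
      ((dweight q (l + m))%:E * h (l + m)%R) `^ r)); last first.
    move=> l _; rewrite E EFinM -muleA [LHS]poweRM ?poweR_EFin//.
    exact: dyadic_term_ge0.
  rewrite esum_intZ ?powR_ge0//; last by move=> l; exact: poweR_ge0.
  rewrite lee_wpmul2l ?lee_fin ?powR_ge0//.
  by rewrite (esum_int_shift (fun l => ((dweight q l)%:E * h l) `^ r)).
move=> H l; rewrite E !EFinM -muleA lee_wpmul2l ?lee_fin//.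
Qed.

Lemma dyadic_lorentz_scale q r h A c : (0 <= A)%R -> (0 <= c)%R -> (forall l, 0 <= h l) ->
  dyadic_lorentz q r h A -> dyadic_lorentz q r (fun l => c%:E * h l) (c * A).
Proof.
move=> A0 c0 h0; case: r => [r| |]//= H.
  rewrite powRM// EFinM.
  rewrite (eq_esum (b := fun l => (c `^ r)%:E * ((dweight q l)%:E * h l) `^ r)); last first.
    move=> l _; rewrite muleCA [LHS]poweRM ?poweR_EFin//.
    exact: dyadic_term_ge0.
  rewrite esum_intZ ?powR_ge0//; last by move=> l; exact: poweR_ge0.
  by rewrite lee_wpmul2l ?lee_fin ?powR_ge0.
by move=> l; rewrite muleCA EFinM lee_wpmul2l ?lee_fin.
Qed.

(** The r-th power of a supremum is at most the sum of the r-th powers for every r > 0. Suprema thus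
    replace sums, and geometric decay suffices even where the quasi-norm has no triangle
    inequality. *)
Lemma dyadic_lorentz_sup q r (x : R) : 0 < r -> (0 <= x < 1)%R ->
  exists C : R, (0 < C)%R /\ forall (h : nat -> int -> \bar R) A, (0 <= A)%R ->
    (forall m l, 0 <= h m l) ->
    (forall m, dyadic_lorentz q r (h m) (x ^+ m * A)) ->
    dyadic_lorentz q r (fun l => ereal_sup (range (h ^~ l))) (C * A).
Proof.
move=> + /andP[x0 x1]; case: r => [r| |]//=.
  rewrite lte_fin => r0; have y0 : (0 <= x `^ r)%R by exact: powR_ge0.
  have y1 : (x `^ r < 1)%R.
    by have := @gt0_ltr_powR _ r r0 x 1%R; rewrite powR1; apply; rewrite ?nnegrE ?ler01.
  have z0 : (0 < (1 - x `^ r)^-1)%R by rewrite invr_gt0 subr_gt0.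
  exists ((1 - x `^ r)^-1 `^ r^-1)%R; split; first exact: powR_gt0.
  move=> h A A0 h0 H.
  rewrite powRM ?powR_ge0// -powRrM mulVf ?gt_eqF// powRr1 ?(ltW z0)// EFinM.
  have t0 m l : 0 <= ((dweight q l)%:E * h m l) `^ r by exact: poweR_ge0.
  have h0' l : 0 <= ereal_sup (range (h ^~ l)).
    by apply: le_trans (h0 0%N l) _; apply: ereal_sup_ubound; exists 0%N.
  apply: (@le_trans _ _ (\esum_(l in [set: int])
      \sum_(m <oo) ((dweight q l)%:E * h m l) `^ r)).
    apply: le_esum => l _; have S0 : 0 <= \sum_(m <oo) ((dweight q l)%:E * h m l) `^ r.
      exact: nneseries_ge0.
    rewrite -[leRHS](@poweRVK _ r) ?gt_eqF//; apply: lee_poweR; first exact: ltW.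
      exact: dyadic_term_ge0.
    rewrite -ereal_sup_pZl ?dweight_gt0//; apply: ge_ereal_sup => _ [_ [m _ <-] <-].
    apply: lee_poweRK => //; first exact: dyadic_term_ge0.
    exact: (nneseries_term m (t0 ^~ l)).
  rewrite esum_int_series; last by move=> l; exact: nneseries_ge0.
  rewrite nneseries_interchange//.
  apply: (@le_trans _ _ (\sum_(m <oo) ((A `^ r)%:E * ((x `^ r) ^+ m)%:E))).
    apply: lee_nneseries => m // _; first by move=> _; exact: nneseries_ge0.
    rewrite -(esum_int_series (t0 m)); apply: le_trans (H m) _.
    rewrite -EFinM lee_fin; apply: le_of_eq.
    rewrite powRM ?exprn_ge0// mulrC; congr (_ * _)%R.
    by rewrite -powR_mulrn// -powRrM mulrC powRrM powR_mulrn.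
  rewrite nneseriesZl; last by move=> m _; rewrite lee_fin exprn_ge0.
  by rewrite nneseries_geometric ?y0// muleC.
move=> _; exists 1%R; split => // h A A0 h0 H l; rewrite mul1r.
rewrite -ereal_sup_pZl ?dweight_gt0//; apply: ge_ereal_sup => _ [_ [m _ <-] <-].
apply: le_trans (H m l) _; rewrite lee_fin ler_piMl// exprn_ile1//; exact: ltW.
Qed.

Lemma dyadic_lorentz_max q r : 0 < r ->
  exists C : R, (0 < C)%R /\ forall h1 h2 A, (0 <= A)%R ->
    (forall l, 0 <= h1 l) -> (forall l, 0 <= h2 l) ->
    dyadic_lorentz q r h1 A -> dyadic_lorentz q r h2 A ->
    dyadic_lorentz q r (fun l => maxe (h1 l) (h2 l)) (C * A).
Proof.
case: r => [r| |]//=.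
  rewrite lte_fin => r0; exists (2 `^ r^-1)%R; split; first by rewrite powR_gt0.
  move=> h1 h2 A A0 h10 h20 H1 H2.
  rewrite powRM ?powR_ge0// -powRrM mulVf ?gt_eqF// powRr1//.
  apply: (@le_trans _ _ (\esum_(l in [set: int])
      (((dweight q l)%:E * h1 l) `^ r + ((dweight q l)%:E * h2 l) `^ r))).
    apply: le_esum => l _; case: (leP (h1 l) (h2 l)) => _.
      by rewrite leeDr// poweR_ge0.
    by rewrite leeDl// poweR_ge0.
  rewrite esumD; [|by move=> *; exact: poweR_ge0|by move=> *; exact: poweR_ge0].
  by rewrite mulr_natl mulr2n EFinD leeD.
move=> _; exists 1%R; split => // h1 h2 A A0 h10 h20 H1 H2 l; rewrite mul1r.
by case: (leP (h1 l) (h2 l)) => _.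
Qed.

End dyadic_lorentz.

Section lorentz_discretization.
Context {R : realType} {n : nat}.
Local Open Scope ereal_scope.
Implicit Types (q A B : R) (r : \bar R) (g : 'rV[R]_n -> \bar R).

Definition rearrangement2 g (l : int) : \bar R := rearrangement g (2 ^ l)%R.

Lemma rearrangement2_ge0 g l : 0 <= rearrangement2 g l.
Proof. exact: rearrangement_ge0. Qed.

Lemma dyadic_level_bounds q (t : R) : (0 < q)%R -> (0 < t)%R ->
  (dweight q (dyadic_level t) <= t `^ q^-1 <= dweight q (dyadic_level t + 1))%R /\
  (2 ^ dyadic_level t <= t <= 2 ^ (dyadic_level t + 1))%R.
Proof.
move=> q0 t0; have := dyadic_levelP t0.
rewrite /dyadic_itv /= in_itv /= => /andP[h1 /ltW h2]; rewrite h1 h2; split => //.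
rewrite -!powR_exp2z !ge0_ler_powR ?nnegrE ?invr_ge0 ?(ltW (exp2z_gt0 _)) ?(ltW t0) ?(ltW q0)//.
Qed.

Lemma lorentz_dyadic q r : (0 < q)%R -> 0 < r -> exists C : R, (0 < C)%R /\
  forall g B, (0 <= B)%R -> lorentz_norm q r g <= B%:E ->
    dyadic_lorentz q r (rearrangement2 g) (C * B).
Proof.
move=> q0; case: r => [r| |]//=; last first.
  move=> _; exists 1%R; split => // g B B0 H l; rewrite mul1r.
  apply: le_trans H; apply: ereal_sup_ubound; exists (2 ^ l)%R; first exact: exp2z_gt0.
  by rewrite powR_exp2z.
rewrite lte_fin => r0.
pose c := (2 `^ q^-1 `^ r * 2)%R; have c0 : (0 < c)%R by rewrite mulr_gt0 ?powR_gt0.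
exists (c `^ r^-1)%R; split; first exact: powR_gt0.
move=> g B B0 /lee_poweRVK -/(_ r0) H.
have {}H : \int[lebesgue_measure]_(t in `]0%R, +oo[)
         (((t `^ q^-1)%:E * rearrangement g t) `^ r * (t^-1)%:E) <= (B `^ r)%:E.
  rewrite -poweR_EFin; apply: H; last by rewrite lee_fin.
  apply: integral_ge0 => t /=; rewrite in_itv/= andbT => t0.
  by rewrite mule_ge0 ?poweR_ge0// lee_fin invr_ge0 ltW.
pose b l := ((dweight q l)%:E * rearrangement2 g l) `^ r.
have b0 l : 0 <= b l by exact: poweR_ge0.
pose a l := ((dweight q l)%:E * rearrangement2 g (l + 1)%R) `^ r * ((2 ^ (l + 1))^-1)%:E.
have a0 l : 0 <= a l by rewrite mule_ge0 ?poweR_ge0// lee_fin invr_ge0 ltW ?exp2z_gt0.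
have Ha : \esum_(l in [set: int]) (a l * (2 ^ l)%:E) <= (B `^ r)%:E.
  rewrite -integral_dyadic_step//; apply: le_trans H.
  apply: ge0_le_integral_nomeas => //= t; rewrite in_itv/= andbT => t0.
  have [/andP[h1 h2] /andP[h3 h4]] := dyadic_level_bounds q0 t0.
  apply: lee_pmul; rewrite ?poweR_ge0 ?lee_fin ?invr_ge0 ?(ltW (exp2z_gt0 _)) ?(ltW t0)//.
    apply: lee_poweR; [exact: ltW|by rewrite dyadic_term_ge0 ?rearrangement2_ge0|].
    apply: lee_pmul => //; [by rewrite lee_fin ltW ?dweight_gt0|exact: rearrangement2_ge0|].
    exact: rearrangement_noninc.
  by rewrite lef_pV2 ?posrE ?exp2z_gt0.
rewrite powRM ?powR_ge0// -powRrM mulVf ?gt_eqF// powRr1 ?(ltW c0)// EFinM.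
rewrite -[X in X <= _](esum_int_shift b 1).
rewrite -lee_pdivrMl//; apply: le_trans Ha; rewrite -esum_intZ ?invr_ge0 ?(ltW c0)//.
apply: le_esum => l _; rewrite /a /b.
have -> : (dweight q (l + 1))%:E = (2 `^ q^-1)%:E * (dweight q l)%:E.
  by rewrite dweightD dweight1E mulrC EFinM.
rewrite -muleA (@poweRM _ (2 `^ q^-1)%:E); last 2 first.
  by rewrite lee_fin powR_ge0.
  by rewrite dyadic_term_ge0 ?rearrangement2_ge0.
have e2 : ((2 ^ (l + 1))^-1 * 2 ^ l = 2^-1 :> R)%R.
  by rewrite exp2zS invfM mulfVK// gt_eqF// exp2z_gt0.
rewrite poweR_EFin muleA -[X in _ <= X]muleA -!EFinM e2.
rewrite muleC lee_wpmul2l ?poweR_ge0// lee_fin /c invfM mulrAC.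
by rewrite mulVf ?mul1r ?gt_eqF// powR_gt0// powR_gt0.
Qed.

Lemma dyadic_lorentz_norm q r g A : (0 < q)%R -> 0 < r -> (0 <= A)%R ->
  dyadic_lorentz q r (rearrangement2 g) A ->
  lorentz_norm q r g <= (2 `^ q^-1 * A)%:E.
Proof.
move=> q0; case: r => [r| |]//=; last first.
  move=> _ A0 H; apply: ge_ereal_sup => _ [t /= t0 <-].
  have [/andP[h1 h2] /andP[h3 h4]] := dyadic_level_bounds q0 t0.
  apply: (@le_trans _ _ ((dweight q (dyadic_level t + 1))%:E *
      rearrangement2 g (dyadic_level t))).
    apply: lee_pmul; rewrite ?lee_fin ?powR_ge0//; first exact: rearrangement_ge0.
    exact: rearrangement_noninc.
  rewrite dweightD dweight1E mulrC !EFinM -muleA lee_wpmul2l ?lee_fin ?powR_ge0//.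
rewrite lte_fin => r0 A0 H.
pose b l := ((dweight q l)%:E * rearrangement2 g l) `^ r.
have b0 l : 0 <= b l by exact: poweR_ge0.
pose a l := ((dweight q (l + 1))%:E * rearrangement2 g l) `^ r * ((2 ^ l)^-1)%:E.
have a0 l : 0 <= a l by rewrite mule_ge0 ?poweR_ge0// lee_fin invr_ge0 ltW ?exp2z_gt0.
have p0 : (0 <= 2 `^ q^-1 * A :> R)%R by rewrite mulr_ge0 ?powR_ge0.
rewrite -[leRHS](@poweRK _ r) ?gt_eqF ?lee_fin//.
apply: lee_poweR; first by rewrite invr_ge0 ltW.
  apply: integral_ge0 => t /=; rewrite in_itv/= andbT => t0.
  by rewrite mule_ge0 ?poweR_ge0// lee_fin invr_ge0 ltW.
apply: (@le_trans _ _ (\int[lebesgue_measure]_(t in `]0%R, +oo[) a (dyadic_level t))).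
  apply: ge0_le_integral_nomeas => //= t; rewrite in_itv/= andbT => t0.
    by rewrite mule_ge0 ?poweR_ge0// lee_fin invr_ge0 ltW.
  have [/andP[h1 h2] /andP[h3 h4]] := dyadic_level_bounds q0 t0.
  apply: lee_pmul; rewrite ?poweR_ge0 ?lee_fin ?invr_ge0 ?(ltW (exp2z_gt0 _)) ?(ltW t0)//.
    apply: lee_poweR; first exact: ltW.
      by rewrite mule_ge0 ?lee_fin ?powR_ge0// rearrangement_ge0.
    apply: lee_pmul; rewrite ?lee_fin ?powR_ge0//; first exact: rearrangement_ge0.
    exact: rearrangement_noninc.
  by rewrite lef_pV2 ?posrE ?exp2z_gt0.
rewrite integral_dyadic_step// poweR_EFin powRM ?powR_ge0// EFinM.
apply: (@le_trans _ _ (((2 `^ q^-1) `^ r)%:E * \esum_(l in [set: int]) b l)); last first.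
  by rewrite lee_wpmul2l ?lee_fin ?powR_ge0.
rewrite -esum_intZ ?powR_ge0//; apply: le_esum => l _; rewrite /a /b.
rewrite -muleA -EFinM mulVf ?gt_eqF ?exp2z_gt0// mule1.
rewrite dweightD dweight1E mulrC EFinM -muleA [X in X <= _]poweRM ?poweR_EFin//.
by rewrite dyadic_term_ge0 ?rearrangement2_ge0.
Qed.

End lorentz_discretization.

(** * Mass of selected cubes *)

Section series_of_indicators.
Context d (T : measurableType d) (R : realType) (mu : {measure set T -> \bar R}).
Local Open Scope ereal_scope.

Lemma measurable_fun_EFin_indic (E : set T) : measurable E ->
  measurable_fun [set: T] (fun x => (\1_E x)%:E : \bar R).
Proof. by move=> mE; apply/measurable_EFinP; exact: measurable_indic. Qed.

Lemma integral_cst_indic (D E : set T) (c : \bar R) : measurable D -> measurable E -> 0 <= c ->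
  \int[mu]_(x in D) (c * (\1_E x)%:E) = c * mu (E `&` D).
Proof.
move=> mD mE c0; rewrite ge0_integralZl ?integral_indic//.
exact/measurable_funTS/measurable_fun_EFin_indic.
Qed.

Lemma integral_series_indic (D : set T) (E : nat -> set T) (c : nat -> \bar R) :
  measurable D -> (forall i, measurable (E i)) -> (forall i, 0 <= c i) ->
  \int[mu]_(x in D) (\sum_(i <oo) (c i * (\1_(E i) x)%:E)) =
  \sum_(i <oo) (c i * mu (E i `&` D)).
Proof.
move=> mD mE c0; rewrite integral_nneseries//; last 2 first.
  by move=> i; apply/measurable_funTS/measurable_funeM/measurable_fun_EFin_indic.
  by move=> i x _; rewrite mule_ge0// lee_fin.
by apply: eq_eseriesr => i _; rewrite integral_cst_indic.
Qed.

End series_of_indicators.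

Section selection.
Context {R : realType} {n : nat}.
Local Notation mu := (@lebesgue_rV R n).
Local Notation LT := (@lebesgue_space R n).
Local Open Scope ereal_scope.

(** Half of each cube lies in [E], so its [K]-dilate carries at least its own measure under the
    density 2 K^n times the indicator of [E]. The covering lemma then applies to the dilates. *)
Lemma vitali_dense (E : set 'rV[R]_n) (J : set nat) (c : nat -> 'rV[R]_n)
    (rho : nat -> R) (K : R) : measurable (E : set LT) -> (1 <= K)%R ->
  (forall j, J j -> (0 <= rho j)%R) ->
  (forall j, J j -> mu (qb (c j) (rho j)) <= 2%:E * mu (qb (c j) (rho j) `&` E)) ->
  mu (\bigcup_(j in J) qb (c j) (K * rho j)) <= (3 ^+ n * (2 * K ^+ n))%:E * mu E.
Proof.
move=> mE K1 r0 H; have K0 : (0 <= K)%R by exact: le_trans K1.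
have k0 : (0 <= 2 * K ^+ n)%R by rewrite mulr_ge0// exprn_ge0.
pose g (x : LT) := (2 * K ^+ n)%:E * (\1_E x)%:E.
have mg : measurable_fun [set: LT] g.
  by apply: measurable_funeM; exact: measurable_fun_EFin_indic.
have g0 x : 0 <= g x by rewrite mule_ge0// lee_fin.
have ig D : measurable (D : set LT) -> \int[mu]_(x in D) g x = (2 * K ^+ n)%:E * mu (E `&` D).
  by move=> mD; apply: integral_cst_indic.
have := @vitali_countable R n g mg g0 c (fun j => K * rho j)%R J.
rewrite ig// setIT EFinM muleA; apply.
  by move=> j Jj; rewrite mulr_ge0// r0.
move=> j Jj; rewrite ig; last exact: measurable_qb.
have rj := r0 _ Jj; have Kr : (0 <= K * rho j)%R by rewrite mulr_ge0.
have -> : mu (qb (c j) (K * rho j)) = (K ^+ n)%:E * mu (qb (c j) (rho j)).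
  by rewrite !mu_qb// -EFinM -exprMn mulrCA.
rewrite mulrC EFinM -muleA lee_wpmul2l ?lee_fin ?exprn_ge0//.
apply: le_trans (H _ Jj) _; rewrite lee_wpmul2l//; apply: le_mu => x [h1 h2]; split => //.
by apply: qb_sub h1; rewrite subrr normr0 add0r ler_peMl.
Qed.

Variables (F : LT -> \bar R) (w s : R).
Hypotheses (mF : measurable_fun [set: LT] F) (F0 : forall x, 0 <= F x).
Hypotheses (w0 : (0 < w)%R) (s0 : (0 < s)%R).
Hypothesis F_vanish : exists m, rearrangement F (2 ^+ m * s) = 0.

Let f (i : nat) : \bar R := rearrangement F (2 ^+ i * s).

Let slices : \bar R := \sum_(i <oo) ((2 ^+ i.+1 * s)%:E * f i `^ w).

Lemma slice_integral :
  \int[mu]_(x in [set x | F x <= f 0%N]) (F x `^ w) <= slices.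
Proof.
have f0 i : 0 <= f i by exact: rearrangement_ge0.
pose E i : set LT := [set x | f i.+1 < F x].
pose h i (x : LT) := (f i `^ w) * (\1_(E i) x)%:E.
have mFi i : measurable (E i).
  by have := emeasurable_fun_o_infty measurableT mF (f i.+1); rewrite setTI.
have h0 i x : 0 <= h i x by rewrite mule_ge0 ?poweR_ge0// lee_fin.
apply: (@le_trans _ _ (\int[mu]_x \sum_(i <oo) h i x)).
  rewrite integral_mkcond; apply: ge0_le_integral_nomeas => x _.
    by apply: erestrict_ge0 => *; exact: poweR_ge0.
  have S0 : 0 <= \sum_(i <oo) h i x by exact: nneseries_ge0.
  rewrite patchE; case: ifPn => // /set_mem/= Fx.
  have [->|Fx0] := eqVneq (F x) 0; first by rewrite poweR0r ?gt_eqF.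
  (* The least index whose level lies below [F x] is positive because [F x <= f 0]; its predecessor
     is the layer of [x]. *)
  have [m fm] := F_vanish.
  have ex : exists i, ~~ (F x <= f i).
    exists m; rewrite /f fm -ltNge lt_neqAle eq_sym Fx0; exact: F0.
  case: (ex_minnP ex) => -[|k]; first by rewrite Fx.
  rewrite -ltNge => hk kmin; apply: le_trans (nneseries_term k (h0 ^~ x)).
  rewrite /h indicE mem_set// mule1; apply: lee_poweR => //; first exact: ltW.
  by rewrite leNgt; apply/negP => h'; have := kmin k; rewrite -ltNge => /(_ h'); rewrite ltnn.
rewrite integral_series_indic//; last by move=> i; exact: poweR_ge0.
apply: lee_nneseries => i _; first by move=> _; rewrite mule_ge0// poweR_ge0.
rewrite muleC lee_wpmul2r ?poweR_ge0// setIT.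
have s2 : (0 <= 2 ^+ i.+1 * s)%R by rewrite mulr_ge0 ?exprn_ge0// ltW.
apply: le_trans (mu_gt_rearrangement mF s2).
by apply: le_mu => x /=; rewrite gee0_abs.
Qed.

Lemma selected_mass (y : nat -> R) (Q : nat -> set 'rV[R]_n) :
  (forall j, (0 <= y j)%R) ->
  (forall j, measurable (Q j : set LT)) -> (forall j, mu (Q j) < +oo) ->
  (forall x, \sum_(j <oo) (y j * \1_(Q j) x)%:E <= F x `^ w) ->
  (forall j, (0 < y j)%R -> 2%:E * mu (Q j `&` [set x | f 0%N < F x]) <= mu (Q j)) ->
  \sum_(j <oo) ((y j)%:E * mu (Q j)) <= 2%:E * slices.
Proof.
move=> y0 mQ Qfin yF dense.
have mE : measurable ([set x | f 0%N < F x] : set LT).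
  by have := emeasurable_fun_o_infty measurableT mF (f 0%N); rewrite setTI.
have EC : [set x | F x <= f 0%N] = ~` [set x | f 0%N < F x].
  by apply/seteqP; split => x /=; [rewrite leNgt => /negP|move/negP; rewrite -leNgt].
have mEC : measurable ([set x | F x <= f 0%N] : set LT) by rewrite EC; exact: measurableC.
apply: (@le_trans _ _ (2%:E * \sum_(j <oo) ((y j)%:E * mu (Q j `&` [set x | F x <= f 0%N])))).
  rewrite -nneseriesZl; last by move=> j _; rewrite mule_ge0// lee_fin.
  apply: lee_nneseries => j _; first by move=> _; rewrite mule_ge0// lee_fin.
  have := y0 j; rewrite le_eqVlt => /predU1P[<-|yj]; first by rewrite !mul0e mule0.
  rewrite muleCA lee_wpmul2l ?lee_fin//.
  have := dense _ yj; rewrite EC.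
  have -> : mu (Q j) = mu (Q j `&` ~` [set x | f 0%N < F x]) + mu (Q j `&` [set x | f 0%N < F x]).
    by rewrite -setDE -measureDI.
  have : mu (Q j `&` ~` [set x | f 0%N < F x]) < +oo.
    by apply: le_lt_trans (Qfin j); apply: le_mu => x [].
  have : mu (Q j `&` [set x | f 0%N < F x]) < +oo.
    by apply: le_lt_trans (Qfin j); apply: le_mu => x [].
  rewrite -!ge0_fin_numE ?mu_ge0// => /fineK <- /fineK <-.
  by rewrite -EFinD -!EFinM !lee_fin; lra.
rewrite lee_wpmul2l//; apply: le_trans slice_integral.
rewrite -(@integral_series_indic _ LT R mu _ Q (fun j => (y j)%:E) mEC mQ); last first.
  by move=> j; rewrite lee_fin.
apply: ge0_le_integral_nomeas => x _.
  by apply: nneseries_ge0 => j _ _; rewrite mule_ge0// lee_fin.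
apply: le_trans (yF x); apply: le_of_eq.
by apply: eq_eseriesr => j _; rewrite EFinM.
Qed.

End selection.

Lemma measurable_fun_mul_indic d (T : measurableType d) (R : realType) (A : set T)
    (F : T -> \bar R) : measurable A -> measurable_fun [set: T] F ->
  measurable_fun [set: T] (fun x => F x * (\1_A x)%:E)%E.
Proof. by move=> mA mF; apply: emeasurable_funM => //; exact: measurable_fun_EFin_indic. Qed.

Section power_tools.
Context {R : realType}.
Implicit Types (a x : R).

Lemma powR_expR a x : 0 < a -> a `^ x = expR (x * ln a).
Proof. by move=> a0; rewrite /powR gt_eqF. Qed.

Lemma expr_expR a k : 0 < a -> a ^+ k = expR (k%:R * ln a).
Proof. by move=> a0; rewrite -powR_mulrn ?ltW// powR_expR. Qed.

Lemma exprz_expR a (l : int) : 0 < a -> a ^ l = expR (l%:~R * ln a).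
Proof. by move=> a0; rewrite -powR_intmul ?ltW// powR_expR. Qed.

Lemma pow2_lt1 x : x < 0 -> 0 <= (2 : R) `^ x < 1.
Proof.
move=> x0; rewrite powR_ge0/= powR_expR// -[ltRHS]expR0 ltr_expR.
by rewrite nmulr_rlt0// ln_gt0// ltr1n.
Qed.

Lemma pow2_natM x k : (2 : R) `^ (k%:R * x) = (2 `^ x) ^+ k.
Proof. by rewrite mulrC powRrM powR_mulrn// powR_ge0. Qed.

Lemma ler_powR2 a b x : 0 <= x -> 0 <= a -> a <= b -> a `^ x <= b `^ x.
Proof. by move=> x0 a0 ab; rewrite ge0_ler_powR// ?nnegrE// (le_trans a0). Qed.

End power_tools.

(** * Morrey-Lorentz norms in terms of discrete norms on cubes *)

Section morrey_pieces.
Context {R : realType} {n : nat}.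
Local Notation mu := (@lebesgue_rV R n).
Local Notation LT := (@lebesgue_space R n).
Implicit Types (F : 'rV[R]_n -> \bar R).

Definition cut (A : set 'rV[R]_n) F (x : 'rV[R]_n) : \bar R := (F x * (\1_A x)%:E)%E.

Lemma cut_ge0 A F x : (forall x, 0 <= F x)%E -> (0 <= cut A F x)%E.
Proof. by move=> F0; rewrite mule_ge0// lee_fin. Qed.

Lemma cut_in (A : set 'rV[R]_n) F x : A x -> cut A F x = F x.
Proof. by move=> Ax; rewrite /cut indicE mem_set// mule1. Qed.

Lemma cut_out (A : set 'rV[R]_n) F x : ~ A x -> cut A F x = 0%E.
Proof. by move=> Ax; rewrite /cut indicE memNset// mule0. Qed.

Lemma measurable_cut A F : measurable (A : set LT) -> measurable_fun [set: LT] F ->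
  measurable_fun [set: LT] (cut A F).
Proof. exact: measurable_fun_mul_indic. Qed.

Lemma rearrangement_cut_eq0 A F t : (mu A <= t%:E)%E -> rearrangement (cut A F) t = 0%E.
Proof. by apply: rearrangement_eq0 => x /cut_out. Qed.

Lemma cut_vanish x (rho : R) F (s : R) : 0 <= rho -> 0 < s ->
  exists m, rearrangement (cut (qb x rho) F) (2 ^+ m * s) = 0%E.
Proof.
move=> r0 s0; pose m := (Num.truncn ((2 * rho) ^+ n / s)).+1.
exists m; apply: rearrangement_cut_eq0; rewrite mu_qb// lee_fin -ler_pdivrMr//.
apply: (@le_trans _ _ (m%:R : R)); first exact/ltW/truncnS_gt.
by rewrite -natrX ler_nat ltnW// ltn_expl.
Qed.

(** The form in which the Morrey condition is used throughout: on a cube of radius rho the discrete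
    quasi-norm is of size rho^(n/q - n/p), with a constant free of the cube and of the function. *)
Lemma morrey_dyadic (p q : R) (r : \bar R) : 0 < q -> (0 < r)%E ->
  exists C : R, 0 < C /\ forall F (N : R), 0 <= N ->
    (morrey_lorentz_norm p q r F <= N%:E)%E -> forall x (rho : R), 0 < rho ->
    dyadic_lorentz q r (rearrangement2 (cut (qb x rho) F))
      (C * (N * rho `^ (n%:R / q - n%:R / p))).
Proof.
move=> q0 r0; have [C [C0 HC]] := @lorentz_dyadic R n q r q0 r0.
pose c := 2 `^ (n%:R / q - n%:R / p) : R.
have c0 : 0 < c by exact: powR_gt0.
exists (C * c); split; first by rewrite mulr_gt0.
move=> F N N0 H x rho rho0.
have -> : C * c * (N * rho `^ (n%:R / q - n%:R / p)) =
    C * (N * (2 * rho) `^ (n%:R / q - n%:R / p)).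
  by rewrite powRM ?ltW//; rewrite -/c; ring.
apply: HC; first by rewrite mulr_ge0// powR_ge0.
have V0 : 0 < (2 * rho) ^+ n by rewrite exprn_gt0// mulr_gt0.
have HQ : ((((2 * rho) ^+ n) `^ (p^-1 - q^-1))%:E * lorentz_norm q r (cut (qb x rho) F) <= N%:E)%E.
  apply: le_trans H; apply: ereal_sup_ubound => /=; exists (qb x rho); last first.
    by rewrite mu_qb ?ltW// poweR_EFin.
  exists (\row_i (x ord0 i - rho)), (2 * rho); split; first by rewrite mulr_gt0.
  by rewrite -qb_cube// ltW.
rewrite -(@lee_pmul2l _ ((((2 * rho) ^+ n) `^ (p^-1 - q^-1))%:E)) ?lte_fin ?powR_gt0//.
apply: le_trans HQ _; rewrite -EFinM lee_fin mulrCA.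
have -> : ((2 * rho) ^+ n) `^ (p^-1 - q^-1) * (2 * rho) `^ (n%:R / q - n%:R / p) = 1.
  have h : 0 < 2 * rho by rewrite mulr_gt0.
  by rewrite (expr_expR n h) !powR_expR ?expR_gt0// expRK -expRD -[RHS]expR0; congr expR; ring.
by rewrite mulr1.
Qed.

Lemma weak_dyadic (q : R) (r : \bar R) (F : 'rV[R]_n -> \bar R) (A t : R) :
  0 < q -> (0 < r)%E -> 0 <= A -> 0 < t ->
  dyadic_lorentz q r (rearrangement2 F) A ->
  (rearrangement F t <= (2 `^ q^-1 * A * t `^ (- q^-1))%:E)%E.
Proof.
move=> q0 r0 A0 t0 H.
have [/andP[h1 h2] /andP[h3 h4]] := dyadic_level_bounds q0 t0.
have := dyadic_lorentz_weak (dyadic_level t) r0 A0 (rearrangement2_ge0 F) H.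
set d := dyadic_level t in h1 h2 h3 h4 *.
rewrite -lee_pdivlMl ?dweight_gt0// => h.
apply: (le_trans (rearrangement_noninc F h3)); apply: le_trans h _.
rewrite -EFinM lee_fin powRN mulrAC ler_wpM2r//.
rewrite dweightD dweight1E in h2.
by rewrite -[X in _ <= X]invrK lef_pV2 ?posrE ?dweight_gt0 ?invr_gt0 ?divr_gt0 ?powR_gt0//
  invfM invrK mulrC ler_pdivrMr ?powR_gt0.
Qed.

End morrey_pieces.

(** * The estimate of the majorant on a cube *)

Lemma markov_nonneg d (T : measurableType d) (R : realType) (mu : {measure set T -> \bar R})
    (g : T -> \bar R) (b : R) : measurable_fun [set: T] g -> (forall x, 0 <= g x)%E -> 0 < b ->
  (b%:E * mu [set x | (b%:E < g x)%E] <= \int[mu]_x g x)%E.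
Proof.
move=> mg g0 b0; set E := [set x | _].
have mE : measurable E.
  by have := emeasurable_fun_o_infty measurableT mg b%:E; rewrite setTI.
rewrite -[E]setIT -integral_cst_indic ?lee_fin ?(ltW b0)//.
apply: ge0_le_integral_nomeas => x _; first by rewrite mule_ge0// lee_fin ltW.
rewrite indicE; case: (boolP (x \in E)) => [/set_mem h|_]; last by rewrite mule0.
by rewrite mule1; exact: ltW.
Qed.

Lemma pow2_natz (R : realType) (i : nat) (m : int) : (2 : R) ^+ i * 2 ^ m = 2 ^ (i%:Z + m).
Proof. by rewrite expfzDr ?pnatr_eq0. Qed.

(** Separates the cubes not larger than the test cube (level 0) from all the larger ones at the
    price of halving the threshold. *)
Lemma nneseries_lt_split (R : realType) (u : nat -> \bar R) (b : R) :
  (forall m, 0 <= u m)%E -> ((2 * b)%:E < \sum_(m <oo) u m)%E ->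
  (b%:E < u 0%N)%E \/ (b%:E < \sum_(m <oo) u m.+1)%E.
Proof.
move=> u0; rewrite nneseries_recl// -(nneseries_addn 1)//.
under eq_eseriesr do rewrite addn1.
have [|h1] := ltP b%:E (u 0%N); first by left.
have [|h2] := ltP b%:E (\sum_(m <oo) u m.+1)%E; first by right.
move=> h; have := lt_le_trans h (leeD h1 h2).
by rewrite -EFinD lte_fin mulr_natl mulr2n ltxx.
Qed.

Section core.
Context {R : realType} {n : nat}.
Local Notation mu := (@lebesgue_rV R n).
Local Notation LT := (@lebesgue_space R n).
Variables (p q w s D A gam : R) (r : \bar R).
Hypotheses (q0 : 0 < q) (qp : q <= p) (r0 : (0 < r)%E) (qw : q < w) (ps : p < s).
Hypotheses (A0 : 0 <= A) (gam1 : 1 <= gam).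
Hypothesis decay : n.+1%:R * w / q < w * D + 1.

Let p0 : 0 < p. Proof. exact: lt_le_trans qp. Qed.
Let s0 : 0 < s. Proof. exact: lt_trans ps. Qed.
Let w0 : 0 < w. Proof. exact: lt_trans qw. Qed.
Let gam0 : 0 < gam. Proof. exact: lt_le_trans gam1. Qed.

(* [B j k] is the [w]-th power of the part of the [j]-th maximal function that
   lives at distance about [2 ^ k * rho j] from the cube [qb (c j) (rho j)]. *)
Record core_data (c : nat -> 'rV[R]_n) (rho y : nat -> R)
    (B : nat -> nat -> 'rV[R]_n -> \bar R) (F : 'rV[R]_n -> \bar R) (N : R) : Prop := {
  cd_rho : forall j, 0 < rho j;
  cd_y : forall j, 0 <= y j;
  cd_B0 : forall j k x, (0 <= B j k x)%E;
  cd_mB : forall j k, measurable_fun [set: LT] (B j k);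
  cd_supp : forall j k x, ~ qb (c j) (gam * (2 ^+ k * rho j)) x -> B j k x = 0%E;
  cd_int : forall j k x tau, 0 < tau -> tau <= gam * (2 ^+ k * rho j) ->
    (\int[mu]_(z in qb x tau) B j k z <=
     (A * 2 `^ (- (k%:R * (w * D))) * tau `^ (n%:R - n%:R * w / s) *
        (2 ^+ k * rho j) `^ (n%:R * w / s))%:E)%E;
  cd_mF : measurable_fun [set: LT] F;
  cd_F0 : forall x, (0 <= F x)%E;
  cd_yF : forall x, (\sum_(j <oo) (y j * \1_(qb (c j) (rho j)) x)%:E <= F x `^ w)%E;
  cd_N0 : 0 <= N;
  cd_norm : (morrey_lorentz_norm p q r F <= N%:E)%E }.

(** * Two model sequences that bound the rearrangement of the majorant *)

Section discrete_bounds.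
Variables (alpha beta : R).
Hypotheses (alpha_q : n.+1%:R / q < alpha) (beta_q : beta < q^-1).

(** Here [k] counts dilations, whose threshold sits n+1 dyadic steps lower each time, and [i] counts
    the layers above a threshold. The weights are such that [shift_sup h l < a] bounds each sample
    by a 2^(k alpha - i beta). The section hypotheses on [alpha] and [beta] keep the supremum
    bounded; two opposite ones, met later, make the resulting sums converge. *)
Definition shift_sup (h : int -> \bar R) (l : int) : \bar R :=
  ereal_sup (range (fun k : nat => ereal_sup (range (fun i : nat =>
    ((2 `^ (i%:R * beta - k%:R * alpha))%:E * h (l + (i%:Z - (k * n.+1)%:Z))%R)%E)))).

Lemma shift_sup_bound : exists C : R, 0 < C /\ forall (h : int -> \bar R) A, 0 <= A ->
  (forall l, 0 <= h l)%E -> dyadic_lorentz q r h A ->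
  dyadic_lorentz q r (shift_sup h) (C * A).
Proof.
have e1 : beta - q^-1 < 0 by rewrite subr_lt0.
have e2 : n.+1%:R / q - alpha < 0 by rewrite subr_lt0.
have [Ci [Ci0 HCi]] := dyadic_lorentz_sup q r0 (pow2_lt1 e1).
have [Ck [Ck0 HCk]] := dyadic_lorentz_sup q r0 (pow2_lt1 e2).
exists (Ck * Ci); split; first by rewrite mulr_gt0.
move=> h a a0 h0 H; rewrite -mulrA.
have t0 k i l : (0 <= (2 `^ (i%:R * beta - k%:R * alpha))%:E *
    h (l + (i%:Z - (k * n.+1)%:Z))%R)%E by rewrite mule_ge0 ?lee_fin ?powR_ge0.
apply: (HCk (fun k l => ereal_sup (range (fun i : nat =>
    ((2 `^ (i%:R * beta - k%:R * alpha))%:E * h (l + (i%:Z - (k * n.+1)%:Z))%R)%E)))).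
- by rewrite mulr_ge0// ltW.
- by move=> k l; apply: le_trans (t0 k 0%N l) _; apply: ereal_sup_ubound; exists 0%N.
move=> k; rewrite mulrCA.
apply: (HCi (fun i l => ((2 `^ (i%:R * beta - k%:R * alpha))%:E *
    h (l + (i%:Z - (k * n.+1)%:Z))%R)%E)) => [|i l|i]; first by rewrite mulr_ge0 ?exprn_ge0 ?powR_ge0.
  exact: t0.
(* The factor gained from the shift by i - k(n+1) combines with the weight into a product of two
   geometric decays, one in [i] and one in [k]. *)
have -> : (2 `^ (beta - q^-1)) ^+ i * ((2 `^ (n.+1%:R / q - alpha)) ^+ k * a) =
    2 `^ (i%:R * beta - k%:R * alpha) * (dweight q (- (i%:Z - (k * n.+1)%:Z)) * a).
  rewrite !mulrA; congr (_ * a); rewrite -!pow2_natM /dweight !powR_expR// -!expRD.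
  by congr expR; rewrite opprB intrB -!pmulrn natrM; ring.
apply: dyadic_lorentz_scale; rewrite ?powR_ge0//; first by rewrite mulr_ge0 ?powR_ge0.
exact: dyadic_lorentz_shift.
Qed.

Lemma dyadic_lorentz_point (h : int -> \bar R) A' l0 : (0 <= h l0)%E ->
  (forall l, l != l0 -> h l = 0%E) -> ((dweight q l0)%:E * h l0 <= A'%:E)%E ->
  dyadic_lorentz q r h A'.
Proof.
move=> h0 hz hA; have A1 : 0 <= A' by rewrite -lee_fin (le_trans _ hA)// dyadic_term_ge0.
have hl0 l : (0 <= h l)%E by have [->//|/hz ->] := eqVneq l l0.
case: r r0 => [r1| |]//=; last first.
  move=> _ l; have [->//|/hz ->] := eqVneq l l0.
  by rewrite mule0 lee_fin.
rewrite lte_fin => r10; rewrite (esumID [set l0])//; last by move=> *; exact: poweR_ge0.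
rewrite !setTI esum_set1 ?poweR_ge0// esum1 ?adde0; last first.
  by move=> l /= /eqP/hz ->; rewrite mule0 poweR0r// gt_eqF.
by rewrite -[(A' `^ r1)%:E]poweR_EFin; apply: lee_poweR; [exact: ltW|exact: dyadic_term_ge0|].
Qed.

(** Because 1/q > 1/w, the weighted terms 2^(l/q - l/w) grow up to the cut-off at [X]. Downwards
    from its dyadic level they decay geometrically, so the tail is a supremum of one-point
    sequences. *)
Lemma power_tail_bound : exists C : R, 0 < C /\ forall (N rho0 : R) (X : R),
  0 <= N -> 0 < rho0 -> 0 < X -> X <= (2 * rho0) ^+ n ->
  dyadic_lorentz q r (fun l => if (2 : R) ^ l < X then
      (N * rho0 `^ (n%:R / w - n%:R / p) * 2 `^ (- (l%:~R / w)))%:E else 0%E)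
    (C * (N * rho0 `^ (n%:R / q - n%:R / p))).
Proof.
have e0 : 0 < q^-1 - w^-1 by rewrite subr_gt0 ltf_pV2 ?posrE.
have e1 : - (q^-1 - w^-1) < 0 by rewrite oppr_lt0.
have [C [C0 HC]] := dyadic_lorentz_sup q r0 (pow2_lt1 e1).
(* This is 2^n to the power 1/q - 1/w, from the bound of [X] by the volume 2^n rho0^n of the test
   cube. *)
pose d : R := 2 `^ (n%:R * (q^-1 - w^-1)).
exists (C * d); split; first by rewrite mulr_gt0 ?powR_gt0.
move=> N rho0 X N0 rho00 X0 Xle; have [L /andP[hL1 hL2]] := exp2z_bracket X0.
pose T (l : int) : R := N * rho0 `^ (n%:R / w - n%:R / p) * 2 `^ (- (l%:~R / w)).
have T0 l : 0 <= T l by rewrite !mulr_ge0 ?powR_ge0.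
pose a := d * (N * rho0 `^ (n%:R / q - n%:R / p)).
have a0 : 0 <= a by rewrite !mulr_ge0 ?powR_ge0.
pose h (i : nat) (l : int) : \bar R := if l == L - i%:Z then (T l)%:E else 0%E.
have h0 i l : (0 <= h i l)%E by rewrite /h; case: ifP => // _; rewrite lee_fin.
apply: (@dyadic_lorentz_le _ q r (fun l => ereal_sup (range (h ^~ l))) _ (C * a)) => //.
- by rewrite mulr_ge0// ltW.
- by rewrite /a mulrA.
- move=> l; apply/andP; split; first by case: ifP => // _; rewrite lee_fin; exact: T0.
  case: ifPn => [hl|_]; last by apply: le_trans (h0 0%N l) _; apply: ereal_sup_ubound; exists 0%N.
  have lL : (l <= L)%R.
    by have := lt_trans hl hL2; rewrite ltr_eXz2l ?ltr1n// ltzD1.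
  apply: ereal_sup_ubound; exists `|L - l|%N => //.
  rewrite /h gez0_abs ?subr_ge0// opprB addrC subrK eqxx //.
apply: HC => // i; apply: (@dyadic_lorentz_point _ _ (L - i%:Z)) => //.
  by move=> l /negbTE; rewrite /h => ->.
rewrite /h eqxx -EFinM lee_fin -pow2_natM /a /T.
have -> : dweight q (L - i%:Z) * (N * rho0 `^ (n%:R / w - n%:R / p) * 2 `^ (- ((L - i%:Z)%:~R / w))) =
    2 `^ (i%:R * - (q^-1 - w^-1)) * (N * (rho0 `^ (n%:R / w - n%:R / p) * (2 ^ L) `^ (q^-1 - w^-1))).
  rewrite /dweight.
  transitivity (N * (rho0 `^ (n%:R / w - n%:R / p) * (2 `^ ((L - i%:Z)%:~R / q) * 2 `^ (- ((L - i%:Z)%:~R / w))))); first by ring.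
  transitivity (N * (rho0 `^ (n%:R / w - n%:R / p) * (2 `^ (i%:R * - (q^-1 - w^-1)) * (2 ^ L) `^ (q^-1 - w^-1)))); last by ring.
  congr (_ * (_ * _)); rewrite exprz_expR// !powR_expR ?expR_gt0// expRK -!expRD.
  by congr expR; rewrite intrB -!pmulrn; ring.
rewrite ler_wpM2l ?powR_ge0//.
have -> : d * (N * rho0 `^ (n%:R / q - n%:R / p)) =
    N * (rho0 `^ (n%:R / w - n%:R / p) * ((2 * rho0) ^+ n) `^ (q^-1 - w^-1)).
  have r20 : 0 < 2 * rho0 by rewrite mulr_gt0.
  rewrite mulrCA; congr (_ * _); rewrite /d (expr_expR _ r20) lnM ?posrE// !powR_expR ?expR_gt0//.
  by rewrite expRK -!expRD; congr expR; ring.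
rewrite ler_wpM2l// ler_wpM2l ?powR_ge0// ler_powR2 ?(ltW e0)// ?(ltW (exp2z_gt0 _))//.
exact: le_trans Xle.
Qed.

End discrete_bounds.

(** * Pairs of a cube and a dilation, sorted by size relative to the test cube *)

Section data.
Variables (c : nat -> 'rV[R]_n) (rho y : nat -> R)
  (B : nat -> nat -> 'rV[R]_n -> \bar R) (F : 'rV[R]_n -> \bar R) (N : R).
Hypothesis cd : core_data c rho y B F N.
Variables (x0 : 'rV[R]_n) (rho0 : R).
Hypothesis rho0_gt0 : 0 < rho0.

(** Level 0 gathers all dilates of radius at most [rho0]; level m + 1 is the dyadic range of radii
    ending at 2^(m+1) rho0. Only dilates whose [gam]-enlargement meets the test cube are kept. *)
Definition level_set (m k : nat) : set nat := [set j |
  [/\ (if m is m'.+1 then 2 ^+ m' * rho0 < 2 ^+ k * rho j else True),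
      2 ^+ k * rho j <= 2 ^+ m * rho0 &
      qb (c j) (gam * (2 ^+ k * rho j)) `&` qb x0 rho0 !=set0]].

(** Large enough for every original cube of level [m]: [gam] for reaching the test cube, one unit
    for crossing it and one for the radius of the cube. *)
Definition hull (m : nat) : set 'rV[R]_n := qb x0 ((gam + 2) * (2 ^+ m * rho0)).

(** Zeroing coefficients, rather than summing over a subset, keeps all sums series over [nat]. *)
Definition restr (J : set nat) (j : nat) : R := if `[< J j >] then y j else 0.

Lemma restr_ge0 J j : 0 <= restr J j.
Proof. by rewrite /restr; case: ifP => // _; exact: cd_y cd j. Qed.

Lemma restr_in (J : set nat) j : J j -> restr J j = y j.
Proof. by rewrite /restr => /asboolP ->. Qed.

Lemma restr_out (J : set nat) j : ~ J j -> restr J j = 0.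
Proof. by rewrite /restr => /asboolPn/negbTE ->. Qed.

Lemma pow2_gt0 k : 0 < (2 : R) ^+ k. Proof. exact: exprn_gt0. Qed.

Lemma level_set_ex j k x : qb x0 rho0 x -> B j k x != 0%E -> exists m, level_set m k j.
Proof.
move=> xQ Bx; have sup : qb (c j) (gam * (2 ^+ k * rho j)) x.
  by apply: contrapT => /(cd_supp cd)/eqP; rewrite (negbTE Bx).
have ex : exists m, 2 ^+ k * rho j <= 2 ^+ m * rho0.
  pose m := (Num.truncn (2 ^+ k * rho j / rho0)).+1; exists m.
  rewrite -ler_pdivrMr//; apply: (@le_trans _ _ (m%:R : R)); first exact/ltW/truncnS_gt.
  by rewrite -natrX ler_nat ltnW// ltn_expl.
case: (ex_minnP ex) => m hm mmin; exists m; split => //; last by exists x.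
case: m hm mmin => // m _ mmin; rewrite ltNge; apply/negP => /mmin.
by rewrite ltnn.
Qed.

Lemma level_set_hull m k j : level_set m k j -> qb (c j) (rho j) `<=` hull m.
Proof.
move=> [_ h [z [z1 z2]]]; apply: qb_sub.
have rj := cd_rho cd j; have k1 : 1 <= 2 ^+ k :> R by rewrite exprn_ege1// ler1n.
have m1 : 1 <= 2 ^+ m :> R by rewrite exprn_ege1// ler1n.
have h1 : rho j <= 2 ^+ m * rho0 by apply: le_trans h; rewrite ler_peMl// ltW.
have h2 : rho0 <= 2 ^+ m * rho0 by rewrite ler_peMl// ltW.
have e : c j - x0 = (c j - z) + (z - x0) by rewrite subrKA.
rewrite e; have := ler_normD (c j - z) (z - x0).
have z1' : `|c j - z| <= gam * (2 ^+ k * rho j) by rewrite distrC.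
have z2' : `|z - x0| <= rho0 by [].
have h3 : gam * (2 ^+ k * rho j) <= gam * (2 ^+ m * rho0) by rewrite ler_wpM2l// ltW.
by rewrite mulrDl; lra.
Qed.

Lemma level_split x : qb x0 rho0 x ->
  (\sum_(j <oo) \sum_(k <oo) ((y j)%:E * B j k x) <=
   \sum_(m <oo) \sum_(k <oo) \sum_(j <oo) ((restr (level_set m k) j)%:E * B j k x))%E.
Proof.
move=> xQ.
have t0 m k j : (0 <= (restr (level_set m k) j)%:E * B j k x)%E.
  by rewrite mule_ge0 ?lee_fin ?restr_ge0 ?(cd_B0 cd).
rewrite nneseries_interchange; last first.
  by move=> j k; rewrite mule_ge0 ?lee_fin ?(cd_y cd) ?(cd_B0 cd).
rewrite [leRHS]nneseries_interchange; last by move=> m k; exact: nneseries_ge0.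
apply: lee_nneseries => k _.
  by move=> _; apply: nneseries_ge0 => j _ _; rewrite mule_ge0 ?lee_fin ?(cd_y cd) ?(cd_B0 cd).
rewrite [leRHS]nneseries_interchange//.
apply: lee_nneseries => j _; first by move=> _; rewrite mule_ge0 ?lee_fin ?(cd_y cd) ?(cd_B0 cd).
have [->|Bx] := eqVneq (B j k x) 0%E; first by rewrite mule0; apply: nneseries_ge0 => i _ _; rewrite mule0.
have [m hm] := level_set_ex xQ Bx.
apply: le_trans (nneseries_term m _) => //.
by rewrite restr_in.
Qed.

(** All cubes concerned lie in the hull, so [F] may be cut to it. The cut function has bounded
    support, which supplies the vanishing rearrangement required by [selected_mass]. *)
Lemma level_mass (m k : nat) (J : set nat) (t : R) : 0 < t -> J `<=` level_set m k ->
  let f := rearrangement (cut (hull m) F) in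
  (forall j, J j -> 2%:E * mu (qb (c j) (rho j) `&` [set x | f t < cut (hull m) F x]) <=
     mu (qb (c j) (rho j)))%E ->
  (\sum_(j <oo) ((restr J j)%:E * mu (qb (c j) (rho j))) <=
   2%:E * \sum_(i <oo) ((2 ^+ i.+1 * t)%:E * f (2 ^+ i * t)%R `^ w))%E.
Proof.
move=> t0 JL f dense; apply: (@selected_mass R n (cut (hull m) F) w t).
- by apply: measurable_cut; [exact: measurable_qb|exact: cd_mF cd].
- by move=> x; apply: cut_ge0; exact: cd_F0 cd.
- exact: w0.
- exact: t0.
- apply: cut_vanish => //; rewrite mulr_ge0 ?addr_ge0// ?(ltW gam0)//.
  by rewrite mulr_ge0// ltW// pow2_gt0.
- exact: restr_ge0.
- by move=> j; exact: measurable_qb.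
- by move=> j; rewrite mu_qb ?ltry//; exact/ltW/(cd_rho cd).
- move=> x; have [xh|xh] := pselect (hull m x).
    rewrite cut_in//; apply: le_trans (cd_yF cd x); apply: lee_nneseries => j _.
      by move=> _; rewrite lee_fin mulr_ge0// restr_ge0.
    rewrite lee_fin ler_wpM2r// /restr; case: ifP => // _; exact: cd_y cd j.
  rewrite (eq_eseriesr (g := fun=> 0%E)) ?eseries0 ?poweR_ge0// => j _.
  have [Jj|nJ] := pselect (J j); last by rewrite restr_out// mul0r.
  rewrite indicE memNset ?mulr0// => xj; apply: xh.
  exact: level_set_hull (JL _ Jj) _ xj.
- move=> j yj; rewrite expr0 mul1r; apply: dense; apply: contrapT => nJ.
  by move: yj; rewrite restr_out// ltxx.
Qed.

(** * Dilates not larger than the test cube *)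

Section small_cubes.
Variables (alpha beta : R).
Hypothesis alpha_w : alpha * w < w * D + 1.
Hypothesis beta_w : 1 < beta * w.

Let F0 := cut (hull 0) F.

Let small_sup (l : int) : \bar R := shift_sup alpha beta (rearrangement2 F0) l.

(** The first term is the constant of [vitali_dense] times the sum 2 of the powers of 1/2. In the
    second, 4 joins the half of each cube that is kept with the 2 in 2^(i+1); the two inverses sum
    the geometric series over layers and over dilations. *)
Definition small_const : R := 3 ^+ n * (2 * gam ^+ n) * 2 +
  4 * (A * gam `^ (n%:R - n%:R * w / s) / 2 ^+ n) *
  (1 - 2 `^ (1 - beta * w))^-1 * (1 - 2 `^ (alpha * w - w * D - 1))^-1.

Lemma nneseries_geometricZ (b x : R) : 0 <= b -> 0 <= x < 1 ->
  (\sum_(i <oo) (b * x ^+ i)%:E = (b * (1 - x)^-1)%:E)%E.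
Proof.
move=> b0 x01; rewrite EFinM -nneseries_geometric// -nneseriesZl//.
by move=> i _; rewrite lee_fin exprn_ge0//; case/andP: x01.
Qed.

(** For each [k] the cubes are split at the level of the rearrangement at [sk k]. Dense cubes are
    removed together with their dilates, as an exceptional set; off that set only the others
    contribute, and Markov's inequality applies to their total mass. *)
Lemma small_measure (l : int) (a : R) : 0 < a -> (small_sup l < a%:E)%E ->
  (mu [set x | qb x0 rho0 x /\ ((a `^ w)%:E <
     \sum_(k <oo) \sum_(j <oo) ((restr (level_set 0 k) j)%:E * B j k x))%E] <=
   (small_const * 2 ^ l)%:E)%E.
Proof.
move=> a0 Sa; set X := [set x | _].
(* Dilation by 2^k multiplies measures by 2^(kn); the remaining 2^(-k) makes the exceptional sets
   summable. *)
pose sk (k : nat) : R := 2 ^ (l - (k * n.+1)%:Z).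
have sk0 k : 0 < sk k by exact: exp2z_gt0.
have mF0 : measurable_fun [set: LT] F0 by apply: measurable_cut; [exact: measurable_qb|exact: cd_mF cd].
have F00 x : (0 <= F0 x)%E by apply: cut_ge0; exact: cd_F0 cd.
have two0 : 0 < (2 : R) by [].
have fS k i : (rearrangement F0 (2 ^+ i * sk k)%R <= (a * 2 `^ (k%:R * alpha - i%:R * beta))%:E)%E.
  have -> : 2 ^+ i * sk k = 2 ^ (l + (i%:Z - (k * n.+1)%:Z)).
    by rewrite /sk pow2_natz addrCA.
  have h : ((2 `^ (i%:R * beta - k%:R * alpha))%:E *
      rearrangement2 F0 (l + (i%:Z - (k * n.+1)%:Z))%R <= a%:E)%E.
    apply: le_trans (ltW Sa); apply: le_trans; last by apply: ereal_sup_ubound; exists k.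
    by apply: ereal_sup_ubound; exists i.
  rewrite -(@lee_pmul2l _ (2 `^ (i%:R * beta - k%:R * alpha))%:E) ?lte_fin ?powR_gt0//.
  apply: le_trans h _; rewrite -EFinM lee_fin mulrCA -powRD ?pnatr_eq0 ?implybT//.
  by rewrite (_ : _ + _ = 0) ?powRr0 ?mulr1//; ring.
pose E k : set LT := [set x | rearrangement F0 (sk k) < F0 x]%E.
have mE k : measurable (E k).
  by have := emeasurable_fun_o_infty measurableT mF0 (rearrangement F0 (sk k)); rewrite setTI.
have muE k : (mu (E k) <= (sk k)%:E)%E.
  apply: le_trans (mu_gt_rearrangement mF0 (ltW (sk0 k))).
  by apply: le_mu => x /=; rewrite gee0_abs.
(* The cubes at least half covered by the set where [F0] exceeds its level. *)
pose J1 k := [set j | level_set 0 k j /\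
  (mu (qb (c j) (rho j)) <= 2%:E * mu (qb (c j) (rho j) `&` E k))%E].
pose J2 k := level_set 0 k `\` J1 k.
pose Om k := \bigcup_(j in J1 k) qb (c j) ((gam * 2 ^+ k) * rho j).
have k1 k : 1 <= 2 ^+ k :> R by rewrite exprn_ege1// ler1n.
have muOm : (mu (\bigcup_k Om k) <= (3 ^+ n * (2 * gam ^+ n) * 2 * 2 ^ l)%:E)%E.
  apply: (le_trans (mu_bigcup_le _)).
  pose b : R := 3 ^+ n * (2 * gam ^+ n) * 2 ^ l.
  apply: (@le_trans _ _ (\sum_(k <oo) (b * 2^-1 ^+ k)%:E)%E); last first.
    rewrite nneseries_geometricZ; last 2 first.
    - by rewrite !mulr_ge0 ?exprn_ge0 ?(ltW gam0) ?(ltW (exp2z_gt0 _)).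
    - by apply/andP; split; lra.
    by rewrite lee_fin /b (_ : (1 - 2^-1)^-1 = 2); [lra|field].
  apply: lee_nneseries => k _; first by move=> _; exact: mu_ge0.
  apply: le_trans (@vitali_dense R n (E k) (J1 k) c rho (gam * 2 ^+ k) _ _ _ _) _ => //.
  - by rewrite (le_trans gam1)// ler_peMr// ltW.
  - by move=> j _; exact/ltW/(cd_rho cd).
  - by move=> j [].
  apply: le_trans (lee_wpmul2l _ (muE k)) _.
    by rewrite lee_fin !mulr_ge0 ?exprn_ge0 ?mulr_ge0 ?(ltW gam0) ?exprn_ge0.
  rewrite -EFinM lee_fin /b exprMn; apply: le_of_eq.
  rewrite -!mulrA; congr (_ * (_ * (_ * _))).
  rewrite /sk exprVn -exprM exprz_expR// [in RHS]exprz_expR// !expr_expR// -expRN -!expRD.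
  by congr expR; rewrite intrB -pmulrn natrM -natr1; ring.
pose G k x := (\sum_(j <oo) ((restr (J2 k) j)%:E * B j k x))%E.
have t0 k j x : (0 <= (restr (J2 k) j)%:E * B j k x)%E.
  by rewrite mule_ge0 ?lee_fin ?restr_ge0 ?(cd_B0 cd).
have mBr k j : measurable_fun [set: LT] (fun x => (restr (J2 k) j)%:E * B j k x)%E.
  by apply: measurable_funeM; exact: cd_mB cd j k.
have G0 k x : (0 <= G k x)%E by exact: nneseries_ge0.
have mG k : measurable_fun [set: LT] (G k) by exact: ge0_emeasurable_sum.
have mGG : measurable_fun [set: LT] (fun x => \sum_(k <oo) G k x)%E.
  exact: ge0_emeasurable_sum.
(* Outside the exceptional set a dense cube contributes nothing, since its term is supported in the
   removed dilate. *)
have XS : X `<=` (\bigcup_k Om k) `|` [set x | (a `^ w)%:E < \sum_(k <oo) G k x]%E.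
  move=> x [xQ hx]; have [xO|xO] := pselect ((\bigcup_k Om k) x); [by left|right].
  apply: lt_le_trans hx _; apply: lee_nneseries => k _.
    by move=> _; apply: nneseries_ge0 => j _ _; rewrite mule_ge0 ?lee_fin ?restr_ge0 ?(cd_B0 cd).
  apply: lee_nneseries => j _.
    by move=> _; rewrite mule_ge0 ?lee_fin ?restr_ge0 ?(cd_B0 cd).
  have [J1j|nJ1] := pselect (J1 k j).
    rewrite (cd_supp cd) ?mule0// => h; apply: xO; exists k => //; exists j => //.
    by rewrite -mulrA.
  have [Lj|nL] := pselect (level_set 0 k j); last by rewrite restr_out// mul0e.
  by rewrite !restr_in.
apply: (le_trans (le_mu XS)); apply: (le_trans (mu_subU _ _)).
rewrite /small_const mulrDl EFinD leeD//.
have aw0 : 0 < a `^ w by rewrite powR_gt0.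
rewrite -(@lee_pmul2l _ (a `^ w)%:E) ?lte_fin//.
have GG0 x : (0 <= \sum_(k <oo) G k x)%E by exact: nneseries_ge0.
apply: (le_trans (@markov_nonneg _ LT R mu _ _ mGG GG0 aw0)).
rewrite integral_nneseries//.
(* The integral bound at the radius of the whole support is A gam^(n - nw/s) 2^(k(n - wD)) rho^n;
   dividing by the measure (2 rho)^n of the cube gives this constant. *)
pose Ck k : R := A * gam `^ (n%:R - n%:R * w / s) / 2 ^+ n *
  2 `^ (k%:R * (n%:R - w * D)).
have Ck0 k : 0 <= Ck k.
  by rewrite !mulr_ge0 ?powR_ge0 ?invr_ge0 ?exprn_ge0.
have intG k : (\int[mu]_x G k x <=
    (Ck k)%:E * \sum_(j <oo) ((restr (J2 k) j)%:E * mu (qb (c j) (rho j))))%E.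
  rewrite integral_nneseries// -nneseriesZl; last first.
    by move=> j _; rewrite mule_ge0 ?mu_ge0// lee_fin restr_ge0.
  apply: lee_nneseries => j _; first by move=> _; exact: integral_ge0.
  rewrite (@ge0_integralZl_EFin _ LT R mu setT measurableT _ (fun x _ => cd_B0 cd j k x)
    (cd_mB cd j k)) ?restr_ge0//.
  rewrite muleCA lee_wpmul2l ?lee_fin ?restr_ge0//.
  have rj := cd_rho cd j; have g2 : 0 < gam * (2 ^+ k * rho j).
    by rewrite !mulr_gt0// pow2_gt0.
  apply: (@le_trans _ _ (\int[mu]_(x in qb (c j) (gam * (2 ^+ k * rho j))) B j k x)%E).
    rewrite [leRHS]integral_mkcond; apply: ge0_le_integral_nomeas => x _; first exact: cd_B0 cd j k x.
    rewrite patchE; case: ifPn => // /negP h; rewrite (cd_supp cd)// => h'.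
    by apply: h; rewrite inE.
  apply: (@le_trans _ _ _%:E); first by apply: (cd_int cd) => //; exact: lexx.
  rewrite mu_qb ?(ltW rj)// -EFinM lee_fin /Ck; apply: le_of_eq.
  rewrite -!mulrA; congr (A * _).
  have kr0 : 0 < 2 ^+ k * rho j by rewrite mulr_gt0// pow2_gt0.
  rewrite powRM ?(ltW gam0) ?(ltW kr0)// -!mulrA mulrCA; congr (_ * _).
  rewrite -powRD; last by rewrite (gt_eqF kr0) implybT.
  rewrite subrK powR_mulrn ?(ltW kr0)// !exprMn.
  have h2 : 2 ^- n * 2 ^+ n = 1 :> R by rewrite mulVf// lt0r_neq0// pow2_gt0.
  transitivity (2 `^ (k%:R * (n%:R - w * D)) * rho j ^+ n); last first.
    by rewrite [RHS]mulrCA (mulrA (2 ^- n)) h2 mul1r.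
  rewrite mulrA; congr (_ * _).
  rewrite -exprM !powR_expR// expr_expR// -!expRD; congr expR.
  by rewrite natrM; ring.
have mass k : (\sum_(j <oo) ((restr (J2 k) j)%:E * mu (qb (c j) (rho j))) <=
    (4 * sk k * a `^ w * 2 `^ (k%:R * (alpha * w)) * (1 - 2 `^ (1 - beta * w))^-1)%:E)%E.
  apply: le_trans (@level_mass 0 k (J2 k) (sk k) (sk0 k) _ _) _.
  - by move=> j [].
  - by move=> j [Lj nJ]; rewrite leNgt; apply/negP => h; apply: nJ; split => //; exact: ltW.
  have [x0' x1'] := andP (@pow2_lt1 R (1 - beta * w) ltac:(rewrite subr_lt0; exact: beta_w)).
  apply: (@le_trans _ _ (2%:E * \sum_(i <oo)
      (2 * sk k * a `^ w * 2 `^ (k%:R * (alpha * w)) * (2 `^ (1 - beta * w)) ^+ i)%:E)%E).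
    rewrite lee_wpmul2l//; apply: lee_nneseries => i _.
      by move=> _; rewrite mule_ge0 ?poweR_ge0// lee_fin mulr_ge0 ?exprn_ge0// ltW.
    apply: (@le_trans _ _ ((2 ^+ i.+1 * sk k)%:E * (a * 2 `^ (k%:R * alpha - i%:R * beta))%:E `^ w)%E).
      rewrite lee_wpmul2l ?lee_fin ?mulr_ge0 ?exprn_ge0 ?(ltW (sk0 k))//.
      by apply: lee_poweR; [exact: ltW|exact: rearrangement_ge0|exact: fS].
    rewrite poweR_EFin -EFinM lee_fin powRM ?(ltW a0) ?powR_ge0// -powRrM.
    apply: le_of_eq; rewrite -pow2_natM exprS.
    rewrite -[LHS]mulrA -[LHS]mulrA.
    transitivity (2 * sk k * a `^ w * (2 ^+ i * 2 `^ ((k%:R * alpha - i%:R * beta) * w))); first by ring.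
    rewrite -[RHS]mulrA; congr (_ * _).
    rewrite expr_expR// !powR_expR// -!expRD; congr expR; ring.
  rewrite nneseries_geometricZ; last 2 first.
  - by rewrite !mulr_ge0 ?powR_ge0 ?(ltW (sk0 k)).
  - by apply/andP; split.
  by rewrite -EFinM lee_fin !mulrA -natrM.
(* The ratio of the series in [k]: n - wD from the integrals, -(n+1) from [sk k] and alpha w from
   the levels add up to alpha w - wD - 1 < 0. *)
have [z0 z1] := andP (@pow2_lt1 R (alpha * w - w * D - 1) ltac:(by rewrite -addrA -opprD subr_lt0)).
pose b : R := 4 * (A * gam `^ (n%:R - n%:R * w / s) / 2 ^+ n) *
  (1 - 2 `^ (1 - beta * w))^-1 * 2 ^ l * a `^ w.
have [x0' x1'] := andP (@pow2_lt1 R (1 - beta * w) ltac:(rewrite subr_lt0; exact: beta_w)).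
have b0 : 0 <= b.
  rewrite !mulr_ge0 ?powR_ge0 ?invr_ge0 ?exprn_ge0 ?(ltW (exp2z_gt0 _)) ?subr_ge0//.
  exact: ltW.
apply: (@le_trans _ _ (\sum_(k <oo) (b * (2 `^ (alpha * w - w * D - 1)) ^+ k)%:E)%E).
  apply: lee_nneseries => k _; first by move=> _; exact: integral_ge0.
  apply: le_trans (intG k) _; apply: le_trans (lee_wpmul2l _ (mass k)) _; first by rewrite lee_fin.
  rewrite -EFinM lee_fin /Ck /b; apply: le_of_eq.
  set u := A * _ / _; set v := (1 - 2 `^ (1 - beta * w))^-1.
  transitivity (4 * u * v * a `^ w * (2 `^ (k%:R * (n%:R - w * D)) * sk k * 2 `^ (k%:R * (alpha * w)))); first by ring.
  transitivity (4 * u * v * a `^ w * (2 ^ l * 2 `^ (alpha * w - w * D - 1) ^+ k)); last by ring.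
  congr (_ * _); rewrite -pow2_natM /sk !exprz_expR// !powR_expR// -!expRD; congr expR.
  by rewrite intrB -pmulrn natrM -natr1; ring.
rewrite nneseries_geometricZ; [|exact: b0|by apply/andP; split].
by rewrite -EFinM lee_fin /b; apply: le_of_eq; ring.
Qed.

End small_cubes.

(** * Dilates larger than the test cube *)

Section large_cubes.
Variable C1 : R.
Hypothesis C1_ge0 : 0 <= C1.
Hypothesis F_dyadic : forall x tau, 0 < tau ->
  dyadic_lorentz q r (rearrangement2 (cut (qb x tau) F))
    (C1 * (N * tau `^ (n%:R / q - n%:R / p))).

Definition large_const0 : R := A * 2 `^ (n%:R * w / s) * 2 *
  (1 - 2 `^ (1 - w / q))^-1 * (2 `^ q^-1 * C1) `^ w *
  ((gam + 2) * 2) `^ (w * (n%:R / q - n%:R / p)) * 2 `^ (w / q) *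
  2 `^ (- (n%:R * w / q)).

(** The dilate exceeds the test cube, so the Morrey growth of [B j k] is applied at radius [rho0],
    while the mass is counted on the hull at scale 2^(m+1) rho0. The exponents of 2^k and 2^m that
    remain are -(wD - nw/q) and nw/s - nw/p. *)
Lemma large_term m k :
  (\sum_(j <oo) ((restr (level_set m.+1 k) j)%:E * \int[mu]_(x in qb x0 rho0) B j k x) <=
   (large_const0 * (N `^ w * rho0 `^ (n%:R - n%:R * w / p)) *
     (2 `^ (- (w * D - n%:R * w / q))) ^+ k *
     (2 `^ (n%:R * w / s - n%:R * w / p)) ^+ m)%:E)%E.
Proof.
pose u := 2 * (2 ^+ m * (2 ^+ k)^-1 * rho0).
have u0 : 0 < u by rewrite !mulr_gt0 ?invr_gt0 ?pow2_gt0.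
(* Half the volume of a cube of side u, which is smaller than every cube of this level. The set
   above the level at [t] has measure at most [t], hence never covers more than half of such a
   cube. *)
pose t := u ^+ n / 2; have t0 : 0 < t by rewrite divr_gt0// exprn_gt0.
have N0 := cd_N0 cd.
pose W := (gam + 2) * (2 ^+ m.+1 * rho0).
have g2 : 0 < gam + 2 by rewrite addr_gt0.
have W0 : 0 < W by rewrite !mulr_gt0// pow2_gt0.
pose M := 2 `^ q^-1 * (C1 * (N * W `^ (n%:R / q - n%:R / p))).
have M0 : 0 <= M by rewrite !mulr_ge0 ?powR_ge0.
pose f := rearrangement (cut (hull m.+1) F).
have fM i : (f (2 ^+ i * t)%R <= (M * (2 ^+ i * t) `^ (- q^-1))%:E)%E.
  apply: (weak_dyadic q0 r0); last exact: F_dyadic W0.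
    by rewrite !mulr_ge0 ?powR_ge0.
  by rewrite mulr_gt0// pow2_gt0.
have Lj j : level_set m.+1 k j -> 2 * t <= (2 * rho j) ^+ n.
  move=> [h _ _]; rewrite /t mulrC divfK//; apply: lerXn2r; rewrite ?nnegrE ?(ltW u0)//.
    by rewrite mulr_ge0// ltW// (cd_rho cd).
  rewrite /u ler_pM2l// mulrAC ler_pdivrMr ?pow2_gt0//.
  by rewrite (le_trans (ltW h))// mulrC.
(* The ratio of the series over layers: 2^i from the measure against 2^(-iw/q) from the weak-type
   bound on the levels, hence w > q. *)
have [x50 x51] := andP (@pow2_lt1 R (1 - w / q) ltac:(by rewrite subr_lt0 ltr_pdivlMr// mul1r)).
have mass : (\sum_(j <oo) ((restr (level_set m.+1 k) j)%:E * mu (qb (c j) (rho j))) <=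
    (4 * M `^ w * t `^ (1 - w / q) * (1 - 2 `^ (1 - w / q))^-1)%:E)%E.
  apply: le_trans (@level_mass m.+1 k (level_set m.+1 k) t t0 _ _) _ => //.
    move=> j Jj; have rj := cd_rho cd j.
    apply: (@le_trans _ _ (2%:E * t%:E)%E); last by rewrite mu_qb ?(ltW rj)// -EFinM lee_fin Lj.
    have mc : measurable_fun [set: LT] (cut (hull m.+1) F).
      by apply: measurable_cut; [exact: measurable_qb|exact: cd_mF cd].
    rewrite lee_wpmul2l//; apply: le_trans (mu_gt_rearrangement mc (ltW t0)).
    by apply: le_mu => x /= [_]; rewrite gee0_abs// cut_ge0//; exact: cd_F0 cd.
  apply: (@le_trans _ _ (2%:E * \sum_(i <oo)
      (2 * M `^ w * t `^ (1 - w / q) * (2 `^ (1 - w / q)) ^+ i)%:E)%E).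
    rewrite lee_wpmul2l//; apply: lee_nneseries => i _.
      by move=> _; rewrite mule_ge0 ?poweR_ge0// lee_fin; exact: mulr_ge0 (exprn_ge0 _ _) (ltW t0).
    apply: (@le_trans _ _ ((2 ^+ i.+1 * t)%:E * (M * (2 ^+ i * t) `^ (- q^-1))%:E `^ w)%E).
      apply: lee_wpmul2l; first by rewrite lee_fin; exact: mulr_ge0 (exprn_ge0 _ _) (ltW t0).
      by apply: lee_poweR; [exact: ltW|exact: rearrangement_ge0|exact: fM].
    rewrite poweR_EFin -EFinM lee_fin powRM ?powR_ge0// -powRrM.
    apply: le_of_eq; rewrite -pow2_natM exprS.
    transitivity (2 * M `^ w * ((2 ^+ i * t) * (2 ^+ i * t) `^ (- q^-1 * w))); first by ring.
    rewrite -[RHS]mulrA; congr (_ * _).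
    have it0 : 0 < 2 ^+ i * t by rewrite mulr_gt0// pow2_gt0.
    rewrite !powR_expR// lnM ?posrE ?pow2_gt0// (expr_expR _ (ltr0Sn _ 1)) expRK.
    by rewrite -{1}[t]lnK// -!expRD; congr expR; field; rewrite gt_eqF.
  rewrite nneseries_geometricZ; last 2 first.
  - by rewrite !mulr_ge0 ?powR_ge0.
  - by apply/andP; split.
  by rewrite -EFinM lee_fin !mulrA -natrM.
(* A uniform bound for the integral of [B j k] over the test cube per unit of measure of the
   original cube, whose volume is at least 2t. *)
pose K : R := A * 2 `^ (- (k%:R * (w * D))) * rho0 `^ (n%:R - n%:R * w / s) *
  (2 ^+ m.+1 * rho0) `^ (n%:R * w / s) / (2 * t).
have t20 : 0 < 2 * t by rewrite mulr_gt0.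
have K0 : 0 <= K by rewrite divr_ge0 ?(ltW t20)// !mulr_ge0 ?powR_ge0.
apply: (@le_trans _ _ (K%:E * \sum_(j <oo)
    ((restr (level_set m.+1 k) j)%:E * mu (qb (c j) (rho j))))%E).
  rewrite -nneseriesZl; last by move=> j _; rewrite mule_ge0 ?mu_ge0// lee_fin restr_ge0.
  apply: lee_nneseries => j _.
    by move=> _; rewrite mule_ge0 ?lee_fin ?restr_ge0// integral_ge0// => x _; exact: cd_B0 cd j k x.
  have [Jj|nJ] := pselect (level_set m.+1 k j); last by rewrite restr_out// !mul0e mule0.
  rewrite muleCA lee_wpmul2l ?lee_fin ?restr_ge0//.
  have rj := cd_rho cd j; have [h1 h2 _] := Jj.
  have h0 : rho0 <= gam * (2 ^+ k * rho j).
    rewrite (@le_trans _ _ (2 ^+ m * rho0))//; first by rewrite ler_peMl ?(ltW rho0_gt0)// exprn_ege1// ler1n.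
    rewrite (le_trans (ltW h1))// ler_peMl// mulr_ge0 ?(ltW rj)// ltW// pow2_gt0.
  apply: (@le_trans _ _ _%:E); first by apply: (cd_int cd) => //; exact: h0.
  rewrite mu_qb ?(ltW rj)// -EFinM lee_fin /K -[leRHS]mulrA.
  rewrite -[leLHS]mulr1; apply: ler_pM => //; first by rewrite !mulr_ge0 ?powR_ge0.
    apply: ler_wpM2l; first by rewrite !mulr_ge0 ?powR_ge0.
    apply: ler_powR2 => //; last by rewrite mulr_ge0 ?(ltW rj)// ltW// pow2_gt0.
    by rewrite divr_ge0 ?(ltW s0)// mulr_ge0 ?ler0n// ltW.
  have Lj' := Lj _ Jj; rewrite [leRHS]mulrC.
  by rewrite (ler_pdivlMr _ _ t20) mul1r.

apply: le_trans (lee_wpmul2l _ mass) _; first by rewrite lee_fin.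
rewrite -EFinM lee_fin; apply: le_of_eq.
rewrite /K /large_const0.
have [Nz|Nn0] := eqVneq N 0.
  rewrite /M Nz mul0r !mulr0 powR0 ?(gt_eqF w0)//; ring.
have Np : 0 < N by rewrite lt_neqAle eq_sym Nn0.
have [C10|C1n0] := eqVneq C1 0.
  rewrite /M C10 mul0r !mulr0 powR0 ?(gt_eqF w0)//; ring.
have C1p : 0 < C1 by rewrite lt_neqAle eq_sym C1n0.
set v := (1 - 2 `^ (1 - w / q))^-1.
have q20 : 0 < 2 `^ q^-1 :> R by rewrite powR_gt0.
rewrite /M (powRM _ (ltW q20)) ?mulr_ge0 ?powR_ge0//.
rewrite (powRM _ (ltW C1p)) ?mulr_ge0 ?powR_ge0// (powRM _ (ltW Np)) ?powR_ge0//.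
rewrite (powRM _ (ltW q20) (ltW C1p)) -[W `^ _ `^ _]powRrM.
transitivity (2 * (A * v * (2 `^ q^-1) `^ w * C1 `^ w * N `^ w) *
  (2 `^ (- (k%:R * (w * D))) * rho0 `^ (n%:R - n%:R * w / s) *
   (2 ^+ m.+1 * rho0) `^ (n%:R * w / s) * t^-1 *
   W `^ ((n%:R / q - n%:R / p) * w) * t `^ (1 - w / q))).
  by field; rewrite gt_eqF.
transitivity (2 * (A * v * (2 `^ q^-1) `^ w * C1 `^ w * N `^ w) *
  (2 `^ (n%:R * w / s) * ((gam + 2) * 2) `^ (w * (n%:R / q - n%:R / p)) * 2 `^ (w / q) *
  2 `^ (- (n%:R * w / q)) * rho0 `^ (n%:R - n%:R * w / p) *
     (2 `^ (- (w * D - n%:R * w / q))) ^+ k *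
     (2 `^ (n%:R * w / s - n%:R * w / p)) ^+ m)); last by ring.
congr (_ * _).
have two0 : 0 < (2 : R) by [].
have eu : u = expR (ln 2 + m%:R * ln 2 - k%:R * ln 2 + ln rho0).
  by rewrite /u !expRD expRN !lnK// -!expr_expR// !mulrA.
have et : t = expR (n%:R * (ln 2 + m%:R * ln 2 - k%:R * ln 2 + ln rho0) - ln 2).
  by rewrite /t (expr_expR _ u0) eu expRK expRD expRN lnK.
have gt2 : 0 < (gam + 2) * 2 by rewrite mulr_gt0.
have eW : W = expR (ln ((gam + 2) * 2) + m%:R * ln 2 + ln rho0).
  by rewrite /W !expRD !lnK// -expr_expR// exprS; ring.
have em : 2 ^+ m.+1 * rho0 = expR (m.+1%:R * ln 2 + ln rho0).
  by rewrite expRD lnK// -expr_expR.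
rewrite -!pow2_natM em et eW (powR_expR _ gt2) !(powR_expR _ two0) !(powR_expR _ rho0_gt0).
rewrite !(powR_expR _ (expR_gt0 _)) !expRK -expRN -!expRD -natr1; congr expR.
by field; rewrite !gt_eqF.
Qed.

Definition large_const : R := large_const0 *
  (1 - 2 `^ (- (w * D - n%:R * w / q)))^-1 *
  (1 - 2 `^ (n%:R * w / s - n%:R * w / p))^-1.

Hypothesis n_gt0 : (0 < n)%N.

Lemma large_measure (a : R) : 0 < a ->
  (mu [set x | qb x0 rho0 x /\ ((a `^ w)%:E <
     \sum_(m <oo) \sum_(k <oo) \sum_(j <oo) ((restr (level_set m.+1 k) j)%:E * B j k x))%E] <=
   (large_const * (N `^ w * rho0 `^ (n%:R - n%:R * w / p)) / a `^ w)%:E)%E.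
Proof.
move=> a0; set X := [set x | _].
have aw0 : 0 < a `^ w by rewrite powR_gt0.
have w1q : 1 < w / q by rewrite ltr_pdivlMr// mul1r.
have np : 0 < n%:R :> R by rewrite ltr0n.
(* From w/q > 1: nw/q + 1 < (n+1)w/q < wD + 1. *)
have e3 : - (w * D - n%:R * w / q) < 0.
  rewrite oppr_lt0 subr_gt0 -(ltrD2r 1); apply: lt_trans decay.
  by rewrite -natr1 !mulrDl mul1r ltrD2l.
have e4 : n%:R * w / s - n%:R * w / p < 0.
  by rewrite subr_lt0 ltr_pM2l ?mulr_gt0// ltf_pV2 ?posrE.
have /andP[x30 x31] := pow2_lt1 e3; have /andP[x40 x41] := pow2_lt1 e4.
have /andP[x50 x51] := @pow2_lt1 R (1 - w / q) ltac:(by rewrite subr_lt0).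
have L0 : 0 <= large_const0.
  by rewrite !mulr_ge0 ?powR_ge0 ?invr_ge0 ?subr_ge0 ?(ltW x51).
pose b := large_const0 * (N `^ w * rho0 `^ (n%:R - n%:R * w / p)).
have b0 : 0 <= b by rewrite mulr_ge0// mulr_ge0 ?powR_ge0.
pose G m k x := (\sum_(j <oo) ((restr (level_set m.+1 k) j)%:E * B j k x))%E.
have mBr m k j : measurable_fun [set: LT] (fun x => (restr (level_set m.+1 k) j)%:E * B j k x)%E.
  by apply: measurable_funeM; exact: cd_mB cd j k.
have t0 m k j x : (0 <= (restr (level_set m.+1 k) j)%:E * B j k x)%E.
  by rewrite mule_ge0 ?lee_fin ?restr_ge0 ?(cd_B0 cd).
have G0 m k x : (0 <= G m k x)%E by exact: nneseries_ge0.
have mG m k : measurable_fun [set: LT] (G m k) by exact: ge0_emeasurable_sum.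
pose G' m x := (\sum_(k <oo) G m k x)%E.
have G'0 m x : (0 <= G' m x)%E by exact: nneseries_ge0.
have mG' m : measurable_fun [set: LT] (G' m) by exact: ge0_emeasurable_sum.
pose H x := (\sum_(m <oo) G' m x)%E.
have H0 x : (0 <= H x)%E by exact: nneseries_ge0.
have mH : measurable_fun [set: LT] H by exact: ge0_emeasurable_sum.
have mQ := @measurable_qb R n x0 rho0.
have intH : (\int[mu]_(x in qb x0 rho0) H x <=
    (large_const * (N `^ w * rho0 `^ (n%:R - n%:R * w / p)))%:E)%E.
  rewrite (@integral_nneseries _ LT R mu _ mQ _ (fun m => measurable_funTS (mG' m)) (fun m x _ => G'0 m x)).
  apply: (@le_trans _ _ (\sum_(m <oo) (b * (1 - 2 `^ (- (w * D - n%:R * w / q)))^-1 *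
      (2 `^ (n%:R * w / s - n%:R * w / p)) ^+ m)%:E)%E).
    apply: lee_nneseries => m _; first by move=> _; exact: integral_ge0.
    rewrite (@integral_nneseries _ LT R mu _ mQ _ (fun k => measurable_funTS (mG m k)) (fun k x _ => G0 m k x)).
    apply: (@le_trans _ _ (\sum_(k <oo) (b * (2 `^ (n%:R * w / s - n%:R * w / p)) ^+ m *
      (2 `^ (- (w * D - n%:R * w / q))) ^+ k)%:E)%E).
      apply: lee_nneseries => k _; first by move=> _; exact: integral_ge0.
      rewrite (@integral_nneseries _ LT R mu _ mQ _ (fun j => measurable_funTS (mBr m k j)) (fun j x _ => t0 m k j x)).
      rewrite mulrAC; apply: le_trans (large_term m k).
      apply: lee_nneseries => j _; first by move=> _; exact: integral_ge0.
      rewrite (@ge0_integralZl_EFin _ LT R mu _ mQ _ (fun x _ => cd_B0 cd j k x)) ?restr_ge0//.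
      by apply: measurable_funTS; exact: cd_mB cd j k.
    rewrite nneseries_geometricZ; last 2 first.
    - by rewrite mulr_ge0// exprn_ge0.
    - by apply/andP; split.
    by rewrite mulrAC.
  rewrite nneseries_geometricZ; last 2 first.
  - by rewrite mulr_ge0// invr_ge0 subr_ge0 ltW.
  - by apply/andP; split.
  by rewrite lee_fin /large_const /b; apply: le_of_eq; ring.
have mc : measurable_fun [set: LT] (cut (qb x0 rho0) H) by exact: measurable_cut.
have c0 x : (0 <= cut (qb x0 rho0) H x)%E by exact: cut_ge0.
rewrite -(@lee_pmul2l _ (a `^ w)%:E) ?lte_fin// -EFinM mulrCA divff ?(gt_eqF aw0)// mulr1.
apply: le_trans intH; rewrite integral_mkcond.
have -> : (H \_ (qb x0 rho0)) = cut (qb x0 rho0) H.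
  apply/funext => x; rewrite patchE; case: ifPn => [/set_mem h|/negP h]; first by rewrite cut_in.
  by rewrite cut_out// => h'; apply: h; rewrite inE.
apply: le_trans (@markov_nonneg _ LT R mu _ _ mc c0 aw0).
rewrite lee_wpmul2l ?lee_fin ?(ltW aw0)//; apply: le_mu => x [xQ hx] /=.
by rewrite cut_in.
Qed.


End large_cubes.

(** * From distribution bounds to the rearrangement of the majorant *)

Section combination.
Variables (alpha beta C1 : R).
Hypothesis alpha_w : alpha * w < w * D + 1.
Hypothesis beta_w : 1 < beta * w.
Hypothesis C1_ge0 : 0 <= C1.
Hypothesis F_dyadic : forall x tau, 0 < tau ->
  dyadic_lorentz q r (rearrangement2 (cut (qb x tau) F))
    (C1 * (N * tau `^ (n%:R / q - n%:R / p))).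
Hypothesis n_gt0 : (0 < n)%N.
Variables (H : 'rV[R]_n -> \bar R) (M : nat).
Hypothesis H_ge0 : forall x, (0 <= H x)%E.
Hypothesis H_le : forall x,
  (H x `^ w <= \sum_(j <oo) \sum_(k <oo) ((y j)%:E * B j k x))%E.
Hypothesis M_large : small_const alpha beta + large_const C1 <= 2 ^+ M.

Lemma combined_rearrangement (l : int) :
  (rearrangement2 (cut (qb x0 rho0) H) (l + M%:Z) <= (2 `^ w^-1)%:E *
     maxe (shift_sup alpha beta (rearrangement2 (cut (hull 0) F)) l)
       (if ((2 : R) ^ l < (2 * rho0) ^+ n / 2 ^+ M)%R then
         (N * rho0 `^ (n%:R / w - n%:R / p) * 2 `^ (- (l%:~R / w)))%:E else 0))%E.
Proof.
have w20 : 0 < 2 `^ w^-1 :> R by rewrite powR_gt0.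
set S := shift_sup _ _ _ l; have N0 := cd_N0 cd.
have S0 : (0 <= S)%E.
  apply: (@le_trans _ _ ((2 `^ (0%N%:R * beta - 0%N%:R * alpha))%:E *
      rearrangement2 (cut (hull 0) F) (l + (0%N%:Z - (0 * n.+1)%:Z))%R)%E).
    by rewrite mule_ge0 ?lee_fin ?powR_ge0// rearrangement2_ge0.
  apply: (@le_trans _ _ (ereal_sup (range (fun i : nat =>
    ((2 `^ (i%:R * beta - 0%N%:R * alpha))%:E *
      rearrangement2 (cut (hull 0) F) (l + (i%:Z - (0 * n.+1)%:Z))%R)%E)))).
    by apply: ereal_sup_ubound; exists 0%N.
  by apply: ereal_sup_ubound; exists 0%N.
case: ifPn => [hl|]; last first.
  (* Here 2^(l+M) is at least the volume of the test cube, so the rearrangement on the left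
     vanishes. *)
  rewrite -leNgt ler_pdivrMr ?pow2_gt0// [2 ^ l * _]mulrC pow2_natz addrC => hl.
  rewrite [leLHS]rearrangement_cut_eq0 ?mule_ge0 ?lee_fin ?(ltW w20)//.
    by rewrite le_max S0.
  by rewrite mu_qb ?(ltW rho0_gt0)// lee_fin.
set T := N * _ * _; have T0 : 0 <= T by rewrite !mulr_ge0 ?powR_ge0.
have := le_max T%:E S T%:E; rewrite lexx orbT => /esym Tm.
have := le_max S S T%:E; rewrite lexx => /esym; set m := maxe S T%:E => Sm.
have {}Tm : (T%:E <= m)%E by rewrite /m le_max lexx orbT.
have {}Sm : (S <= m)%E by rewrite /m le_max lexx.
have m0 : (0 <= m)%E by exact: le_trans S0 Sm.
have [moo|moo] := eqVneq m +oo%E; first by rewrite moo gt0_muley ?lte_fin// leey.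
have E : m = (fine m)%:E by rewrite fineK// ge0_fin_numE// ltey.
have b0 : 0 <= fine m by rewrite fine_ge0.
rewrite E; set b := fine m in E b0 *; rewrite -EFinM.
(* [small_measure] requires the threshold to exceed the supremum strictly and to be positive, hence
   an arbitrarily small excess. *)
apply/lee_addgt0Pr => e e0.
pose a := b + e / 2 `^ w^-1.
have ab : b < a by rewrite ltrDl divr_gt0.
have a0 : 0 < a by exact: le_lt_trans ab.
have -> : ((2 `^ w^-1 * b)%:E + e%:E = (2 `^ w^-1 * a)%:E)%E.
  by rewrite -EFinD mulrDr mulrCA divff ?mulr1// gt_eqF.
apply: rearrangement_le; first by rewrite mulr_gt0.
rewrite addrC -pow2_natz.
apply: (@le_trans _ _ ((small_const alpha beta + large_const C1) * 2 ^ l)%:E); last first.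
  by rewrite lee_fin ler_wpM2r// ltW// exp2z_gt0.
have Sa : (S < a%:E)%E by apply: le_lt_trans Sm _; rewrite E lte_fin.
have Ta : T <= a by rewrite -lee_fin (le_trans Tm)// E lee_fin ltW.
have SM := small_measure alpha_w beta_w a0 Sa.
have LM := large_measure C1_ge0 F_dyadic n_gt0 a0.
have aw0 : 0 < a `^ w by rewrite powR_gt0.
apply: le_trans; last first.
  rewrite mulrDl EFinD; apply: leeD; first exact: SM.
  apply: le_trans LM _; rewrite lee_fin -mulrA; apply: ler_wpM2l.
    have /andP[x30 x31] := @pow2_lt1 R (- (w * D - n%:R * w / q)) ltac:(
      rewrite oppr_lt0 subr_gt0 -(ltrD2r 1); apply: lt_trans decay;
      rewrite -natr1 !mulrDl mul1r ltrD2l ltr_pdivlMr// mul1r; exact: qw).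
    have /andP[x40 x41] := @pow2_lt1 R (n%:R * w / s - n%:R * w / p) ltac:(
      rewrite subr_lt0 ltr_pM2l ?mulr_gt0 ?ltr0n// ltf_pV2 ?posrE//).
    have /andP[x50 x51] := @pow2_lt1 R (1 - w / q) ltac:(by rewrite subr_lt0 ltr_pdivlMr// mul1r).
    by rewrite !mulr_ge0 ?powR_ge0 ?invr_ge0 ?subr_ge0 ?(ltW x51) ?(ltW x31) ?(ltW x41).
  rewrite ler_pdivrMr//; apply: (@le_trans _ _ (2 ^ l * T `^ w)); last first.
    by rewrite ler_wpM2l ?(ltW (exp2z_gt0 _))// ler_powR2// ltW.
  have [->|Nn0] := eqVneq N 0.
    by rewrite powR0 ?(gt_eqF w0)// mul0r mulr_ge0 ?powR_ge0// ltW// exp2z_gt0.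
  have Np : 0 < N by rewrite lt_neqAle eq_sym Nn0.
  rewrite /T powRM ?mulr_ge0 ?powR_ge0// powRM ?powR_ge0// -!powRrM.
  apply: le_of_eq.
  transitivity (N `^ w * (2 ^ l * (rho0 `^ ((n%:R / w - n%:R / p) * w) *
    2 `^ (- (l%:~R / w) * w)))); last by ring.
  congr (_ * _).
  rewrite exprz_expR// !powR_expR// -!expRD; congr expR; field.
  by rewrite !gt_eqF.
apply: le_trans (mu_subU _ _); apply: le_mu => x /= hx.
have xQ : qb x0 rho0 x.
  apply: contrapT => nx; move: hx; rewrite cut_out// abse0 lte_fin ltNge.
  by rewrite mulr_ge0// ltW.
move: hx; rewrite cut_in// gee0_abs// => hx.
have {}hx : ((2 * a `^ w)%:E < H x `^ w)%E.
  have -> : 2 * a `^ w = (2 `^ w^-1 * a) `^ w.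
    by rewrite powRM ?powR_ge0 ?(ltW a0)// -powRrM mulVf ?gt_eqF// powRr1.
  rewrite -poweR_EFin ltNge; apply/negP => h.
  move: hx; rewrite ltNge => /negP; apply.
  by have := lee_poweRK w0 (H_ge0 x) (poweR_ge0 _ _) h; rewrite poweRK// ?gt_eqF// lee_fin mulr_ge0 ?(ltW a0).
have := lt_le_trans hx (le_trans (H_le x) (level_split xQ)).
have u0 m' k : (0 <= \sum_(j <oo) ((restr (level_set m' k) j)%:E * B j k x))%E.
  by apply: nneseries_ge0 => j _ _; rewrite mule_ge0 ?lee_fin ?restr_ge0 ?(cd_B0 cd).
have v0 m' : (0 <= \sum_(k <oo) \sum_(j <oo) ((restr (level_set m' k) j)%:E * B j k x))%E.
  by apply: nneseries_ge0 => k _ _; exact: u0.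
move=> /(nneseries_lt_split v0) [h1|h2]; [by left|right; split => //].
Qed.

End combination.

End data.

Theorem core_estimate (n_gt0 : (0 < n)%N) : exists C : R, 0 < C /\
  forall c rho y B F N (H : 'rV[R]_n -> \bar R), core_data c rho y B F N ->
  (forall x, 0 <= H x)%E ->
  (forall x, H x `^ w <= \sum_(j <oo) \sum_(k <oo) ((y j)%:E * B j k x))%E ->
  forall x0 rho0, 0 < rho0 ->
  dyadic_lorentz q r (rearrangement2 (cut (qb x0 rho0) H))
    (C * (N * rho0 `^ (n%:R / q - n%:R / p))).
Proof.
(* Midpoints of the admissible intervals ((n+1)/q, D + 1/w) and (1/w, 1/q); the first is nonempty by
   [decay], the second because q < w. *)
pose alpha := (n.+1%:R / q + (w * D + 1) / w) / 2.
pose beta := (w^-1 + q^-1) / 2.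
have wq : w^-1 < q^-1 by rewrite ltf_pV2 ?posrE.
have e0 : n.+1%:R / q < (w * D + 1) / w by rewrite ltr_pdivlMr// mulrAC.
have alpha_q : n.+1%:R / q < alpha by rewrite /alpha; lra.
have alpha_w : alpha * w < w * D + 1 by rewrite -ltr_pdivlMr// /alpha; lra.
have beta_w : 1 < beta * w by rewrite -ltr_pdivrMr// div1r /beta; lra.
have beta_q : beta < q^-1 by rewrite /beta; lra.
have [C1 [C10 HC1]] := @morrey_dyadic R n p q r q0 r0.
have [C2 [C20 HC2]] := shift_sup_bound alpha_q beta_q.
have [C3 [C30 HC3]] := power_tail_bound.
have [C4 [C40 HC4]] := dyadic_lorentz_max q r0.
pose Z := small_const alpha beta + large_const C1.
pose M := (Num.truncn Z).+1.
have ZM : Z <= 2 ^+ M.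
  apply: (@le_trans _ _ (M%:R : R)); first exact/ltW/truncnS_gt.
  by rewrite -natrX ler_nat ltnW// ltn_expl.
have [E0 E0p] : exists E, E = n%:R / q - n%:R / p by eexists.
pose C5 := C2 * (C1 * (gam + 2) `^ E0) + C3.
have g2 : 0 < gam + 2 by rewrite addr_gt0.
have C50 : 0 < C5 by rewrite addr_gt0 ?mulr_gt0 ?powR_gt0.
exists (dweight q M%:Z * (2 `^ w^-1 * (C4 * C5))); split.
  by rewrite !mulr_gt0 ?powR_gt0.
move=> c rho y B F N H cd H0 HB x0 rho0 rho00; rewrite -E0p.
have N0 := cd_N0 cd.
have FD := HC1 F N N0 (cd_norm cd).
pose S := shift_sup alpha beta (rearrangement2 (cut (hull x0 rho0 0) F)).
pose X := (2 * rho0) ^+ n / 2 ^+ M.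
pose T (l : int) : \bar R := if (2 : R) ^ l < X then
  (N * rho0 `^ (n%:R / w - n%:R / p) * 2 `^ (- (l%:~R / w)))%:E else 0%E.
have a0 : 0 <= N * rho0 `^ E0 by rewrite mulr_ge0 ?powR_ge0.
have S0 l : (0 <= S l)%E.
  have t0 : (0 <= (2 `^ (0%N%:R * beta - 0%N%:R * alpha))%:E *
      rearrangement2 (cut (hull x0 rho0 0) F) (l + (0%N%:Z - (0 * n.+1)%:Z))%R)%E.
    by rewrite mule_ge0 ?lee_fin ?powR_ge0// rearrangement2_ge0.
  apply: le_trans t0 _; apply: le_trans; last by apply: ereal_sup_ubound; exists 0%N.
  by apply: ereal_sup_ubound; exists 0%N.
have T0 l : (0 <= T l)%E by rewrite /T; case: ifP => // _; rewrite lee_fin !mulr_ge0 ?powR_ge0.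
have HS : dyadic_lorentz q r S (C5 * (N * rho0 `^ E0)).
  apply: (@dyadic_lorentz_le _ q r S _ (C2 * (C1 * (N * ((gam + 2) * (2 ^+ 0 * rho0)) `^ E0)))) => //.
  - by rewrite !mulr_ge0 ?powR_ge0// ltW.
  - rewrite expr0 mul1r powRM ?(ltW g2) ?(ltW rho00)// /C5 mulrDl -[leLHS]addr0.
    apply: lerD; last by rewrite mulr_ge0// ltW.
    by apply: le_of_eq; ring.
  - by move=> l; rewrite S0 lexx.
  apply: HC2; first by rewrite !mulr_ge0 ?powR_ge0// ltW.
    exact: rearrangement2_ge0.
  by rewrite E0p; apply: FD; rewrite !mulr_gt0.
have HT : dyadic_lorentz q r T (C5 * (N * rho0 `^ E0)).
  apply: (@dyadic_lorentz_le _ q r T _ (C3 * (N * rho0 `^ E0))) => //.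
  - by rewrite mulr_ge0// ltW.
  - by rewrite ler_wpM2r// /C5 lerDr mulr_ge0 ?mulr_ge0 ?powR_ge0// ltW.
  - by move=> l; rewrite T0 lexx.
  rewrite E0p; apply: HC3 => //; first by rewrite divr_gt0 ?exprn_gt0// mulr_gt0.
  by rewrite ler_pdivrMr ?exprn_gt0// ler_peMr ?exprn_ge0 ?mulr_ge0 ?(ltW rho00)// exprn_ege1// ler1n.
have HM := HC4 S T _ (mulr_ge0 (ltW C50) a0) S0 T0 HS HT.
have m0 l : (0 <= maxe (S l) (T l))%E by rewrite le_max S0.
have {}HM := dyadic_lorentz_scale (mulr_ge0 (ltW C40) (mulr_ge0 (ltW C50) a0))
  (powR_ge0 2 w^-1) m0 HM.
have b0 : 0 <= 2 `^ w^-1 * (C4 * (C5 * (N * rho0 `^ E0))).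
  by rewrite !mulr_ge0 ?powR_ge0 ?(ltW C40) ?(ltW C50).
have HR : dyadic_lorentz q r (fun l => rearrangement2 (cut (qb x0 rho0) H) (l + M%:Z))
    (2 `^ w^-1 * (C4 * (C5 * (N * rho0 `^ E0)))).
  apply: (dyadic_lorentz_le r0 b0 (lexx _) _ HM) => l; rewrite rearrangement2_ge0/=.
  have hh := combined_rearrangement cd x0 rho00 alpha_w beta_w (ltW C10) FD n_gt0 H0 HB ZM l.
  exact: hh.
(* Undoing the shift by [M] costs only the constant factor [dweight q M%:Z]. *)
have := dyadic_lorentz_shift (- M%:Z) b0 (fun l => rearrangement2_ge0 _ _) HR.
rewrite opprK !mulrA; congr (dyadic_lorentz q r _ _).
by apply/funext => l; rewrite subrK.
Qed.

End core.

(** * Grid maximal function *)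

Lemma powR_le1 (R : realType) (a x : R) : 0 <= x -> 0 <= a -> a <= 1 -> a `^ x <= 1.
Proof. by move=> x0 a0 a1; rewrite (le_trans (ler_powR2 x0 a0 a1))// powR1. Qed.

Lemma powR_ge1 (R : realType) (a x : R) : 0 <= x -> 1 <= a -> 1 <= a `^ x.
Proof. by move=> x0 a1; rewrite -[leLHS](_ : 1 `^ x = 1) ?ler_powR2// powR1. Qed.

Lemma integral_cut (R : realType) n (D : set 'rV[R]_n) (g : 'rV[R]_n -> \bar R) :
  (\int[@lebesgue_rV R n]_x cut D g x = \int[@lebesgue_rV R n]_(x in D) g x)%E.
Proof.
rewrite [RHS]integral_mkcond; congr (integral _ _ _); apply/funext => x.
rewrite patchE; case: ifPn => [/set_mem h|h]; first by rewrite cut_in.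
by rewrite cut_out// => /mem_set; exact/negP.
Qed.

Section maximal.
Context {R : realType} {n : nat}.
Local Notation mu := (@lebesgue_rV R n).
Local Notation LT := (@lebesgue_space R n).
Variable g : LT -> \bar R.
Hypothesis mg : measurable_fun [set: LT] g.
Hypothesis g0 : forall x, (0 <= g x)%E.

(** A cube of radius t lies in a grid cube of radius at most 4t, whose average is at most [A]
    because it contains [x]. *)
Lemma grid_cube_average (x : 'rV[R]_n) (A t : R) : 0 <= A -> 0 < t ->
  ~ grid_level_set g A x -> (\int[mu]_(y in qb x t) g y <= (A * (8 * t) ^+ n)%:E)%E.
Proof.
move=> A0 t0 nx; have [l /andP[l1 l2]] := exp2z_bracket t0.
have [k [xk rk]] := grid_cube_sup x (ltW l2).
have kx : grid_cube k x by apply: xk; rewrite /qb/= subrr normr0 ltW.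
apply: (@le_trans _ _ (\int[mu]_(y in grid_cube k) g y)%E).
  apply: (@ge0_subset_integral _ LT R mu) => //; try exact: measurable_qb.
  exact: measurable_funTS.
apply: (@le_trans _ _ (A%:E * mu (grid_cube k))%E).
  by rewrite leNgt; apply/negP => h; apply: nx; exists k.
rewrite mu_qb ?(ltW (grid_radius_gt0 _))// -EFinM lee_fin ler_wpM2l//.
have r0 := ltW (@grid_radius_gt0 R n k).
rewrite lerXn2r ?nnegrE ?mulr_ge0 ?(ltW t0)// rk.
have -> : (2 : R) ^ (l + 1) = 2 * 2 ^ l by rewrite addrC -pow2_natz expr1.
lra.
Qed.


Lemma dyadic_ball_ex (x y : 'rV[R]_n) (t : R) : 0 < t -> exists m : nat,
  qb x (2 ^+ m * t) y /\ 2 ^+ m <= 2 * (1 + `|x - y| / t).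
Proof.
move=> t0; have ex : exists m : nat, `|y - x| <= 2 ^+ m * t.
  exists (Num.truncn (`|y - x| / t)).+1; rewrite -ler_pdivrMr//.
  apply: (@le_trans _ _ ((Num.truncn (`|y - x| / t)).+1%:R)); first exact/ltW/truncnS_gt.
  by rewrite -natrX ler_nat ltnW// ltn_expl.
have d0 : 0 <= `|x - y| / t by rewrite divr_ge0// ltW.
case: (ex_minnP ex) => -[|m] hm mmin; first by exists 0%N; split => //; lra.
exists m.+1; split => //.
have : 2 ^+ m * t < `|y - x|.
  by rewrite ltNge; apply/negP => /mmin; rewrite ltnn.
rewrite distrC -ltr_pdivlMr// => h; rewrite exprS; lra.
Qed.

(** The kernel is dominated by a sum over the cubes of radius 2^m t about [x]. The decay exponent n
    + 1 exceeds the dimension by one, which leaves the summable factor 2^(-m). *)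
Lemma kernel_maximal_bound (x : 'rV[R]_n) (A A0 t : R) (K : 'rV[R]_n -> R) :
  0 <= A -> 0 <= A0 -> 0 < t -> ~ grid_level_set g A x ->
  (forall y, 0 <= K y <= A0 / t ^+ n / (1 + `|x - y| / t) ^+ n.+1) ->
  (\int[mu]_y (g y * (K y)%:E) <= (4 * 16 ^+ n * A0 * A)%:E)%E.
Proof.
move=> A1 A00 t0 nx HK.
(* On the smallest such cube containing [y], 1 + |x - y| / t is at least 2^m / 2. *)
pose cf m := A0 / t ^+ n * (2 / 2 ^+ m) ^+ n.+1.
have cf0 m : 0 <= cf m by rewrite /cf mulr_ge0 ?exprn_ge0 ?divr_ge0 ?exprn_ge0// ltW.
pose h m (y : LT) := ((cf m)%:E * cut (qb x (2 ^+ m * t)) g y)%E.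
have h0 m y : (0 <= h m y)%E by rewrite mule_ge0 ?lee_fin// cut_ge0.
have mc m : measurable_fun [set: LT] (cut (qb x (2 ^+ m * t)) g).
  by apply: measurable_cut => //; exact: measurable_qb.
have mh m : measurable_fun [set: LT] (h m) by exact: measurable_funeM.
apply: (@le_trans _ _ (\int[mu]_y (\sum_(m <oo) h m y))%E).
  apply: ge0_le_integral_nomeas => y _; have /andP[K0 K1] := HK y.
    by rewrite mule_ge0// lee_fin.
  have [m [my ym]] := dyadic_ball_ex x y t0.
  apply: le_trans (nneseries_term m (fun k => h0 k y)).
  rewrite /h cut_in// muleC lee_wpmul2r// lee_fin (le_trans K1)// /cf.
  have d0 : 0 <= `|x - y| / t by rewrite divr_ge0// ltW.
  rewrite -[(_ ^+ n.+1)^-1]exprVn ler_wpM2l ?divr_ge0 ?exprn_ge0 ?(ltW t0)//.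
  rewrite lerXn2r ?nnegrE ?divr_ge0 ?invr_ge0 ?exprn_ge0 ?addr_ge0//.
  by rewrite ler_pdivlMr ?exprn_gt0// mulrC ler_pdivrMr ?ltr_pwDl.
rewrite (@integral_nneseries _ LT R mu _ measurableT h mh (fun m y _ => h0 m y)).
apply: (@le_trans _ _ (\sum_(m <oo) ((2 * 16 ^+ n * A0 * A)%:E * ((2^-1) ^+ m)%:E))%E).
  apply: lee_nneseries => m _; first by move=> _; exact: integral_ge0.
  rewrite /h (@ge0_integralZl_EFin _ LT R mu _ measurableT _ (fun y _ => cut_ge0 _ _ g0) (mc m))//.
  rewrite integral_cut.
  apply: (@le_trans _ _ ((cf m)%:E * (A * (8 * (2 ^+ m * t)) ^+ n)%:E)%E).
    rewrite lee_wpmul2l ?lee_fin//; apply: grid_cube_average => //.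
    by rewrite mulr_gt0.
  rewrite -!EFinM lee_fin; apply: le_of_eq; rewrite /cf.
  have tn : t ^+ n != 0 by rewrite expf_eq0 gt_eqF// andbF.
  have mn : (2 : R) ^+ m != 0 by rewrite expf_eq0 pnatr_eq0 andbF.
  have -> : (16 : R) ^+ n = 2 ^+ n * 8 ^+ n by rewrite -exprMn; congr (_ ^+ _); ring.
  rewrite !exprMn !exprVn exprS [(2 ^+ m) ^+ n.+1]exprS; field.
  by rewrite tn mn expf_neq0.
rewrite nneseriesZl; last by move=> m _; rewrite lee_fin exprn_ge0// invr_ge0.
rewrite nneseries_geometric; last by rewrite invr_ge0 ler0n/= invf_lt1// ltr1n.
rewrite -EFinM lee_fin (_ : (1 - 2^-1)^-1 = 2); first by lra.
by field.
Qed.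

Variables (s A1 rho : R).
Hypotheses (s1 : 1 <= s) (A1_ge1 : 1 <= A1) (rho0 : 0 < rho).
Hypothesis g_avg : forall x t, 0 < t ->
  (\int[mu]_(y in qb x t) g y <= (A1 * t `^ (n%:R - n%:R / s) * rho `^ (n%:R / s))%:E)%E.

Let s0 : 0 < s. Proof. exact: lt_le_trans s1. Qed.
Let A1_ge0 : 0 <= A1. Proof. exact: le_trans A1_ge1. Qed.
Let ns0 : 0 <= n%:R / s. Proof. by rewrite divr_ge0// ltW. Qed.
Let nns0 : 0 <= n%:R - n%:R / s.
Proof. by rewrite subr_ge0 ler_pdivrMr// ler_peMr. Qed.

(** Averages over grid cubes of radius above [t] are too small by the Morrey growth. Every selected
    cube is thus of radius at most [t], and those meeting [qb x t] stay within [3 * t]. *)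
Lemma grid_level_set_local x t A : 0 < t -> 0 < A -> A1 * (rho / t) `^ (n%:R / s) <= A ->
  grid_level_set g A `&` qb x t `<=` grid_level_set (cut (qb x (3 * t)) g) A.
Proof.
move=> t0 A0 hA y [[k /= hk ky] yt]; exists k => //=; apply: (lt_le_trans hk).
have [rt|tr] := leP (@grid_radius R n k) t; last first.
  exfalso; move: (hk); rewrite ltNge => /negP; apply.
  apply: le_trans (g_avg _ (grid_radius_gt0 k)) _.
  rewrite mu_qb ?(ltW (grid_radius_gt0 k))// -EFinM lee_fin.
  have r0 := @grid_radius_gt0 R n k; set a := grid_radius k in tr r0 *.
  apply: (@le_trans _ _ (A1 * (rho / t) `^ (n%:R / s) * a ^+ n)); last first.
    apply: ler_pM => //; first by rewrite mulr_ge0 ?powR_ge0.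
      by rewrite exprn_ge0// ltW.
    by rewrite lerXn2r ?nnegrE ?mulr_ge0 ?(ltW r0)// ler_peMl ?(ltW r0)// ler1n.
  rewrite -!mulrA ler_wpM2l//.
  have -> : a `^ (n%:R - n%:R / s) * rho `^ (n%:R / s) = (rho / a) `^ (n%:R / s) * a ^+ n.
    by rewrite !powR_expR ?divr_gt0// ln_div ?posrE// expr_expR// -!expRD; congr expR; ring.
  rewrite ler_wpM2r ?exprn_ge0 ?(ltW r0)//.
  apply: ler_powR2 => //; first by rewrite divr_ge0// ltW.
  by rewrite ler_wpM2l ?(ltW rho0)// lef_pV2 ?posrE// ltW.
apply: le_of_eq; apply: eq_integral => z /set_mem kz.
rewrite cut_in//; rewrite /grid_cube /qb/= in kz ky yt *.
have -> : z - x = (z - grid_center k) + (grid_center k - y) + (y - x).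
  by rewrite !addrA !subrK.
rewrite (le_trans (ler_normD _ _))// (le_trans (lerD (ler_normD _ _) (lexx _)))//.
by rewrite [`|_ - y|]distrC; lra.
Qed.

(** For A above [L] the weak-type inequality is used on the enlarged cube: one factor 3^n is its
    constant and the other bounds the growth of the integral. Otherwise the volume of [qb x t]
    suffices. *)
Lemma grid_level_set_measure x t A L : 0 < t -> 0 < A -> A1 * (rho / t) `^ (n%:R / s) <= L ->
  (mu (grid_level_set g A `&` qb x t) <= (9 ^+ n * t ^+ n * Num.min 1 (L / A))%:E)%E.
Proof.
move=> t0 A0 hL.
have h1 : (mu (grid_level_set g A `&` qb x t) <= (9 ^+ n * t ^+ n)%:E)%E.
  apply: (le_trans (le_mu (@subIsetr _ _ _))); rewrite mu_qb ?(ltW t0)// lee_fin exprMn.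
  rewrite ler_wpM2r ?exprn_ge0 ?(ltW t0)// lerXn2r ?nnegrE//; lra.
rewrite minEle; case: ifPn => [_|]; first by rewrite mulr1.
rewrite -ltNge ltr_pdivrMr// mul1r => LA.
have hA : A1 * (rho / t) `^ (n%:R / s) <= A by apply: le_trans hL (ltW LA).
apply: (le_trans (le_mu (grid_level_set_local t0 A0 hA))).
have m3 : measurable (qb x (3 * t) : set LT) by exact: measurable_qb.
have := weak_type_grid (measurable_cut m3 mg) (fun y => cut_ge0 (qb x (3 * t)) y g0) A0.
rewrite integral_cut => /le_trans h.
rewrite mulrA EFinM muleC lee_pdivlMl//; apply: h.
apply: (@le_trans _ _ ((3 ^+ n)%:E * (A1 * (3 * t) `^ (n%:R - n%:R / s) * rho `^ (n%:R / s))%:E)%E).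
  by rewrite lee_wpmul2l ?lee_fin ?exprn_ge0// g_avg// mulr_gt0.
rewrite -EFinM lee_fin.
apply: (@le_trans _ _ (9 ^+ n * t ^+ n * (A1 * (rho / t) `^ (n%:R / s)))); last first.
  by rewrite ler_wpM2l ?mulr_ge0 ?exprn_ge0 ?(ltW t0).
have -> : (9 : R) ^+ n = 3 ^+ n * 3 ^+ n by rewrite -exprMn; congr (_ ^+ _); ring.
rewrite -!mulrA ler_wpM2l ?exprn_ge0//.
rewrite ![_ * (A1 * _)]mulrCA; apply: ler_wpM2l => //.
rewrite [(3 * t) `^ _]powRM ?(ltW t0)// -mulrA; apply: ler_pM; rewrite ?powR_ge0 ?mulr_ge0 ?powR_ge0//.
  by rewrite -powR_mulrn// ler_powR ?ler1n// gerBl.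
apply: le_of_eq.
by rewrite !powR_expR ?divr_gt0// ln_div ?posrE// expr_expR// -!expRD; congr expR; ring.
Qed.

End maximal.

(** The dyadic form of Kolmogorov's inequality. Up to 2^i of size [L] the terms grow like 2^(iw);
    beyond it they decay like 2^(i(w-1)), which is where w < 1 enters. *)
Lemma geometric_min (R : realType) (w : R) : 0 < w -> w < 1 -> exists C : R, 0 < C /\
  forall L : R, 1 <= L ->
  (\sum_(i <oo) (2 `^ (i.+1%:R * w) * Num.min 1 (L / 2 ^+ i))%:E <= (C * L `^ w)%:E)%E.
Proof.
move=> w0 w1; have /andP[z0 z1] := @pow2_lt1 R (w - 1) ltac:(by rewrite subr_lt0).
have x1 : 1 < (2 : R) `^ w by rewrite powR_expR// expR_gt1 mulr_gt0// ln_gt0// ltr1n.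
pose C1 : R := 2 `^ w * (2 `^ w / (2 `^ w - 1)).
pose C2 : R := 2 `^ w * (1 - 2 `^ (w - 1))^-1.
have C10 : 0 < C1 by rewrite !mulr_gt0 ?invr_gt0 ?powR_gt0// subr_gt0.
have C20 : 0 < C2 by rewrite mulr_gt0 ?invr_gt0 ?powR_gt0// subr_gt0.
exists (C1 + C2); split; first by rewrite addr_gt0.
move=> L L1; have L0 : 0 < L by exact: lt_le_trans L1.
have ex : exists m : nat, L < 2 ^+ m.
  exists (Num.truncn L).+1; apply: lt_trans (truncnS_gt _) _.
  by rewrite -natrX ltr_nat ltn_expl.
case: (ex_minnP ex) => m Lm mmin.
have mL : (0 < m)%N -> 2 ^+ m <= 2 * L.
  case: m mmin {Lm} => // m mmin _; rewrite exprS ler_pM2l// leNgt.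
  by apply/negP => /mmin; rewrite ltnn.
have t0 i : 0 <= 2 `^ (i.+1%:R * w) * Num.min 1 (L / 2 ^+ i) :> R.
  by rewrite mulr_ge0 ?powR_ge0// le_min ler01 divr_ge0 ?exprn_ge0// ltW.
rewrite (@nneseries_split _ _ 0 m); last by move=> i _; rewrite lee_fin.
rewrite add0n mulrDl EFinD; apply: leeD.
  rewrite sumEFin lee_fin.
  apply: (@le_trans _ _ (\sum_(0 <= i < m) 2 `^ w * (2 `^ w) ^+ i)).
    apply: ler_sum => i _; rewrite -[leRHS]mulr1; apply: ler_pM; rewrite ?powR_ge0//.
    - by rewrite le_min ler01 divr_ge0 ?exprn_ge0// ltW.
    - by rewrite -exprS -pow2_natM.
    - by rewrite ge_min lexx.
  rewrite -mulr_sumr -mulrA ler_wpM2l ?powR_ge0// big_mkord.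
  have := subrX1 ((2 : R) `^ w) m => /esym/(canRL (mulKf _)) ->; last by rewrite gt_eqF// subr_gt0.
  rewrite mulrC -mulrA [_^-1 * _]mulrC mulrA ler_wpM2r ?invr_ge0 ?subr_ge0 ?(ltW x1)//.
  have w20 : 0 <= 2 `^ w * L `^ w by rewrite mulr_ge0 ?powR_ge0.
  case: m mL {Lm mmin} => [|m] mL; first by rewrite expr0 subrr.
  rewrite -powRM ?(ltW L0)// (@le_trans _ _ ((2 `^ w) ^+ m.+1))// ?gerBl//.
  by rewrite -pow2_natM powRrM powR_mulrn// ler_powR2 ?exprn_ge0 ?(ltW w0)// mL.
rewrite -(nneseries_addn m); last by move=> i; rewrite lee_fin.
apply: (@le_trans _ _ (\sum_(i <oo) ((2 `^ w * L * (2 `^ (w - 1)) ^+ m)%:E *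
    ((2 `^ (w - 1)) ^+ i)%:E))%E).
  apply: lee_nneseries => i _; first by move=> _; rewrite lee_fin.
  rewrite -EFinM lee_fin.
  apply: (@le_trans _ _ (2 `^ ((i + m).+1%:R * w) * (L / 2 ^+ (i + m)))).
    by rewrite ler_wpM2l ?powR_ge0// ge_min lexx orbT.
  apply: le_of_eq.
  have e : 2 `^ ((i + m).+1%:R * w) / 2 ^+ (i + m) =
      2 `^ w * (2 `^ (w - 1)) ^+ m * (2 `^ (w - 1)) ^+ i.
    rewrite -!pow2_natM expr_expR// !powR_expR// -expRN -!expRD; congr expR.
    by rewrite -natr1 natrD; ring.
  by rewrite mulrCA e; ring.
rewrite nneseriesZl; last by move=> i _; rewrite lee_fin exprn_ge0.
rewrite nneseries_geometric ?z0// -EFinM lee_fin /C2 -!mulrA ler_wpM2l ?powR_ge0//.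
rewrite mulrA mulrC ler_wpM2l ?invr_ge0 ?subr_ge0 ?(ltW z1)//.
rewrite -pow2_natM powRrM powR_mulrn// -[w - 1]opprB powRN.
rewrite ler_pdivrMr ?powR_gt0 ?exprn_gt0//.
apply: (@le_trans _ _ (L `^ w * L `^ (1 - w))).
  by rewrite -powRD ?(gt_eqF L0) ?implybT// addrC subrK powRr1// ltW.
by rewrite ler_wpM2l ?powR_ge0// ler_powR2 ?subr_ge0 ?(ltW w1) ?(ltW L0) ?(ltW Lm).
Qed.


Lemma integral_one_series_indic d (T : measurableType d) (R : realType)
    (mu : {measure set T -> \bar R}) (D : set T) (E : nat -> set T) (c : nat -> \bar R) :
  measurable D -> (forall i, measurable (E i)) -> (forall i, (0 <= c i)%E) ->
  (\int[mu]_(x in D) (1 + \sum_(i <oo) (c i * (\1_(E i) x)%:E)) =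
   mu D + \sum_(i <oo) (c i * mu (E i `&` D)))%E.
Proof.
move=> mD mE c0; rewrite ge0_integralD//.
- by rewrite integral_series_indic// integral_cst// mul1e.
- by move=> x _; apply: nneseries_ge0 => i _ _; rewrite mule_ge0// lee_fin.
- apply: ge0_emeasurable_sum => [i x _ _|i _]; first by rewrite mule_ge0// lee_fin.
  exact/measurable_funTS/measurable_funeM/measurable_fun_EFin_indic.
Qed.

Section maximal_power.
Context {R : realType} {n : nat}.
Local Notation mu := (@lebesgue_rV R n).
Local Notation LT := (@lebesgue_space R n).

(* Dominates the [w]-th power of one plus the grid maximal function of [g]. *)
Definition maximal_power (w : R) (g : LT -> \bar R) (x : 'rV[R]_n) : \bar R :=
  (1 + \sum_(i <oo) ((2 `^ (i.+1%:R * w))%:E * (\1_(grid_level_set g (2 ^+ i)) x)%:E))%E.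

Lemma maximal_power_ge0 w g x : (0 <= maximal_power w g x)%E.
Proof.
apply: adde_ge0 => //; apply: nneseries_ge0 => i _ _.
by rewrite mule_ge0// lee_fin powR_ge0.
Qed.

Lemma measurable_maximal_power w g : measurable_fun [set: LT] (maximal_power w g).
Proof.
apply: (@emeasurable_funD _ LT R [set: LT] (fun=> 1%E)); first exact: measurable_cst.
apply: (@ge0_emeasurable_sum _ LT R) => [i x _ _|i _].
  by rewrite mule_ge0// lee_fin powR_ge0.
by apply/measurable_funeM/measurable_fun_EFin_indic/measurable_grid_level_set.
Qed.

(** The hypothesis says that [u] is at most the maximal function at [x]. For the least dyadic bound
    2^(m+1) of [u], the point lies in the level set of 2^m, whose weight is 2^((m+1)w). *)
Lemma maximal_power_ge w g x (u : R) : 0 < w -> 0 <= u ->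
  (forall A, 0 <= A -> ~ grid_level_set g A x -> u <= A) ->
  ((u `^ w)%:E <= maximal_power w g x)%E.
Proof.
move=> w0 u0 H; have t0 i : (0 <= (2 `^ (i.+1%:R * w))%:E * (\1_(grid_level_set g (2 ^+ i)) x)%:E)%E.
  by rewrite mule_ge0// lee_fin powR_ge0.
have [u1|u1] := leP u 1.
  rewrite (@le_trans _ _ 1%:E)// ?lee_fin ?leeDl ?nneseries_ge0//.
  by rewrite powR_le1// ltW.
have ex : exists m : nat, u <= 2 ^+ m.
  exists (Num.truncn u).+1; apply: le_trans (ltW (truncnS_gt _)) _.
  by rewrite -natrX ler_nat ltnW// ltn_expl.
case: (ex_minnP ex) => -[|m] um mmin; first by move: um; rewrite expr0 leNgt u1.
have lm : grid_level_set g (2 ^+ m) x.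
  apply: contrapT => /H; rewrite exprn_ge0// => /(_ isT) /mmin.
  by rewrite ltnn.
rewrite (@le_trans _ _ (2 `^ (m.+1%:R * w))%:E)//.
  by rewrite lee_fin powRrM powR_mulrn// ler_powR2// ltW.
apply: le_trans (leeDr _ _) => //; apply: le_trans (nneseries_term m t0).
by rewrite indicE mem_set// mule1.
Qed.

Lemma integral_maximal_power (w s gam : R) : 0 < w -> w < 1 -> 1 <= s -> 1 <= gam ->
  exists C : R, 0 < C /\ forall (A1 rho : R) (g : LT -> \bar R),
  measurable_fun [set: LT] g -> (forall x, (0 <= g x)%E) -> 1 <= A1 -> 0 < rho ->
  (forall x t, 0 < t ->
    (\int[mu]_(y in qb x t) g y <= (A1 * t `^ (n%:R - n%:R / s) * rho `^ (n%:R / s))%:E)%E) ->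
  forall x t, 0 < t -> t <= gam * rho ->
  (\int[mu]_(z in qb x t) maximal_power w g z <=
    (C * A1 `^ w * t `^ (n%:R - n%:R * w / s) * rho `^ (n%:R * w / s))%:E)%E.
Proof.
move=> w0 w1 s1 gam1; have [C1 [C10 HC1]] := @geometric_min R w w0 w1.
have s0 : 0 < s by exact: lt_le_trans s1.
have gam0 : 0 < gam by exact: lt_le_trans gam1.
exists ((2 ^+ n + 9 ^+ n * C1) * gam `^ (n%:R * w / s)); split.
  by rewrite mulr_gt0 ?powR_gt0// addr_gt0 ?mulr_gt0 ?exprn_gt0.
move=> A1 rho g mg g0 A11 rho0 gavg x t t0 tr.
have A10 : 0 < A1 by exact: lt_le_trans A11.
(* The factor [gam] makes [L] at least 1 in the range t <= gam rho, so the constant term of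
   [maximal_power] is absorbed as well. *)
pose L := A1 * (gam * rho / t) `^ (n%:R / s).
have ns0 : 0 <= n%:R / s by rewrite divr_ge0// ltW.
have L1 : 1 <= L.
  rewrite /L -[leLHS]mulr1; apply: ler_pM => //.
  by rewrite powR_ge1// ler_pdivlMr// mul1r.
have hL : A1 * (rho / t) `^ (n%:R / s) <= L.
  rewrite ler_wpM2l ?(ltW A10)//; apply: ler_powR2 => //; first by rewrite divr_ge0// ltW.
  by rewrite ler_wpM2r ?invr_ge0 ?(ltW t0)// ler_peMl// ltW.
have mS : measurable (qb x t : set LT) by exact: measurable_qb.
have mE i : measurable (grid_level_set g (2 ^+ i) : set LT) by exact: measurable_grid_level_set.
have p0 i : (0 <= (2 `^ (i.+1%:R * w))%:E :> \bar R)%E by rewrite lee_fin powR_ge0.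
rewrite /maximal_power (@integral_one_series_indic _ LT R mu _ _ _ mS mE p0).
apply: (@le_trans _ _ ((2 ^+ n * t ^+ n)%:E + (9 ^+ n * t ^+ n * (C1 * L `^ w))%:E)%E).
  apply: leeD.
    by rewrite mu_qb ?(ltW t0)// exprMn.
  apply: (@le_trans _ _ (\sum_(i <oo) ((9 ^+ n * t ^+ n)%:E *
      (2 `^ (i.+1%:R * w) * Num.min 1 (L / 2 ^+ i))%:E))%E).
    apply: lee_nneseries => i _; first by move=> _; rewrite mule_ge0 ?mu_ge0.
    rewrite -EFinM mulrCA EFinM; apply: lee_wpmul2l; first exact: p0.
    by apply: (grid_level_set_measure mg g0 s1 A11 rho0 gavg) => //; rewrite exprn_gt0.
  rewrite nneseriesZl; last first.
    move=> i _; rewrite lee_fin mulr_ge0 ?powR_ge0// le_min ler01 divr_ge0 ?exprn_ge0//.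
    exact: le_trans L1.
  rewrite [leRHS]EFinM; apply: lee_wpmul2l; last exact: HC1.
  by rewrite lee_fin mulr_ge0 ?exprn_ge0// ltW.
rewrite -EFinD lee_fin.
have Lw : 1 <= L `^ w by rewrite powR_ge1// ltW.
apply: (@le_trans _ _ ((2 ^+ n + 9 ^+ n * C1) * (t ^+ n * L `^ w))).
  rewrite mulrDl; apply: lerD; last by apply: le_of_eq; ring.
  by rewrite ler_wpM2l ?exprn_ge0// ler_peMr ?exprn_ge0// ltW.
rewrite -!mulrA ler_wpM2l//; first by rewrite addr_ge0 ?mulr_ge0 ?exprn_ge0// ltW.
apply: le_of_eq.
rewrite /L !powR_expR ?mulr_gt0 ?invr_gt0 ?powR_gt0 ?expR_gt0// expr_expR//.
rewrite (_ : ln (A1 * _) = ln A1 + n%:R / s * (ln gam + ln rho - ln t)); last first.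
  by rewrite lnM ?posrE ?expR_gt0// expRK ln_div ?posrE ?mulr_gt0// lnM ?posrE.
rewrite -!expRD; congr expR.
by field; rewrite gt_eqF.
Qed.

End maximal_power.

(** * Moments and polynomials *)

Lemma integral_exhaustion d (T : measurableType d) (R : realType)
    (mu : {measure set T -> \bar R}) (g : T -> \bar R) (E : nat -> set T) (c : \bar R) :
  measurable_fun [set: T] g -> (forall x, 0 <= g x)%E -> (forall m, measurable (E m)) ->
  {homo E : n m / (n <= m)%N >-> (n <= m)%O} -> mu (~` (\bigcup_m E m)) = 0%E ->
  (forall m, \int[mu]_(x in E m) g x <= c)%E -> (\int[mu]_x g x <= c)%E.
Proof.
move=> mg g0 mE ndE N0 H.
have mU : measurable (\bigcup_m E m) by exact: bigcup_measurable.
rewrite (ge0_negligible_integral (measurableC mU))// setTD setCK.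
have := ge0_nondecreasing_set_cvg_integral (mu := mu) ndE mE (fun i => measurable_funTS mg)
  (fun i x _ => g0 x).
move=> /(cvg_lim (@ereal_hausdorff R)) <-; apply: lime_le; last exact: nearW.
apply: ereal_nondecreasing_is_cvgn => i j ij.
by apply: ge0_subset_integral => //; [exact: measurable_funTS|exact/subsetPset/ndE].
Qed.

Section lorentz_one.
Context {R : realType} {n : nat}.
Local Notation mu := (@lebesgue_rV R n).
Local Notation LT := (@lebesgue_space R n).

(** The embedding of L^(1,1) into L^1, needed because the Morrey norm of an atom is expressed
    through rearrangements. Slicing above the level at 2^(-m) gives the bound on a set whose
    complement has measure at most 2^(-m), and m tends to infinity. *)
Lemma integral_dyadic_lorentz (g : LT -> \bar R) (A : R) : 0 <= A ->
  measurable_fun [set: LT] g -> (forall x, 0 <= g x)%E ->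
  (forall t : R, 0 < t -> exists m, rearrangement g (2 ^+ m * t) = 0%E) ->
  dyadic_lorentz 1 1%:E (rearrangement2 g) A -> (\int[mu]_x g x <= (2 * A)%:E)%E.
Proof.
move=> A0 mg g0 van; rewrite /dyadic_lorentz powRr1// => H.
have t0 l : (0 <= (dweight 1 l)%:E * rearrangement2 g l)%E.
  exact/dyadic_term_ge0/rearrangement2_ge0.
pose tt m : R := 2 ^ (- m%:Z).
pose E m : set LT := [set x | (g x <= rearrangement g (tt m))%E].
have tt0 m : 0 < tt m by exact: exp2z_gt0.
have t1 m : 0 <= tt m by exact: ltW.
have ttE m : tt m = (2^-1) ^+ m by rewrite /tt -invr_expz exprVn.
have ttS m k : (m <= k)%N -> tt k <= tt m.
  by move=> mk; rewrite !ttE ler_wiXn2l// invf_le1// ler1n.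
have mE m : measurable (E m).
  by have := emeasurable_fun_infty_c measurableT mg (rearrangement g (tt m)); rewrite setTI.
apply: (@integral_exhaustion _ LT R mu g E) => //.
- move=> m k mk; apply/subsetPset => x /= h; apply: le_trans h _.
  exact/rearrangement_noninc/ttS.
- apply/eqP; rewrite eq_le mu_ge0 andbT; apply/lee_addgt0Pr => e e0; rewrite add0e.
  have [m hm] : exists m, tt m <= e.
    exists (Num.truncn e^-1).+1; rewrite ttE exprVn invf_ple ?posrE ?exprn_gt0//.
    apply: le_trans (ltW (truncnS_gt _)) _.
    by rewrite -natrX ler_nat ltnW// ltn_expl.
  apply: (@le_trans _ _ (tt m)%:E); last by rewrite lee_fin.
  apply: le_trans (mu_gt_rearrangement mg (t1 m)); apply: le_mu => x /= h.
  by rewrite gee0_abs// ltNge; apply/negP => h'; apply: h; exists m.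
move=> m.
have := slice_integral mg g0 ltr01 (tt0 m) (van _ (tt0 m)).
rewrite expr0 mul1r.
under eq_integral do rewrite poweRe1//.
move=> /le_trans; apply.
apply: (@le_trans _ _ (2%:E * \sum_(i <oo)
    ((dweight 1 (i%:Z - m%:Z))%:E * rearrangement2 g (i%:Z - m%:Z))%E)%E).
  rewrite -nneseriesZl; last by move=> i _; exact: t0.
  apply: lee_nneseries => i _; first by move=> _; rewrite mule_ge0 ?poweR_ge0// lee_fin mulr_ge0 ?exprn_ge0.
  have -> : 2 ^+ i.+1 * tt m = 2 * dweight 1 (i%:Z - m%:Z).
    by rewrite exprS -mulrA pow2_natz /dweight divr1 powR_intmul.
  by rewrite pow2_natz poweRe1 ?rearrangement_ge0// muleA EFinM.
rewrite EFinM lee_wpmul2l// nneseries_esumT; last by move=> i; exact: t0.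
have inj : {in [set: nat] &, injective (fun i : nat => i%:Z - m%:Z)}.
  by move=> i j _ _ /addIr [].
rewrite -(reindex_esum _ _ _ (fun l => ((dweight 1 l)%:E * rearrangement2 g l)%E) (inj_bij inj)).
apply: le_trans H; under [leRHS]eq_esum do rewrite poweRe1//.
apply: ub_ereal_sup => _ [F [fF FS] <-]; apply: ereal_sup_ubound; exists F => //.
Qed.

Lemma modulus_ge0 (f : 'rV[R]_n -> R[i]) x : (0 <= modulus f x)%E.
Proof. by rewrite lee_fin /ComplexField.Normc.normc; case: (f x) => a b; exact: sqrtr_ge0. Qed.

Lemma normcE (z : R[i]) :
  ComplexField.Normc.normc z = Num.sqrt (complex.Re z ^+ 2 + complex.Im z ^+ 2).
Proof. by case: z. Qed.

Lemma measurable_modulus (f : 'rV[R]_n -> R[i]) : cmeasurable f ->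
  measurable_fun [set: LT] (modulus f).
Proof.
move=> [m1 m2]; apply/measurable_EFinP.
under eq_fun do rewrite normcE.
apply: (@measurableT_comp _ _ _ LT _ _ (@Num.sqrt R)).
  have := @sqrt_continuous R; move/(@continuous_measurable_fun R); apply.
by apply: (@measurable_funD _ LT R); apply: (@measurable_funX _ LT R).
Qed.

Lemma morrey_one_integral (s : R) : 1 <= s -> exists C : R, 1 <= C /\
  forall (f : 'rV[R]_n -> R[i]) (N : R), cmeasurable f -> 0 <= N ->
  (morrey_norm s 1 f <= N%:E)%E -> forall x t, 0 < t ->
  (\int[mu]_(y in qb x t) modulus f y <= (C * N * t `^ (n%:R - n%:R / s))%:E)%E.
Proof.
move=> s1; have [C [C0 HC]] := @morrey_dyadic R n s 1 1%:E ltr01 lte01.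
exists (2 * C + 1); split; first by rewrite lerDr mulr_ge0// ltW.
move=> f N mf N0 H x t t0.
have mm := measurable_modulus mf; have m0 := modulus_ge0 f.
have mc : measurable_fun [set: LT] (cut (qb x t) (modulus f)).
  by apply: measurable_cut => //; exact: measurable_qb.
have := HC _ _ N0 H x t t0; rewrite divr1 => HD.
have a0 : 0 <= C * (N * t `^ (n%:R - n%:R / s)) by rewrite !mulr_ge0 ?powR_ge0// ltW.
rewrite -integral_cut.
apply: le_trans (integral_dyadic_lorentz a0 mc (fun y => cut_ge0 _ _ m0) _ HD) _.
  by move=> e e0; apply: cut_vanish => //; exact: ltW.
rewrite lee_fin; have : 0 <= N * t `^ (n%:R - n%:R / s) by rewrite mulr_ge0 ?powR_ge0.
by set X := _ `^ _; lra.
Qed.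

End lorentz_one.

Section polyfun.
Context {R : realType} {n : nat}.
Implicit Types (P Q : 'rV[R]_n -> R) (x c : 'rV[R]_n).

(** Polynomial functions of degree at most [d], presented by generators so that orthogonality to
    them follows from the moment conditions by induction. *)
Inductive polyfun (d : nat) : ('rV[R]_n -> R) -> Prop :=
| polyfun_monomial alpha : (\sum_i alpha i <= d)%N -> polyfun d (monomial alpha)
| polyfun0 : polyfun d (fun=> 0)
| polyfun_lin a P Q : polyfun d P -> polyfun d Q -> polyfun d (fun x => a * P x + Q x).

Lemma polyfunZ d a P : polyfun d P -> polyfun d (fun x => a * P x).
Proof.
move=> h; have := polyfun_lin a h (polyfun0 d); congr (polyfun d _).
by apply/funext => x; rewrite addr0.
Qed.

Lemma polyfunD d P Q : polyfun d P -> polyfun d Q -> polyfun d (fun x => P x + Q x).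
Proof.
move=> h h'; have := polyfun_lin 1 h h'; congr (polyfun d _).
by apply/funext => x; rewrite mul1r.
Qed.

Lemma polyfun_sum d (I : Type) (s : seq I) (P : I -> 'rV[R]_n -> R) :
  (forall i, polyfun d (P i)) -> polyfun d (fun x => \sum_(i <- s) P i x).
Proof.
move=> h; elim: s => [|i s ih].
  by under eq_fun do rewrite big_nil; exact: polyfun0.
by under eq_fun do rewrite big_cons; exact: polyfunD.
Qed.

Lemma polyfun_leq d e P : (d <= e)%N -> polyfun d P -> polyfun e P.
Proof.
move=> de; elim=> [alpha h| |a P1 Q _ h1 _ h2]; last exact: polyfun_lin.
  by apply: polyfun_monomial; exact: leq_trans de.
exact: polyfun0.
Qed.

Lemma monomialM (alpha beta : 'I_n -> nat) x :
  monomial alpha x * monomial beta x = monomial (fun i => alpha i + beta i)%N x.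
Proof. by rewrite /monomial -big_split/=; apply: eq_bigr => i _; rewrite exprD. Qed.

Lemma polyfunM d e P Q : polyfun d P -> polyfun e Q -> polyfun (d + e) (fun x => P x * Q x).
Proof.
move=> hP hQ; elim: hP => [alpha ha| |a P1 P2 _ h1 _ h2].
- elim: hQ => [beta hb| |b Q1 Q2 _ h1 _ h2].
  + under eq_fun do rewrite monomialM.
    by apply: polyfun_monomial; rewrite big_split leq_add.
  + by under eq_fun do rewrite mulr0; exact: polyfun0.
  + by under eq_fun do rewrite mulrDr mulrCA; exact: polyfun_lin.
- by under eq_fun do rewrite mul0r; exact: polyfun0.
- by under eq_fun do rewrite mulrDl -mulrA; exact: polyfun_lin.
Qed.

Lemma polyfun_cst d a : polyfun d (fun=> a).
Proof.
have h : polyfun d (monomial (fun=> 0%N)) by apply: polyfun_monomial; rewrite sum_nat_const muln0.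
have := polyfunZ a h; congr (polyfun d _); apply/funext => x.
by rewrite /monomial big1 ?mulr1// => i _; rewrite expr0.
Qed.

Lemma sum_indicator (i : 'I_n) : (\sum_j (j == i) = 1)%N.
Proof. by rewrite (bigD1 i)//= eqxx big1// => j /negPf ->. Qed.

Lemma polyfun_coord i : polyfun 1 (fun x => x ord0 i).
Proof.
have h : polyfun 1 (monomial (fun j => (j == i)%N)).
  by apply: polyfun_monomial; rewrite sum_indicator.
move: h; congr (polyfun 1 _); apply/funext => x.
rewrite /monomial (bigD1 i)//= eqxx expr1 big1 ?mulr1// => j /negPf ->.
by rewrite expr0.
Qed.

Lemma polyfunX d k P : polyfun d P -> polyfun (k * d) (fun x => P x ^+ k).
Proof.
move=> hP; elim: k => [|k ih]; first by under eq_fun do rewrite expr0; exact: polyfun_cst.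
by under eq_fun do rewrite exprS; rewrite mulSn; exact: polyfunM.
Qed.

(** Needed for points that mix coordinates of a variable and of a fixed centre, as on the coordinate
    path of the Taylor expansion. *)
Lemma polyfun_freeze d P (b : 'I_n -> bool) c : polyfun d P ->
  polyfun d (fun x => P (\row_i if b i then x ord0 i else c ord0 i)).
Proof.
elim=> [alpha h| |a P1 P2 _ h1 _ h2]; [|exact: polyfun0|exact: polyfun_lin].
have h' : polyfun d (monomial (fun i => if b i then alpha i else 0%N)).
  by apply: polyfun_monomial; apply: leq_trans h; apply: leq_sum => i _; case: ifP.
have := polyfunZ (\prod_i (if b i then 1 else c ord0 i ^+ alpha i)) h'.
congr (polyfun d _); apply/funext => x; rewrite /monomial -big_split/=.
by apply: eq_bigr => i _; rewrite mxE; case: ifP => _; rewrite ?mul1r// expr0 mulr1.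
Qed.

Definition set_coord x i (t : R) : 'rV[R]_n := \row_j if j == i then t else x ord0 j.

Lemma monomial_set_coord alpha x (i : 'I_n) t : monomial alpha (set_coord x i t) =
  t ^+ alpha i * \prod_(j | j != i) x ord0 j ^+ alpha j.
Proof.
rewrite /monomial (bigD1 i)//= mxE eqxx; congr (_ * _).
by apply: eq_bigr => j /negPf ji; rewrite mxE ji.
Qed.

Lemma is_derive_pow (t c : R) k :
  is_derive t (1 : R) (fun u : R => c * u ^+ k) (c * (k%:R * t ^+ k.-1)).
Proof.
have h := @is_deriveX R R id k t 1 1 (is_derive_id t 1).
have := is_deriveZ c h; congr (is_derive t 1 _ _).
  by apply/funext => u; rewrite /= exprfctE.
by rewrite /GRing.scale/= mulr1.
Qed.

(** The induction step of the Taylor construction: approximations of first derivatives are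
    integrated one coordinate at a time, raising the degree by one. *)
Lemma polyfun_antiderivative d P (i : 'I_n) : polyfun d P -> exists Q, polyfun d.+1 Q /\
  forall x (t : R), is_derive t (1 : R) (fun t => Q (set_coord x i t)) (P (set_coord x i t)).
Proof.
elim=> [alpha h| |a P1 P2 _ [Q1 [h1 d1]] _ [Q2 [h2 d2]]].
- exists (fun x => (alpha i).+1%:R^-1 * monomial (fun j => alpha j + (j == i))%N x); split.
    apply/polyfunZ/polyfun_monomial; rewrite big_split/= -addn1 leq_add//.
    by rewrite sum_indicator.
  move=> x t; pose r := \prod_(j | j != i) x ord0 j ^+ alpha j.
  have -> : (fun t => (alpha i).+1%:R^-1 * monomial (fun j => alpha j + (j == i))%N (set_coord x i t))
     = (fun t => ((alpha i).+1%:R^-1 * r) * t ^+ (alpha i).+1).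
    apply/funext => u; rewrite monomial_set_coord eqxx addn1 -mulrA; congr (_ * _).
    rewrite mulrC; congr (_ * _); apply: eq_bigr => j /negPf ji.
    by rewrite ji addn0.
  rewrite monomial_set_coord -/r.
  have := is_derive_pow t ((alpha i).+1%:R^-1 * r) (alpha i).+1.
  by rewrite mulrACA mulVf ?pnatr_eq0// mul1r [r * _]mulrC.
- exists (fun=> 0); split; first exact: polyfun0.
  by move=> x t; exact: is_derive_cst.
- exists (fun x => a * Q1 x + Q2 x); split; first exact: polyfun_lin.
  by move=> x t; have := is_deriveD (is_deriveZ a (d1 x t)) (d2 x t).
Qed.

End polyfun.

Section vanishing.
Context {R : realType} {n : nat}.
Local Notation mu := (@lebesgue_rV R n).
Local Notation LT := (@lebesgue_space R n).

Lemma enorm_coord (x : 'rV[R]_n) i : `|x ord0 i| <= enorm x.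
Proof.
rewrite /enorm -sqrtr_sqr ler_wsqrtr// (bigD1 i)//= lerDl.
by apply: sumr_ge0 => j _; exact: sqr_ge0.
Qed.

Lemma enorm_ge0 (x : 'rV[R]_n) : 0 <= enorm x. Proof. exact: sqrtr_ge0. Qed.

Lemma enorm_japanese (x : 'rV[R]_n) : enorm x <= japanese x.
Proof.
rewrite /japanese -[leLHS]ger0_norm ?enorm_ge0// -sqrtr_sqr ler_wsqrtr//.
by rewrite lerDr.
Qed.

Lemma japanese_ge1 (x : 'rV[R]_n) : 1 <= japanese x.
Proof. by rewrite /japanese -[leLHS]sqrtr1 ler_wsqrtr// lerDl sqr_ge0. Qed.

Lemma monomial_japanese (alpha : 'I_n -> nat) d (x : 'rV[R]_n) :
  (\sum_i alpha i <= d)%N -> `|monomial alpha x| <= japanese x ^+ d.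
Proof.
move=> h; have j1 := japanese_ge1 x.
apply: (@le_trans _ _ (japanese x ^+ (\sum_i alpha i))); last exact: ler_weXn2l.
rewrite /monomial normr_prod -prodrXr; apply: ler_prod => i _.
rewrite normr_ge0 normrX lerXn2r ?nnegrE//; first exact: le_trans ler01 j1.
exact: le_trans (enorm_coord x i) (enorm_japanese x).
Qed.

Lemma measurable_coord i : measurable_fun [set: LT] (fun x : LT => (x : 'rV[R]_n) ord0 i).
Proof.
move=> _ Y mY; rewrite setTI; apply: borel_lebesgue.
by have := @measurable_rV_coord R n i measurableT Y mY; rewrite setTI.
Qed.

Lemma measurable_monomial (alpha : 'I_n -> nat) : measurable_fun [set: LT] (@monomial R n alpha).
Proof.
apply: (@measurable_prod _ LT R) => i _.
by apply: (@measurable_funX _ LT R); exact: measurable_coord.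
Qed.

(* The real or imaginary part of a function with vanishing moments. *)
Definition real_moments (K : nat) (f : 'rV[R]_n -> R) : Prop :=
  [/\ measurable_fun [set: LT] f,
      mu.-integrable [set: LT] (fun x => (japanese x ^+ K * f x)%:E) &
      forall alpha : 'I_n -> nat, (\sum_i alpha i <= K)%N ->
        Rintegral mu [set: LT] (fun x => monomial alpha x * f x) = 0].

Lemma vanishing_real_moments K (f : 'rV[R]_n -> R[i]) : vanishing_moments K f ->
  real_moments K (fun x => complex.Re (f x)) /\ real_moments K (fun x => complex.Im (f x)).
Proof.
move=> [[m1 m2] [i1 i2] H].
have E (a : R) (z : R[i]) : complex.Re (a%:C%C * z) = a * complex.Re z /\
    complex.Im (a%:C%C * z) = a * complex.Im z.
  by case: z => b c /=; rewrite !mul0r subr0 addr0.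
split; split => //.
- by move: i1; congr (mu.-integrable _ _); apply/funext => x; rewrite (E _ _).1.
- move=> alpha ha; have := congr1 (@complex.Re R) (H alpha ha); rewrite /cintegral/= => <-.
  by congr (Rintegral _ _ _); apply/funext => x; rewrite (E _ _).1.
- by move: i2; congr (mu.-integrable _ _); apply/funext => x; rewrite (E _ _).2.
- move=> alpha ha; have := congr1 (@complex.Im R) (H alpha ha); rewrite /cintegral/= => <-.
  by congr (Rintegral _ _ _); apply/funext => x; rewrite (E _ _).2.
Qed.

Lemma real_moments_polyfun K (f P : 'rV[R]_n -> R) : real_moments K f -> polyfun K P ->
  mu.-integrable [set: LT] (fun x => (P x * f x)%:E) /\
  Rintegral mu [set: LT] (fun x => P x * f x) = 0.
Proof.
move=> [mf jf H]; elim=> [alpha h| |a P1 P2 _ [i1 h1] _ [i2 h2]].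
- split; last exact: H.
  apply: (@le_integrable _ LT R mu _ measurableT _ _ _ _ jf).
    apply/measurable_EFinP; apply: (@measurable_funM _ LT R) => //.
    exact: measurable_monomial.
  move=> x _; rewrite lee_fin !normrM ler_wpM2r//.
  by rewrite (le_trans (monomial_japanese x h))// ler_norm.
- split; under eq_fun do rewrite mul0r; first exact: (@integrable0 _ LT R mu).
  by rewrite /Rintegral integral0.
- have E : (fun x => (a * P1 x + P2 x) * f x) = (fun x => a * (P1 x * f x) + P2 x * f x).
    by apply/funext => x; rewrite mulrDl mulrA.
  have i1' : mu.-integrable [set: LT] (fun x => (a * (P1 x * f x))%:E).
    exact: (@integrableZl _ LT R mu _ measurableT a _ i1).
  split; last first.
    rewrite E (@RintegralD _ LT R mu)// (@RintegralZl _ LT R mu)// h1 h2.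
    by rewrite mulr0 addr0.
  rewrite (_ : (fun x => _) = (fun x => (a * (P1 x * f x))%:E + (P2 x * f x)%:E)%E).
    exact: (@integrableD _ LT R mu).
  by apply/funext => x; rewrite -EFinD mulrDl mulrA.
Qed.

End vanishing.

(** * Action of a kernel on an atom *)

Section real_integrals.
Context d (T : measurableType d) (R : realType).
Variable mu : {measure set T -> \bar R}.

Lemma integrable_mul_bounded (a psi : T -> R) (M : R) :
  mu.-integrable [set: T] (EFin \o a) -> measurable_fun [set: T] psi ->
  (forall x, `|psi x| <= M) -> mu.-integrable [set: T] (EFin \o (fun x => a x * psi x)).
Proof.
move=> ia mpsi hM; have ma := measurable_int _ ia; move/measurable_EFinP in ma.
have iM : mu.-integrable [set: T] (fun x => M%:E * (EFin \o a) x)%E by exact: integrableZl.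
apply: (le_integrable measurableT _ _ iM).
  by apply/measurable_EFinP; exact: measurable_funM.
move=> x _; rewrite /= lee_fin !normrM mulrC ler_wpM2r// (le_trans (hM x))//.
exact: ler_norm.
Qed.

Lemma normr_Rintegral_le (h : T -> R) (g : T -> \bar R) (c : R) :
  mu.-integrable [set: T] (EFin \o h) -> (forall x, `|h x|%:E <= g x)%E ->
  (\int[mu]_x g x <= c%:E)%E -> `|Rintegral mu [set: T] h| <= c.
Proof.
move=> ih hg hc; rewrite -lee_fin; apply: le_trans hc; rewrite /Rintegral.
rewrite -abse_EFin fineK ?(integrable_fin_num _ ih)//.
apply: le_trans (le_abse_integral mu measurableT (measurable_int _ ih)) _.
by apply: ge0_le_integral_nomeas => x _ //=; exact: hg.
Qed.

End real_integrals.

Section atoms.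
Context {R : realType} {n : nat}.
Local Notation mu := (@lebesgue_rV R n).
Local Notation LT := (@lebesgue_space R n).

(** The common interface of heat kernels and Schwartz functions. The second condition feeds the
    maximal function. The third is free of [t]: combined with an atom of mass A1 rho^n it yields
    (rho / |x - c|)^(n+K+1). *)
Definition kernel_bound (K : nat) (gam : R) (c : 'rV[R]_n) (rho A0 t : R) (x : 'rV[R]_n)
    (psi : 'rV[R]_n -> R) : Prop :=
  [/\ measurable_fun [set: LT] psi,
      forall y, `|psi y| <= A0 / t ^+ n / (1 + `|x - y| / t) ^+ n.+1 &
      ~ qb c (gam * rho) x -> exists P, polyfun K P /\
        forall y, qb c rho y -> `|psi y - P y| <= A0 * rho ^+ K.+1 / `|x - c| ^+ (n + K.+1)].

Variables (f : 'rV[R]_n -> R[i]) (K : nat) (gam rho A1 : R) (c : 'rV[R]_n).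
Hypotheses (gam1 : 1 <= gam) (rho0 : 0 < rho) (A1_ge1 : 1 <= A1).
Hypothesis f_moments : vanishing_moments K f.
Hypothesis f_supp : forall y, ~ qb c rho y -> f y = 0.
Hypothesis f_mass : (\int[mu]_(y in qb c rho) modulus f y <= (A1 * rho ^+ n)%:E)%E.

Section real_part.
Variable a : 'rV[R]_n -> R.
Hypothesis a_moments : real_moments K a.
Hypothesis a_le : forall y, (`|a y|%:E <= modulus f y)%E.

Lemma real_part_integrable : mu.-integrable [set: LT] (EFin \o a).
Proof.
have [ma ia _] := a_moments; apply: (@le_integrable _ LT R mu _ measurableT _ _ _ _ ia).
  exact/measurable_EFinP.
move=> x _; rewrite /= lee_fin normrM ler_peMl//.
have j1 := @japanese_ge1 R n x.
by rewrite ger0_norm ?exprn_ege1// exprn_ge0// (le_trans ler01).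
Qed.

Variables (A0 t : R) (x : 'rV[R]_n) (psi : 'rV[R]_n -> R).
Hypotheses (A00 : 0 <= A0) (t0 : 0 < t).
Hypothesis hpsi : kernel_bound K gam c rho A0 t x psi.

Lemma real_part_mul_integrable : mu.-integrable [set: LT] (EFin \o (fun y => a y * psi y)).
Proof.
have [mpsi near _] := hpsi.
apply: (@integrable_mul_bounded _ LT R mu a psi (A0 / t ^+ n) real_part_integrable mpsi).
move=> y; apply: le_trans (near y) _; rewrite ler_pdivrMr ?exprn_gt0 ?ltr_pwDl ?divr_ge0 ?(ltW t0)//.
by rewrite ler_peMr ?divr_ge0 ?exprn_ge0 ?(ltW t0)// exprn_ege1// lerDl divr_ge0// ltW.
Qed.

Lemma real_part_near (A : R) : 0 <= A -> ~ grid_level_set (modulus f) A x ->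
  `|Rintegral mu [set: LT] (fun y => a y * psi y)| <= 4 * 16 ^+ n * A0 * A.
Proof.
move=> hA nx; have [mpsi near _] := hpsi; have [cm _ _] := f_moments.
apply: (@normr_Rintegral_le _ LT R mu _ (fun y => modulus f y * `|psi y|%:E)%E) => //.
- exact: real_part_mul_integrable.
- by move=> y; rewrite normrM EFinM lee_wpmul2r.
apply: (@kernel_maximal_bound R n _ (measurable_modulus cm) (modulus_ge0 f) x A A0 t) => //.
by move=> y; rewrite normr_ge0 near.
Qed.

(** The moments annihilate [P], so only the approximation error on the supporting cube meets the
    mass of the atom. *)
Lemma real_part_far : ~ qb c (gam * rho) x ->
  `|Rintegral mu [set: LT] (fun y => a y * psi y)| <= A0 * A1 * (rho / `|x - c|) ^+ (n + K.+1).
Proof.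
move=> nx; have [mpsi _ /(_ nx) [P [polP far]]] := hpsi.
have [iP P0] := real_moments_polyfun a_moments polP.
have iP' : mu.-integrable [set: LT] (EFin \o (fun y => a y * P y)).
  by move: iP; congr (mu.-integrable _ _); apply/funext => y /=; rewrite mulrC.
have E : Rintegral mu [set: LT] (fun y => a y * psi y) =
    Rintegral mu [set: LT] (fun y => a y * psi y - a y * P y).
  rewrite (@RintegralB _ LT R mu _ _ _ measurableT real_part_mul_integrable iP').
  rewrite (_ : (fun y => a y * P y) = (fun y => P y * a y)) ?P0 ?subr0//.
  by apply/funext => y; rewrite mulrC.
rewrite E; pose b := A0 * rho ^+ K.+1 / `|x - c| ^+ (n + K.+1).
have b0 : 0 <= b by rewrite /b mulr_ge0 ?invr_ge0 ?exprn_ge0 ?mulr_ge0 ?exprn_ge0// ltW.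
apply: (@normr_Rintegral_le _ LT R mu _ (fun y => b%:E * cut (qb c rho) (modulus f) y)%E).
- rewrite (_ : _ \o _ = (fun y => (a y * psi y)%R%:E - (a y * P y)%R%:E)%E); last by apply/funext => y.
  exact: (@integrableB _ LT R mu _ measurableT _ _ real_part_mul_integrable iP').
- move=> y; have [yQ|yQ] := pselect (qb c rho y).
    by rewrite cut_in// -mulrBr normrM mulrC EFinM; apply: lee_pmul => //; rewrite lee_fin far.
  have ay : a y = 0.
    apply/eqP; rewrite -normr_le0 -lee_fin (le_trans (a_le y))//.
    by rewrite /modulus f_supp// normcE/= expr0n/= addr0 sqrtr0.
  by rewrite cut_out// mule0 ay !mul0r subrr normr0.
have [cm _ _] := f_moments.
have mc : measurable_fun [set: LT] (cut (qb c rho) (modulus f)).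
  by apply: measurable_cut; [exact: measurable_qb|exact: measurable_modulus].
rewrite (@ge0_integralZl_EFin _ LT R mu _ measurableT _ (fun y _ => cut_ge0 _ _ (modulus_ge0 f)) mc)//.
rewrite integral_cut.
apply: (@le_trans _ _ (b%:E * (A1 * rho ^+ n)%:E)%E); first by rewrite lee_wpmul2l.
rewrite -EFinM lee_fin /b expr_div_n [rho ^+ (n + _)]exprD.
by apply: le_of_eq; ring.
Qed.

End real_part.

Variables (A0 t : R) (x : 'rV[R]_n) (phi : 'rV[R]_n -> R[i]).
Hypotheses (A00 : 0 < A0) (t0 : 0 < t).
Hypothesis re_phi : kernel_bound K gam c rho A0 t x (fun y => complex.Re (phi y)).
Hypothesis im_phi : kernel_bound K gam c rho A0 t x (fun y => complex.Im (phi y)).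

Let fR := (vanishing_real_moments f_moments).1.
Let fI := (vanishing_real_moments f_moments).2.

Lemma normc_Re_le (z : R[i]) : `|complex.Re z| <= ComplexField.Normc.normc z.
Proof. by rewrite normcE -sqrtr_sqr ler_wsqrtr// lerDl sqr_ge0. Qed.

Lemma normc_Im_le (z : R[i]) : `|complex.Im z| <= ComplexField.Normc.normc z.
Proof. by rewrite normcE -sqrtr_sqr ler_wsqrtr// lerDr sqr_ge0. Qed.

Lemma normc_le_ReIm (z : R[i]) :
  ComplexField.Normc.normc z <= `|complex.Re z| + `|complex.Im z|.
Proof.
rewrite normcE -[leRHS]ger0_norm ?addr_ge0// -sqrtr_sqr ler_wsqrtr//.
rewrite sqrrD !real_normK ?num_real// -addrA [X in _ <= _ + X]addrC addrA lerDl.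
by rewrite mulrn_wge0// mulr_ge0.
Qed.

Lemma regular_distribution_le (b : R) :
  (forall a psi, real_moments K a -> (forall y, (`|a y|%:E <= modulus f y)%E) ->
    kernel_bound K gam c rho A0 t x psi ->
    `|Rintegral mu [set: LT] (fun y => a y * psi y)| <= b) ->
  ComplexField.Normc.normc (regular_distribution f phi) <= 4 * b.
Proof.
move=> H.
have h1 y : (`|complex.Re (f y)|%:E <= modulus f y)%E by rewrite lee_fin normc_Re_le.
have h2 y : (`|complex.Im (f y)|%:E <= modulus f y)%E by rewrite lee_fin normc_Im_le.
have i11 := real_part_mul_integrable fR (ltW A00) t0 re_phi.
have i12 := real_part_mul_integrable fR (ltW A00) t0 im_phi.
have i21 := real_part_mul_integrable fI (ltW A00) t0 re_phi.
have i22 := real_part_mul_integrable fI (ltW A00) t0 im_phi.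
have ReM (u v : R[i]) : complex.Re (u * v) = complex.Re u * complex.Re v - complex.Im u * complex.Im v.
  by case: u => ? ?; case: v.
have ImM (u v : R[i]) : complex.Im (u * v) = complex.Re u * complex.Im v + complex.Im u * complex.Re v.
  by case: u => ? ?; case: v.
apply: le_trans (normc_le_ReIm _) _; rewrite /regular_distribution /cintegral /=.
under eq_Rintegral do rewrite ReM.
under [X in _ + `|X|]eq_Rintegral do rewrite ImM.
rewrite (@RintegralB _ LT R mu _ _ _ measurableT i11 i22).
rewrite (@RintegralD _ LT R mu _ _ _ measurableT i12 i21).
have e1 := H _ _ fR h1 re_phi; have e2 := H _ _ fR h1 im_phi.
have e3 := H _ _ fI h2 re_phi; have e4 := H _ _ fI h2 im_phi.
apply: (@le_trans _ _ ((b + b) + (b + b))); last by apply: le_of_eq; ring.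
by apply: lerD; [apply: le_trans (ler_normB _ _) _|apply: le_trans (ler_normD _ _) _]; exact: lerD.
Qed.

(** The outer 4 counts the products of real and imaginary parts. Inside, the first term comes from
    [kernel_maximal_bound], and the power of 2 from rounding |x - c| / rho to a power of 2. *)
Definition atom_const : R := 4 * (4 * 16 ^+ n + 2 ^+ (n + K.+1)).

(** The term k = 0 carries the local maximal function; for k > 0 it is the w-th power of the far
    decay (2^(-k))^(n+K+1), spread over the whole dilate. *)
Definition atom_power (w : R) (k : nat) (y : 'rV[R]_n) : \bar R :=
  if k is k'.+1 then
    ((2 `^ (- (k%:R * (w * (n + K.+1)%:R))))%:E * (\1_(qb c (gam * (2 ^+ k * rho))) y)%:E)%E
  else cut (qb c (gam * rho)) (maximal_power w (modulus f)) y.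

Lemma atom_power_ge0 w k y : (0 <= atom_power w k y)%E.
Proof.
case: k => [|k] /=; first by rewrite cut_ge0// => z; exact: maximal_power_ge0.
by rewrite mule_ge0 ?lee_fin ?powR_ge0.
Qed.

Lemma atom_estimate (w : R) : 0 < w ->
  (((ComplexField.Normc.normc (regular_distribution f phi) / (atom_const * A0 * A1)) `^ w)%:E <=
   \sum_(k <oo) atom_power w k x)%E.
Proof.
move=> w0; set I := ComplexField.Normc.normc _.
have I0 : 0 <= I by rewrite /I normcE sqrtr_ge0.
have A10 : 0 < A1 by exact: lt_le_trans A1_ge1.
have c1 : 0 < 4 * 16 ^+ n :> R by rewrite mulr_gt0 ?exprn_gt0.
have c2 : 0 < 2 ^+ (n + K.+1) :> R by rewrite exprn_gt0.
have C0 : 0 < atom_const * A0 * A1 by rewrite !mulr_gt0// addr_gt0.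
have u0 : 0 <= I / (atom_const * A0 * A1) by rewrite divr_ge0// ltW.
have p0 := atom_power_ge0 w.
have [xQ|xQ] := pselect (qb c (gam * rho) x).
  apply: le_trans (nneseries_term 0 (fun k => p0 k x)); rewrite /= cut_in//.
  apply: maximal_power_ge => // A hA nx.
  have h : I <= 4 * (4 * 16 ^+ n * A0 * A).
    by apply: regular_distribution_le => a psi hm hl hk; exact: (real_part_near hm hl (ltW A00) t0 hk hA nx).
  rewrite ler_pdivrMr// (le_trans h)// /atom_const.
  have -> : A * (4 * (4 * 16 ^+ n + 2 ^+ (n + K.+1)) * A0 * A1) =
    4 * ((4 * 16 ^+ n + 2 ^+ (n + K.+1)) * A0 * A) * A1 by ring.
  rewrite -[leLHS]mulr1; apply: ler_pM => //; first by rewrite !mulr_ge0// ltW.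
  by rewrite ler_pM2l// ler_wpM2r// ler_wpM2r ?(ltW A00)// lerDl ltW.
have h : I <= 4 * (A0 * A1 * (rho / `|x - c|) ^+ (n + K.+1)).
  by apply: regular_distribution_le => a psi hm hl hk; exact: (real_part_far hm hl (ltW A00) t0 hk).
have g0 : 0 < gam by exact: lt_le_trans gam1.
have ex : exists k, `|x - c| <= gam * (2 ^+ k * rho).
  exists (Num.truncn (`|x - c| / (gam * rho))).+1; rewrite mulrCA -ler_pdivrMr ?mulr_gt0//.
  apply: le_trans (ltW (truncnS_gt _)) _.
  by rewrite -natrX ler_nat ltnW// ltn_expl.
case: (ex_minnP ex) => -[|k] hk kmin; first by exfalso; apply: xQ; rewrite expr0 mul1r in hk.
apply: le_trans (nneseries_term k.+1 (fun k => p0 k x)); rewrite /=.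
rewrite indicE mem_set// mule1 lee_fin.
have -> : 2 `^ (- (k.+1%:R * (w * (n + K.+1)%:R))) = (((2 ^+ k.+1)^-1) ^+ (n + K.+1)) `^ w.
  have p2 : 0 < ((2 : R) ^+ k.+1)^-1 by rewrite invr_gt0 exprn_gt0.
  rewrite [in RHS](expr_expR _ p2) lnV ?posrE ?exprn_gt0// lnXn// -mulr_natl.
  by rewrite !powR_expR ?expR_gt0// expRK; congr expR; ring.
apply: ler_powR2 => //; first exact: ltW.
rewrite ler_pdivrMr// (le_trans h)//.
(* By minimality of k + 1, [x] is outside the [gam]-enlarged dilate of index [k], and gam >= 1. *)
have kz : 2 ^+ k * rho <= `|x - c|.
  rewrite leNgt; apply/negP => hlt.
  have /kmin : `|x - c| <= gam * (2 ^+ k * rho).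
    by rewrite (le_trans (ltW hlt))// ler_peMl// mulr_ge0 ?exprn_ge0 ?(ltW rho0)// ltW.
  by rewrite ltnn.
have z0 : 0 < `|x - c| by apply: lt_le_trans kz; rewrite mulr_gt0 ?exprn_gt0.
have hz : rho / `|x - c| <= 2 * (2 ^+ k.+1)^-1.
  by rewrite exprS invfM mulrA divff// mul1r ler_pdivrMr// ler_pdivlMl ?exprn_gt0.
apply: (@le_trans _ _ (4 * (A0 * A1 * (2 * (2 ^+ k.+1)^-1) ^+ (n + K.+1)))).
  rewrite ler_pM2l// ler_wpM2l ?mulr_ge0 ?(ltW A00) ?(ltW A10)//.
  by rewrite lerXn2r ?nnegrE ?mulr_ge0 ?invr_ge0 ?exprn_ge0 ?(ltW rho0).
rewrite exprMn /atom_const; set X := _^-1 ^+ _; have X0 : 0 <= X by rewrite /X exprn_ge0// invr_ge0 exprn_ge0.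
have Y0 : 0 <= A0 * A1 * X by rewrite !mulr_ge0// ltW.
rewrite -subr_ge0 (_ : _ - _ = 4 * (4 * 16 ^+ n) * (A0 * A1 * X)); last by ring.
by rewrite mulr_ge0// ltW// mulr_gt0.
Qed.

End atoms.

(** * Gaussian kernels *)

Section exp_bounds.
Context {R : realType}.

Lemma mean_value_le (F dF : R -> R) (a b M : R) :
  (forall u, is_derive u (1 : R) F (dF u)) ->
  (forall u, `|u - a| <= `|b - a| -> `|dF u| <= M) -> `|F b - F a| <= M * `|b - a|.
Proof.
move=> dFF hM.
have cF : continuous F.
  by move=> u; apply: differentiable_continuous; apply/derivable1_diffP; case: (dFF u).
have [ab|/ltW ba] := leP a b.
  have [u] := MVT_segment ab (fun u _ => dFF u) (continuous_subspaceT cF).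
  rewrite in_itv/= => /andP[u1 u2] ->; rewrite normrM ler_wpM2r// hM//.
  by rewrite !ger0_norm ?subr_ge0 ?lerB.
have [u] := MVT_segment ba (fun u _ => dFF u) (continuous_subspaceT cF).
rewrite in_itv/= => /andP[u1 u2] E; rewrite distrC E normrM [`|a - b|]distrC ler_wpM2r// hM//.
by rewrite [`|u - a|]distrC [`|b - a|]distrC !ger0_norm ?subr_ge0 ?lerB.
Qed.

Definition exp_sum (m : nat) (u : R) : R := \sum_(k < m) u ^+ k / k`!%:R.

Lemma exp_sumS m u : exp_sum m.+1 u = exp_sum m u + (m`!%:R)^-1 * u ^+ m.
Proof. by rewrite /exp_sum big_ord_recr/= [_ / _]mulrC. Qed.

Lemma is_derive_exp_sum m (u : R) : is_derive u (1 : R) (exp_sum m.+1) (exp_sum m u).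
Proof.
elim: m => [|m ih].
  rewrite (_ : exp_sum 1 = fun=> 1); last first.
    by apply/funext => v; rewrite exp_sumS /exp_sum big_ord0 add0r invr1 mul1r.
  by rewrite /exp_sum big_ord0; exact: is_derive_cst.
have := is_deriveD ih (is_derive_pow u (m.+1`!%:R^-1) m.+1).
congr (is_derive u 1 _ _); first by apply/funext => v; rewrite [RHS]exp_sumS.
rewrite [RHS]exp_sumS; congr (_ + _); rewrite factS natrM /=.
have h1 : m.+1%:R != 0 :> R by rewrite pnatr_eq0.
by rewrite invfM mulrACA mulVf// mul1r.
Qed.

(** The derivative of one remainder is the preceding remainder and all but the zeroth vanish at 0,
    so the mean value inequality gives one more power of |u|. *)
Lemma exp_sum_remainder m (u : R) : `|expR u - exp_sum m u| <= `|u| ^+ m * expR `|u|.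
Proof.
elim: m u => [|m ih] u.
  by rewrite /exp_sum big_ord0 subr0 expr0 mul1r gtr0_norm ?expR_gt0// ler_expR ler_norm.
have h v : is_derive v (1 : R) (expR - exp_sum m.+1) (expR v - exp_sum m v).
  exact: is_deriveB (is_derive_expR v) (is_derive_exp_sum m v).
have := @mean_value_le _ _ 0 u (`|u| ^+ m * expR `|u|) h.
have -> : (expR - exp_sum m.+1) 0 = 0.
  change (expR 0 - exp_sum m.+1 0 = 0 :> R).
  rewrite expR0 /exp_sum big_ord_recl/= expr0 invr1 mulr1 big1 ?addr0 ?subrr// => i _.
  by rewrite expr0n mul0r.
rewrite !subr0 fctE exprS => /(_ _)/le_trans; apply => [v|].
  rewrite !subr0 => hv; apply: le_trans (ih v) _.
  by rewrite ler_pM ?exprn_ge0 ?expR_ge0// ?lerXn2r ?nnegrE// ler_expR.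
by apply: le_of_eq; ring.
Qed.

Lemma poly_exp_bound (m : nat) (b : R) : 0 < b -> exists C : R, 0 < C /\
  forall X, 0 <= X -> (1 + X) ^+ m * expR (- (b * X)) <= C.
Proof.
move=> b0; pose C := 1 + m.+1%:R / b.
have C1 : 1 <= C by rewrite lerDl divr_ge0// ltW.
have C0 : 0 < C by exact: lt_le_trans C1.
exists (C ^+ m); split; first by rewrite exprn_gt0.
move=> X X0; rewrite expRN ler_pdivrMr ?expR_gt0//.
have h : 1 + X <= C * expR (b * X / m.+1%:R).
  apply: (@le_trans _ _ (C * (1 + b * X / m.+1%:R))).
    have -> : C * (1 + b * X / m.+1%:R) = C + b * X / m.+1%:R + X.
      by rewrite /C; field; rewrite !gt_eqF// ltr0n.
    by rewrite lerD2r (le_trans C1)// lerDl divr_ge0// mulr_ge0// ltW.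
  by rewrite ler_pM2l// expR_ge1Dx.
apply: (@le_trans _ _ ((C * expR (b * X / m.+1%:R)) ^+ m)).
  by rewrite lerXn2r ?nnegrE ?addr_ge0 ?mulr_ge0 ?expR_ge0// ltW.
rewrite exprMn ler_wpM2l ?exprn_ge0 ?(ltW C0)// -expRM_natl ler_expR.
rewrite mulrCA ler_piMr ?mulr_ge0 ?(ltW b0)// ler_pdivrMr ?ltr0n// mul1r ler_nat.
exact: leqnSn.
Qed.

(* Only the terms of total degree less than [e] in a variable [h] with
   [A = O(h)] and [B = O(h^2)] are kept. *)
Definition gauss_sum (e : nat) (A B : R) : R :=
  \sum_(b < e) (- B) ^+ b / b`!%:R * exp_sum (e - b.*2) A.

(** Exactly [e] powers of [eta] are gained; what is lost is polynomial in [X] and expR (3/4 X),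
    since |A| <= X/2 and B <= X/4. The Gaussian prefactor expR (-X) later absorbs this loss. *)
Lemma gauss_sum_remainder (e : nat) (A B X eta : R) : 0 <= X -> 0 <= eta -> 4 * eta <= 1 ->
  `|A| <= 2 * eta * X -> 0 <= B -> B <= eta ^+ 2 * X ->
  `|expR (A - B) - gauss_sum e A B| <=
    (1 + e%:R * 2 ^+ e) * eta ^+ e * (1 + X) ^+ (2 * e) * expR (3 / 4 * X).
Proof.
move=> X0 eta0 eta1 hA B0 hB.
have e1 : eta <= 1 by lra.
have e2 : eta ^+ 2 <= eta by rewrite expr2 ler_piMl.
have X1 : 1 <= 1 + X by rewrite lerDl.
have etaX : eta * X <= X / 4 by rewrite mulrC ler_wpM2l//; lra.
have BX : B <= X / 4 by rewrite (le_trans hB)// (le_trans _ etaX)// ler_wpM2r.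
have AX : `|A| <= X / 2 by rewrite (le_trans hA)// -mulrA; lra.
(* First the exponential of -B is truncated, then in each of its terms the exponential of A, at the
   complementary order. *)
have E : expR (A - B) - gauss_sum e A B = expR A * (expR (- B) - exp_sum e (- B)) +
    \sum_(b < e) (- B) ^+ b / b`!%:R * (expR A - exp_sum (e - b.*2) A).
  rewrite mulrBr -expRD -addrA; congr (_ + _).
  rewrite /gauss_sum; under [X in _ = _ + X]eq_bigr do rewrite mulrBr.
  by rewrite sumrB -mulr_suml -/(exp_sum e (- B)) [X in _ + (X - _)]mulrC addKr.
rewrite E (le_trans (ler_normD _ _))//.
have hP : 0 <= eta ^+ e * (1 + X) ^+ (2 * e) * expR (3 / 4 * X).
  by rewrite !mulr_ge0 ?exprn_ge0 ?expR_ge0// (le_trans ler01).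
rewrite -!mulrA [leRHS]mulrDl mul1r; apply: lerD.
  rewrite normrM (gtr0_norm (expR_gt0 _)) mulrA.
  apply: (@le_trans _ _ (expR `|A| * (B ^+ e * expR B))).
    rewrite ler_pM ?expR_ge0 ?ler_expR ?ler_norm//.
    by have := exp_sum_remainder e (- B); rewrite normrN (ger0_norm B0).
  rewrite mulrCA -expRD; apply: ler_pM; rewrite ?exprn_ge0 ?expR_ge0//; last first.
    by rewrite ler_expR; lra.
  rewrite exprM -exprMn lerXn2r ?nnegrE ?mulr_ge0 ?exprn_ge0 ?addr_ge0//.
  rewrite (le_trans hB)//; apply: ler_pM; rewrite ?exprn_ge0//.
  by rewrite expr2 -[leLHS]mul1r ler_pM// lerDr.
rewrite (le_trans (ler_norm_sum _ _ _))//.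
apply: (@le_trans _ _ (\sum_(b < e) (2 ^+ e * (eta ^+ e * ((1 + X) ^+ (2 * e) * expR (3 / 4 * X)))))).
  apply: ler_sum => b _; rewrite !normrM.
  apply: (@le_trans _ _ (B ^+ b * (`|A| ^+ (e - b.*2) * expR `|A|))).
    apply: ler_pM => //; last exact: exp_sum_remainder.
    rewrite normrX normrN (ger0_norm B0) normfV normr_nat ler_piMr ?exprn_ge0//.
    by rewrite invf_le1 ?ltr0n ?fact_gt0// ler1n fact_gt0.
  rewrite !mulrA; apply: ler_pM; rewrite ?mulr_ge0 ?exprn_ge0 ?expR_ge0//; last first.
    by rewrite ler_expR; lra.
  apply: (@le_trans _ _ ((eta ^+ 2 * X) ^+ b * (2 * eta * X) ^+ (e - b.*2))).
    by rewrite ler_pM ?exprn_ge0 ?lerXn2r ?nnegrE ?mulr_ge0 ?exprn_ge0.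
  have -> : (eta ^+ 2 * X) ^+ b * (2 * eta * X) ^+ (e - b.*2) =
      2 ^+ (e - b.*2) * eta ^+ (b.*2 + (e - b.*2)) * X ^+ (b + (e - b.*2)).
    rewrite [eta ^+ (_ + _)]exprD [X ^+ (_ + _)]exprD -[in eta ^+ b.*2]mul2n exprM !exprMn.
    move: (_ ^+ (e - _)) (eta ^+ (e - _)) (X ^+ (e - _)) (eta ^+ b) (X ^+ b) => u1 u2 u3 u4 u5.
    by ring.
  apply: ler_pM; rewrite ?mulr_ge0 ?exprn_ge0//.
    apply: ler_pM; rewrite ?exprn_ge0//; first by rewrite ler_weXn2l ?ler1n// leq_subr.
    by rewrite ler_wiXn2l// -maxnE leq_maxr.
  apply: (@le_trans _ _ ((1 + X) ^+ (b + (e - b.*2)))).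
    by rewrite lerXn2r ?nnegrE ?addr_ge0// lerDr.
  by apply: ler_weXn2l => //; rewrite mul2n -[e.*2]addnn leq_add ?leq_subr// ltnW.
by rewrite sumr_const card_ord -[_ *+ e]mulr_natl !mulrA.
Qed.

End exp_bounds.

Section heat.
Context {R : realType} {n : nat}.
Local Notation mu := (@lebesgue_rV R n).
Local Notation LT := (@lebesgue_space R n).
Hypothesis n_gt0 : (0 < n)%N.

Lemma polyfun_exp_sum m (d : nat) (P : 'rV[R]_n -> R) : polyfun 1 P ->
  (m <= d.+1)%N -> polyfun d (fun y => exp_sum m (P y)).
Proof.
move=> hP md; apply: polyfun_sum => k; under eq_fun do rewrite mulrC.
apply: polyfunZ; apply: polyfun_leq (polyfunX k hP); rewrite muln1.
by rewrite -ltnS (leq_trans (ltn_ord k)).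
Qed.

Lemma polyfun_gauss_sum (d : nat) (A B : 'rV[R]_n -> R) : polyfun 1 A -> polyfun 2 B ->
  polyfun d (fun y => gauss_sum d.+1 (A y) (B y)).
Proof.
move=> hA hB; apply: polyfun_sum => b.
have [db|bd] := leqP d.+1 b.*2.
  move/eqP: db => ->.
  under eq_fun do rewrite /exp_sum big_ord0 mulr0.
  exact: polyfun0.
have hN : polyfun 2 (fun y => - B y) by under eq_fun do rewrite -mulN1r; exact: polyfunZ.
have h1 : polyfun (b * 2) (fun y => (- B y) ^+ b / b`!%:R).
  by under eq_fun do rewrite mulrC; apply/polyfunZ/polyfunX.
have h2 : polyfun (d - b.*2) (fun y => exp_sum (d.+1 - b.*2) (A y)).
  by apply: polyfun_exp_sum => //; rewrite subSn.
apply: polyfun_leq (polyfunM h1 h2); rewrite muln2 subnKC//.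
Qed.

Lemma enorm_sqr (x : 'rV[R]_n) : enorm x ^+ 2 = \sum_i x ord0 i ^+ 2.
Proof. by rewrite sqr_sqrtr// sumr_ge0// => i _; exact: sqr_ge0. Qed.

Lemma norm_le_enorm (x : 'rV[R]_n) : `|x| <= enorm x.
Proof. by apply/rV_norm_le => [|i]; [exact: enorm_ge0|exact: enorm_coord]. Qed.

Definition gaussian (t : R) (x y : 'rV[R]_n) : R :=
  (Num.sqrt ((4 * pi * t) ^+ n))^-1 * expR (- (enorm (x - y) ^+ 2 / (4 * t))).

Lemma measurable_gaussian t x : measurable_fun [set: LT] (gaussian t x).
Proof.
apply: (@measurable_funM _ LT R); first exact: measurable_cst.
apply: (@measurableT_comp _ _ _ LT _ _ (@expR R)); first exact: measurable_expR.
under eq_fun do rewrite -mulNr enorm_sqr.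
apply: (@measurable_funM _ LT R); last exact: measurable_cst.
apply: (@measurableT_comp _ _ _ LT _ _ (@GRing.opp R)); first exact: oppr_measurable.
apply: (@measurable_sum _ LT R) => i; apply: (@measurable_funX _ LT R).
under eq_fun do rewrite !mxE.
apply: (@measurable_funD _ LT R); first exact: measurable_cst.
apply: (@measurableT_comp _ _ _ LT _ _ (@GRing.opp R)); first exact: oppr_measurable.
exact: measurable_coord.
Qed.

Lemma sqrtrXn (a : R) k : 0 <= a -> Num.sqrt (a ^+ k) = Num.sqrt a ^+ k.
Proof.
move=> a0; rewrite -{1}(sqr_sqrtr a0) -exprM mulnC exprM sqrtr_sqr ger0_norm//.
Qed.

Lemma sqrt_heat_ge (t : R) : 0 < t -> Num.sqrt t ^+ n <= Num.sqrt ((4 * pi * t) ^+ n) /\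
  Num.sqrt ((4 * t) ^+ n) <= Num.sqrt ((4 * pi * t) ^+ n).
Proof.
move=> t0; have p2 : 2 <= pi :> R by exact: pi_ge2.
split.
  rewrite -sqrtrXn ?(ltW t0)// ler_wsqrtr// lerXn2r ?nnegrE ?mulr_ge0 ?pi_ge0 ?(ltW t0)//.
  by rewrite ler_peMl ?(ltW t0)//; lra.
rewrite ler_wsqrtr// lerXn2r ?nnegrE ?mulr_ge0 ?pi_ge0 ?(ltW t0)//.
rewrite ler_wpM2r ?(ltW t0)//; lra.
Qed.

Lemma gaussian_near : exists A0 : R, 0 < A0 /\ forall t x y, 0 < t ->
  gaussian t x y <= A0 / Num.sqrt t ^+ n / (1 + `|x - y| / Num.sqrt t) ^+ n.+1.
Proof.
have [C [C0 HC]] := @poly_exp_bound R n.+1 4^-1 ltac:(by rewrite invr_gt0).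
exists (2 ^+ n.+1 * C); split; first by rewrite mulr_gt0 ?exprn_gt0.
move=> t x y t0; have s0 : 0 < Num.sqrt t by rewrite sqrtr_gt0.
have [h1 _] := sqrt_heat_ge t0; rewrite /gaussian.
pose u := `|x - y| / Num.sqrt t; have u0 : 0 <= u by rewrite divr_ge0// ltW.
rewrite -/u (_ : _ / _ / _ = (Num.sqrt t ^+ n)^-1 * (2 ^+ n.+1 * C / (1 + u) ^+ n.+1)); last by ring.
apply: ler_pM; rewrite ?invr_ge0 ?sqrtr_ge0 ?expR_ge0//.
  by rewrite lef_pV2 ?posrE ?exprn_gt0// (lt_le_trans _ h1)// exprn_gt0.
rewrite ler_pdivlMr ?exprn_gt0 ?ltr_pwDl//.
(* The bound 1 + u <= 2 (1 + u^2) reduces Gaussian decay to [poly_exp_bound] at u^2. *)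
apply: (@le_trans _ _ (expR (- (4^-1 * u ^+ 2)) * (2 * (1 + u ^+ 2)) ^+ n.+1)).
  apply: ler_pM; rewrite ?expR_ge0 ?exprn_ge0 ?addr_ge0//.
    rewrite ler_expR lerN2 /u expr_div_n sqr_sqrtr ?(ltW t0)//.
    rewrite mulrA [4^-1 * _]mulrC -mulrA -invfM ler_wpM2r ?invr_ge0 ?mulr_ge0 ?(ltW t0)//.
    by rewrite lerXn2r ?nnegrE ?enorm_ge0 ?norm_le_enorm.
  rewrite lerXn2r ?nnegrE ?addr_ge0 ?mulr_ge0 ?addr_ge0 ?exprn_ge0//.
  by have := sqr_ge0 (u - 1); rewrite sqrrB1; have := sqr_ge0 u; lra.
by rewrite [(2 * _) ^+ _]exprMn mulrCA ler_wpM2l ?exprn_ge0// mulrC HC// exprn_ge0.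
Qed.

(** With z = x - c, the exponent -|x - y|^2 / (4t) expands as -X + A - B, where A has degree 1 and B
    degree 2 in y - c. Relative to X they are of orders eta and eta^2, so [gauss_sum] gives an
    approximation of degree [d] uniform in [t]. *)
Lemma gaussian_far d : exists A0 : R, 0 < A0 /\ forall t c rho x, 0 < t -> 0 < rho ->
  ~ qb c (4 * n%:R * rho) x -> exists P, polyfun d P /\
  forall y, qb c rho y -> `|gaussian t x y - P y| <= A0 * rho ^+ d.+1 / `|x - c| ^+ (n + d.+1).
Proof.
have [C [C0 HC]] := @poly_exp_bound R (2 * d.+1 + n) 4^-1 ltac:(by rewrite invr_gt0).
have n0 : 0 < n%:R :> R by rewrite ltr0n.
exists (C * (1 + d.+1%:R * 2 ^+ d.+1) * n%:R ^+ d.+1); split.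
  by rewrite !mulr_gt0 ?exprn_gt0// ltr_pwDl// mulr_ge0 ?exprn_ge0.
move=> t c rho x t0 rho0 nx; pose z := x - c.
have hz : 4 * n%:R * rho < `|z| by rewrite ltNge; apply/negP.
have z0 : 0 < `|z| by apply: le_lt_trans hz; rewrite !mulr_ge0// ltW.
pose Z := enorm z; have Zz : `|z| <= Z by exact: norm_le_enorm.
have Z0 : 0 < Z by exact: lt_le_trans Zz.
have t40 : 0 < 4 * t by rewrite mulr_gt0.
pose X := Z ^+ 2 / (4 * t); have X0 : 0 <= X by rewrite divr_ge0 ?exprn_ge0// ltW.
(* The factor n accounts for the sums over coordinates, each at most [rho]; the far condition |z| >
   4 n rho is what makes 4 eta <= 1. *)
pose eta := n%:R * rho / `|z|.
have eta0 : 0 <= eta by rewrite divr_ge0 ?mulr_ge0// ltW.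
have eta1 : 4 * eta <= 1 by rewrite /eta !mulrA ler_pdivrMr// mul1r ltW.
have etaZ : n%:R * rho <= eta * Z by rewrite /eta mulrAC ler_pdivlMr// ler_wpM2l// mulr_ge0// ltW.
pose kap := (Num.sqrt ((4 * pi * t) ^+ n))^-1.
have kap0 : 0 <= kap by rewrite invr_ge0 sqrtr_ge0.
pose A (y : 'rV[R]_n) := \sum_i (2 * z ord0 i / (4 * t)) * (y ord0 i - c ord0 i).
pose B (y : 'rV[R]_n) := \sum_i (4 * t)^-1 * (y ord0 i - c ord0 i) ^+ 2.
have hc i : polyfun 1 (fun y => y ord0 i - c ord0 i) by apply: polyfunD; [exact: polyfun_coord|exact: polyfun_cst].
have pA : polyfun 1 A by apply: polyfun_sum => i; exact: polyfunZ.
have pB : polyfun 2 B by apply: polyfun_sum => i; apply: polyfunZ; have := polyfunX 2 (hc i).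
exists (fun y => kap * expR (- X) * gauss_sum d.+1 (A y) (B y)); split.
  exact/polyfunZ/polyfun_gauss_sum.
move=> y yQ.
have hi i : `|y ord0 i - c ord0 i| <= rho.
  by have := rV_coord_le (y - c) i; rewrite !mxE => /le_trans; apply.
have E : enorm (x - y) ^+ 2 / (4 * t) = X - A y + B y.
  rewrite /X /Z !enorm_sqr !mulr_suml -sumrB -big_split/=; apply: eq_bigr => i _.
  by rewrite !mxE; ring.
have hA : `|A y| <= 2 * eta * X.
  apply: (@le_trans _ _ (\sum_(i < n) (2 * Z / (4 * t)) * rho)).
    rewrite (le_trans (ler_norm_sum _ _ _))//; apply: ler_sum => i _.
    rewrite normrM; apply: ler_pM => //; rewrite !normrM ger0_norm// [`|_^-1|]ger0_norm ?invr_ge0 ?(ltW t40)//.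
    by rewrite ler_wpM2r ?invr_ge0 ?(ltW t40)// ler_wpM2l// enorm_coord.
  rewrite sumr_const card_ord -[_ *+ n]mulr_natr -mulrA [rho * _]mulrC.
  apply: (@le_trans _ _ (2 * Z / (4 * t) * (eta * Z))).
    by rewrite ler_wpM2l// divr_ge0 ?mulr_ge0 ?(ltW Z0) ?(ltW t0).
  by rewrite /X; apply: le_of_eq; ring.
have B0 : 0 <= B y by apply: sumr_ge0 => i _; rewrite mulr_ge0 ?sqr_ge0// invr_ge0 ltW.
have hB : B y <= eta ^+ 2 * X.
  apply: (@le_trans _ _ (\sum_(i < n) (4 * t)^-1 * rho ^+ 2)).
    apply: ler_sum => i _; rewrite ler_wpM2l ?invr_ge0 ?(ltW t40)//.
    by rewrite -[leLHS]ger0_norm ?sqr_ge0// normrX lerXn2r ?nnegrE// ltW.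
  rewrite sumr_const card_ord -[_ *+ n]mulr_natr.
  apply: (@le_trans _ _ ((4 * t)^-1 * (eta * Z) ^+ 2)).
    rewrite -mulrA ler_wpM2l ?invr_ge0 ?(ltW t40)//.
    apply: (@le_trans _ _ ((n%:R * rho) ^+ 2)).
      rewrite exprMn mulrC ler_wpM2r ?sqr_ge0//.
      by rewrite expr2 ler_peMl ?(ltW n0)// ler1n.
    by rewrite lerXn2r ?nnegrE ?mulr_ge0 ?(ltW n0) ?(ltW rho0) ?(ltW Z0).
  by rewrite /X; apply: le_of_eq; ring.
have -> : gaussian t x y = kap * expR (- X) * expR (A y - B y).
  by rewrite /gaussian -/kap -mulrA -expRD E; congr (_ * expR _); ring.
rewrite -mulrBr normrM ger0_norm ?mulr_ge0 ?expR_ge0//.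
have G := @gauss_sum_remainder R d.+1 _ _ X eta X0 eta0 eta1 hA B0 hB.
apply: le_trans (ler_wpM2l _ G) _; first by rewrite mulr_ge0 ?expR_ge0.
(* The normalisation t^(-n/2) is traded for |z|^(-n) at the price of powers of X, so that the final
   bound does not depend on [t]. *)
have kapZ : kap <= (1 + X) ^+ n / `|z| ^+ n.
  have Zn : `|z| ^+ n <= Z ^+ n by rewrite lerXn2r ?nnegrE ?(ltW z0) ?(ltW Z0).
  rewrite /kap -[leLHS]mul1r ler_pdivlMr ?exprn_gt0// mulrAC mul1r.
  have [_ h2] := sqrt_heat_ge t0.
  have s4 : 0 < Num.sqrt ((4 * t) ^+ n) by rewrite sqrtr_gt0 exprn_gt0.
  rewrite ler_pdivrMr ?(lt_le_trans s4)//; apply: le_trans Zn _.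
  apply: (@le_trans _ _ ((1 + X) ^+ n * Num.sqrt ((4 * t) ^+ n))); last first.
    by rewrite ler_wpM2l// exprn_ge0// addr_ge0.
  rewrite -[leLHS]ger0_norm ?exprn_ge0 ?(ltW Z0)// -sqrtr_sqr.
  have X2 : 0 <= 1 + X by rewrite addr_ge0.
  have X1 : 0 <= (1 + X) ^+ n by rewrite exprn_ge0.
  rewrite -[X in _ <= X * _]ger0_norm// -sqrtr_sqr -sqrtrM ?sqr_ge0// ler_wsqrtr//.
  rewrite -!exprM [(n * 2)%N]mulnC !exprM -exprMn lerXn2r ?nnegrE ?mulr_ge0 ?sqr_ge0 ?(ltW t0) ?(ltW Z0)//.
  have -> : Z ^+ 2 = X * (4 * t) by rewrite /X divfK// gt_eqF.
  rewrite ler_wpM2r ?(ltW t40)// expr2.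
  by have := sqr_ge0 X; rewrite expr2; nra.
pose c1 := (1 + d.+1%:R * 2 ^+ d.+1) : R.
have c10 : 0 <= c1 by rewrite addr_ge0// mulr_ge0// exprn_ge0.
have X1 : 0 <= 1 + X by rewrite addr_ge0.
have c2 : 0 <= c1 * eta ^+ d.+1 / `|z| ^+ n by rewrite !mulr_ge0 ?invr_ge0 ?exprn_ge0 ?(ltW z0).
apply: (@le_trans _ _ (c1 * eta ^+ d.+1 / `|z| ^+ n * ((1 + X) ^+ (2 * d.+1 + n) * expR (- (4^-1 * X))))).
  have -> : expR (- (4^-1 * X)) = expR (- X) * expR (3 / 4 * X).
    by rewrite -expRD; congr expR; field.
  rewrite -/c1 exprD.
  have -> : kap * expR (- X) * (c1 * eta ^+ d.+1 * (1 + X) ^+ (2 * d.+1) * expR (3 / 4 * X)) =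
     kap * (c1 * eta ^+ d.+1 * (1 + X) ^+ (2 * d.+1) * (expR (- X) * expR (3 / 4 * X))) by ring.
  apply: le_trans (ler_wpM2r _ kapZ) _; first by rewrite !mulr_ge0 ?exprn_ge0 ?expR_ge0.
  by apply: le_of_eq; ring.
apply: le_trans (ler_wpM2l c2 (HC _ X0)) _.
apply: le_of_eq; rewrite /eta !expr_div_n exprMn exprD -/z.
by rewrite /c1 invfM; ring.
Qed.

End heat.

(** * Smooth kernels *)

Section taylor.
Context {R : realType} {n : nat}.
Implicit Types (u : 'rV[R]_n -> R) (c x y : 'rV[R]_n).

Lemma is_derive_set_coord u x (i : 'I_n) (t : R) :
  (forall y, derivable u y (delta_mx ord0 i)) ->
  is_derive t (1 : R) (fun t => u (set_coord x i t))
    ('D_(delta_mx ord0 i) u (set_coord x i t)).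
Proof.
move=> du.
have E : (fun h : R => h^-1 *: (((fun t => u (set_coord x i t)) \o shift t) (h *: (1 : R)) -
      u (set_coord x i t))) =
    (fun h : R => h^-1 *: ((u \o shift (set_coord x i t)) (h *: delta_mx ord0 i) -
      u (set_coord x i t))).
  apply/funext => h /=; congr (_ *: (u _ - _)); apply/rowP => j; rewrite !mxE/=.
  by case: (j == i); rewrite /GRing.scale/= ?mulr1 ?mulr0 ?add0r.
have := du (set_coord x i t); rewrite /derivable -E => d.
by split; rewrite // /derive E.
Qed.

Lemma partial_rcons s i u : partial (rcons s i) u = partial s ('D_(delta_mx ord0 i) u).
Proof. by rewrite /partial -cats1 foldr_cat. Qed.

Lemma smooth_derive i u : smooth u -> smooth ('D_(delta_mx ord0 i) u).
Proof. by move=> su s; have := su (rcons s i); rewrite partial_rcons. Qed.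

(** The corners of the coordinate path from [c] to [y]: the first [k] coordinates are already those
    of [y]. *)
Definition partial_path c y (k : nat) : 'rV[R]_n :=
  \row_j if (j < k)%N then y ord0 j else c ord0 j.

Lemma partial_pathS c y (i : 'I_n) :
  partial_path c y i.+1 = set_coord (partial_path c y i) i (y ord0 i).
Proof.
apply/rowP => j; rewrite !mxE ltnS leq_eqVlt.
by have [->|ji] := eqVneq j i; rewrite ?eqxx//= (inj_eq val_inj) (negPf ji).
Qed.

Lemma partial_path_set c y (i : 'I_n) :
  partial_path c y i = set_coord (partial_path c y i) i (c ord0 i).
Proof. by apply/rowP => j; rewrite !mxE; case: eqP => // ->; rewrite ltnn. Qed.

(** By induction on the order, from approximations of the first derivatives. Integrating them along
    the coordinate path needs neither a multi-index formula nor the symmetry of mixed derivatives;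
    the path stays in the cube. *)
Lemma polyfun_taylor (e : nat) u c : smooth u -> exists P,
  (if e is d.+1 then polyfun d P else P = fun=> 0) /\ forall rho M : R, 0 <= rho -> 0 <= M ->
  (forall s z, size s = e -> qb c rho z -> `|partial s u z| <= M) ->
  forall y, qb c rho y -> `|u y - P y| <= (n%:R * rho) ^+ e * M.
Proof.
elim: e u => [|e ih] u su.
  exists (fun=> 0); split => // rho M rho0 M0 H y yQ.
  by rewrite subr0 expr0 mul1r; exact: (H [::]).
have {}ih i := ih _ (smooth_derive i su).
have [P hP] := choice ih.
have HQ i : exists Q, polyfun e Q /\ forall x (t : R),
    is_derive t (1 : R) (fun t => Q (set_coord x i t)) (P i (set_coord x i t)).
  case: e {ih} hP => [|d] hP; last exact/polyfun_antiderivative/(hP i).1.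
  exists (fun=> 0); split; first exact: polyfun0.
  by move=> x t; rewrite (hP i).1; exact: is_derive_cst.
have [Q hQ] := choice HQ.
(* Each segment of the path contributes the increment of an antiderivative of the approximation to
   the corresponding derivative. *)
exists (fun y => u c + \sum_i (Q i (partial_path c y i.+1) + (- 1) * Q i (partial_path c y i))).
split.
  apply: polyfunD; first exact: polyfun_cst.
  apply: polyfun_sum => i; apply: polyfunD; last apply: polyfunZ.
    exact: (polyfun_freeze (fun j => (j < i.+1)%N) c (hQ i).1).
  exact: (polyfun_freeze (fun j => (j < i)%N) c (hQ i).1).
move=> rho M rho0 M0 H y yQ.
have pQ (i : 'I_n) (t : R) : `|t - c ord0 i| <= rho -> qb c rho (set_coord (partial_path c y i) i t).
  move=> ht; rewrite /qb /=; apply/rV_norm_le => // j; rewrite !mxE.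
  case: eqP => [->//|_]; case: ifP => _; last by rewrite subrr normr0.
  by have := rV_coord_le (y - c) j; rewrite !mxE => /le_trans; apply.
have yi i : `|y ord0 i - c ord0 i| <= rho.
  by have := rV_coord_le (y - c) i; rewrite !mxE => /le_trans; apply.
have E : u y - u c = \sum_(i < n) (u (partial_path c y i.+1) - u (partial_path c y i)).
  rewrite -(big_mkord xpredT (fun i => u (partial_path c y i.+1) - u (partial_path c y i))).
  rewrite telescope_sumr//; congr (u _ - u _); apply/rowP => j; rewrite mxE ?ltn_ord//.
rewrite opprD addrA E -sumrB (le_trans (ler_norm_sum _ _ _))//.
apply: (@le_trans _ _ (\sum_(i < n) ((n%:R * rho) ^+ e * M * rho))).
  apply: ler_sum => i _; rewrite mulN1r.
  (* The error along one segment; its derivative is the error of the approximated derivative,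
     controlled by the induction hypothesis. *)
  pose F t := u (set_coord (partial_path c y i) i t) - Q i (set_coord (partial_path c y i) i t).
  pose dF t := 'D_(delta_mx ord0 i) u (set_coord (partial_path c y i) i t) -
    P i (set_coord (partial_path c y i) i t).
  have dFF t : is_derive t (1 : R) F (dF t).
    by apply: is_deriveB; [apply: is_derive_set_coord => z; exact: (su [::]).2|exact: (hQ i).2].
  have := @mean_value_le R F dF (c ord0 i) (y ord0 i) ((n%:R * rho) ^+ e * M) dFF.
  rewrite {1 2}/F -partial_pathS -partial_path_set => h.
  rewrite (_ : _ - _ - _ = u (partial_path c y i.+1) - Q i (partial_path c y i.+1) -
    (u (partial_path c y i) - Q i (partial_path c y i))); last by ring.
  apply: le_trans (h _) _.
    move=> t ht; apply: ((hP i).2 rho M) => //; last by apply: pQ; exact: le_trans ht (yi i).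
    by move=> s z ss zQ; rewrite -partial_rcons; apply: H => //; rewrite size_rcons ss.
  by rewrite ler_wpM2l// mulr_ge0// exprn_ge0// mulr_ge0.
rewrite sumr_const card_ord -[_ *+ n]mulr_natr exprS.
by apply: le_of_eq; ring.
Qed.

End taylor.

Section kernels.
Context {R : realType} {n : nat}.
Local Notation LT := (@lebesgue_space R n).
Hypothesis n_gt0 : (0 < n)%N.
Local Notation gam := (4 * n%:R : R).

Let n1 : 1 <= n%:R :> R. Proof. by rewrite ler1n. Qed.

Lemma kernel_bound0 K c rho (A0 t : R) (x : 'rV[R]_n) : 0 <= A0 -> 0 < rho -> 0 < t ->
  kernel_bound K gam c rho A0 t x (fun=> 0).
Proof.
move=> A00 rho0 t0; split; first exact: measurable_cst.
  by move=> y; rewrite normr0 !divr_ge0 ?exprn_ge0 ?addr_ge0 ?divr_ge0// ltW.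
move=> _; exists (fun=> 0); split; first exact: polyfun0.
by move=> y _; rewrite subrr normr0 divr_ge0 ?mulr_ge0 ?exprn_ge0// ltW.
Qed.

Lemma kernel_bound_gaussian K : exists A0 : R, 0 < A0 /\ forall (t : R) (x c : 'rV[R]_n) (rho : R), 0 < t -> 0 < rho ->
  kernel_bound K gam c rho A0 (Num.sqrt t) x (gaussian t x).
Proof.
have [A1 [A10 H1]] := @gaussian_near R n; have [A2 [A20 H2]] := @gaussian_far R n n_gt0 K.
exists (A1 + A2); split; first by rewrite addr_gt0.
move=> t x c rho t0 rho0; have s0 : 0 < Num.sqrt t by rewrite sqrtr_gt0.
split; first exact: measurable_gaussian.
  move=> y; rewrite ger0_norm; last by rewrite mulr_ge0 ?invr_ge0 ?sqrtr_ge0 ?expR_ge0.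
  apply: le_trans (H1 t x y t0) _.
  by rewrite !ler_wpM2r ?invr_ge0 ?exprn_ge0 ?(ltW s0)// ?lerDl ?(ltW A20)// addr_ge0// divr_ge0// ltW.
move=> nx; have [P [hP H]] := H2 t c rho x t0 rho0 nx; exists P; split => // y yQ.
apply: le_trans (H y yQ) _; rewrite !ler_wpM2r ?invr_ge0 ?exprn_ge0 ?(ltW rho0)//.
by rewrite lerDr ltW.
Qed.

Lemma norm_japanese (x : 'rV[R]_n) : `|x| <= japanese x.
Proof. exact: le_trans (norm_le_enorm x) (enorm_japanese x). Qed.

(** With |x| <= 1, distances from [x] are comparable to the weights of the Schwartz norm. In the far
    case |x - c| <= 4 [japanese z] on the whole cube, so weighted bounds on derivatives become decay
    in |x - c|. *)
Lemma kernel_bound_smooth K (A0 : R) c rho (x : 'rV[R]_n) (psi : 'rV[R]_n -> R) :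
  smooth psi -> 0 <= A0 -> 0 < rho -> `|x| <= 1 ->
  (forall s z, (size s <= n + K.+1)%N -> japanese z ^+ (n + K.+1) * `|partial s psi z| <= A0) ->
  kernel_bound K gam c rho ((3 ^+ n.+1 + n%:R ^+ K.+1 * 4 ^+ (n + K.+1)) * A0) 1 x psi.
Proof.
move=> spsi A00 rho0 x1 H.
have c1 : 0 <= 3 ^+ n.+1 :> R by rewrite exprn_ge0.
have c2 : 0 <= n%:R ^+ K.+1 * 4 ^+ (n + K.+1) :> R by rewrite mulr_ge0 ?exprn_ge0.
have jp (z : 'rV[R]_n) : 0 < japanese z by rewrite (lt_le_trans ltr01)// japanese_ge1.
split; first exact/measurable_continuous_rV/(spsi [::]).1.
  move=> y; rewrite expr1n !divr1 ler_pdivlMr ?exprn_gt0 ?ltr_pwDl//.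
  have h : 1 + `|x - y| <= 3 * japanese y.
    have := ler_normB x y; have := norm_japanese y; have := japanese_ge1 y; lra.
  apply: (@le_trans _ _ (3 ^+ n.+1 * A0)); last by rewrite ler_wpM2r// lerDl.
  apply: (@le_trans _ _ (`|psi y| * (3 * japanese y) ^+ n.+1)).
    by rewrite ler_wpM2l// lerXn2r ?nnegrE ?addr_ge0 ?mulr_ge0 ?(ltW (jp y)).
  rewrite exprMn mulrCA ler_wpM2l// mulrC.
  apply: le_trans (H [::] y _); last by [].
  by rewrite ler_wpM2r// ler_weXn2l ?japanese_ge1// addnS ltnS leq_addr.
move=> nx; have [P [hP HP]] := polyfun_taylor K.+1 c spsi; exists P; split => // y yQ.
have z0 : gam * rho < `|x - c| by rewrite ltNge; apply/negP.
have zp : 0 < `|x - c| by apply: le_lt_trans z0; rewrite !mulr_ge0// ltW.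
have r2 : 2 * rho < `|x - c|.
  apply: le_lt_trans z0; rewrite ler_wpM2r ?(ltW rho0)//.
  by have : 1 <= n%:R :> R := n1; lra.
pose M := A0 * 4 ^+ (n + K.+1) / `|x - c| ^+ (n + K.+1).
have M0 : 0 <= M by rewrite divr_ge0 ?mulr_ge0 ?exprn_ge0.
have hM s z : size s = K.+1 -> qb c rho z -> `|partial s psi z| <= M.
  move=> ss zQ; rewrite ler_pdivlMr ?exprn_gt0//.
  have jz : `|x - c| <= 4 * japanese z.
    have : `|x - c| <= `|x - z| + `|z - c| by rewrite -[x - c](subrKA z) ler_normD.
    have := ler_normB x z; have := norm_japanese z; have := japanese_ge1 z.
    have : `|z - c| <= rho by []. lra.
  apply: (@le_trans _ _ (`|partial s psi z| * (4 * japanese z) ^+ (n + K.+1))).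
    by rewrite ler_wpM2l// lerXn2r ?nnegrE ?mulr_ge0 ?(ltW (jp z)).
  rewrite exprMn [leRHS]mulrC mulrCA ler_wpM2l ?exprn_ge0// mulrC H// ss leq_addl//.
apply: le_trans (HP rho M (ltW rho0) M0 hM y yQ) _.
rewrite /M exprMn.
apply: (@le_trans _ _ (n%:R ^+ K.+1 * 4 ^+ (n + K.+1) * A0 * rho ^+ K.+1 / `|x - c| ^+ (n + K.+1))).
  by apply: le_of_eq; ring.
by rewrite !ler_wpM2r ?invr_ge0 ?exprn_ge0 ?(ltW rho0)// lerDr.
Qed.

End kernels.

(** * Convergence of the atomic sum *)

Section series.
Context {R : realType}.

Lemma powR_split_le (c b x : R) : 1 <= x -> 0 <= c -> c <= b -> c `^ x <= c * b `^ (x - 1).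
Proof.
move=> x1 c0 cb; have [->|cn0] := eqVneq c 0.
  by rewrite powR0 ?mul0r// gt_eqF// (lt_le_trans ltr01).
have -> : c `^ x = c * c `^ (x - 1).
  by rewrite -{2}(powRr1 c0) -powRD ?cn0 ?implybT// addrC subrK.
by rewrite ler_wpM2l// ler_powR2// subr_ge0.
Qed.

(** The embedding of l^1 into l^x: each term is at most the sum, so x - 1 powers can be pulled
    out. *)
Lemma nneseries_power_le (u : nat -> \bar R) (x : R) : 1 <= x -> (forall j, 0 <= u j)%E ->
  (\sum_(j <oo) (u j `^ x) <= (\sum_(j <oo) u j) `^ x)%E.
Proof.
move=> x1 u0; have x0 : 0 < x by exact: lt_le_trans x1.
have [->|Soo] := eqVneq (\sum_(j <oo) u j)%E +oo%E; first by rewrite poweRyr ?leey// gt_eqF.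
have S0 : (0 <= \sum_(j <oo) u j)%E by exact: nneseries_ge0.
have [b E] : exists b : R, (\sum_(j <oo) u j = b%:E)%E.
  by exists (fine (\sum_(j <oo) u j)%E); rewrite fineK// ge0_fin_numE// ltey.
have b0 : 0 <= b by rewrite -lee_fin -E.
apply: (@le_trans _ _ (\sum_(j <oo) ((b `^ (x - 1))%:E * u j))%E).
  apply: lee_nneseries => j _; first by move=> _; exact: poweR_ge0.
  have ub : (u j <= b%:E)%E by rewrite -E; exact: nneseries_term.
  case: (u j) (u0 j) ub => [c| |]//=; rewrite !lee_fin => c0 cb.
  by rewrite mulrC powR_split_le.
rewrite nneseriesZl// E -EFinM poweR_EFin lee_fin.
have [->|bn0] := eqVneq b 0; first by rewrite mulr0 powR_ge0.
by rewrite -{2}(powRr1 b0) -powRD ?bn0 ?implybT// subrK.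
Qed.

Lemma nneseries_le_power (u : nat -> R) (w : R) : 0 < w -> w <= 1 -> (forall j, 0 <= u j) ->
  (\sum_(j <oo) (u j)%:E <= (\sum_(j <oo) (u j `^ w)%:E) `^ w^-1)%E.
Proof.
move=> w0 w1 u0; have h : 1 <= w^-1 by rewrite invr_ge1// unitf_gt0.
apply: le_trans (nneseries_power_le h _); last by move=> j; rewrite lee_fin powR_ge0.
apply: lee_nneseries => j _; first by move=> _; rewrite lee_fin.
by rewrite poweR_EFin -powRrM divff ?gt_eqF// powRr1.
Qed.

Lemma real_series_cvg (a : nat -> R) (b : R) : (\sum_(j <oo) `|a j|%:E <= b%:E)%E ->
  cvgn (fun k => \sum_(j < k) a j) /\ `|limn (fun k => \sum_(j < k) a j)| <= b.
Proof.
move=> H; have hb k : \sum_(0 <= j < k) `|a j| <= b.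
  rewrite -lee_fin -sumEFin; apply: le_trans H.
  by apply: nneseries_lim_ge => j _; rewrite lee_fin.
have E : (fun k => \sum_(j < k) a j) = series a.
  by apply/funext => k; rewrite /series/= big_mkord.
have c : cvgn (series a).
  apply: normed_cvg; apply: nondecreasing_is_cvgn.
    move=> k m km; have h : nondecreasing_seq (fun k => \sum_(0 <= j < k) `|a j|).
      by apply: nondecreasing_series => i _ _; exact: normr_ge0.
    exact: h.
  by exists b => _ [k _ <-]; exact: hb.
rewrite E; split => //.
have hs k : `|series a k| <= b by rewrite (le_trans _ (hb k))// /series/= ler_norm_sum.
rewrite ler_norml; apply/andP; split.
  by apply: limr_ge => //; apply: nearW => k; have := hs k; rewrite ler_norml => /andP[].
by apply: limr_le => //; apply: nearW => k; have := hs k; rewrite ler_norml => /andP[].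
Qed.

Lemma normc_sum_lim (S : nat -> R[i]) (L : R[i]) :
  (fun k => complex.Re (S k)) @ \oo --> complex.Re L ->
  (fun k => complex.Im (S k)) @ \oo --> complex.Im L ->
  (fun k => ComplexField.Normc.normc (S k - L)) @ \oo --> (0 : R).
Proof.
move=> hR hI.
have h0 : (fun k => `|complex.Re (S k) - complex.Re L| + `|complex.Im (S k) - complex.Im L|) @ \oo --> (0 : R).
  rewrite -[0]addr0; apply: cvgD; rewrite -(normr0 R); apply: cvg_norm.
    by rewrite -(subrr (complex.Re L)); apply: cvgB => //; exact: cvg_cst.
  by rewrite -(subrr (complex.Im L)); apply: cvgB => //; exact: cvg_cst.
apply: (squeeze_cvgr _ (@cvg_cst _ _ _ _ _) h0); apply: nearW => k.
rewrite {1}normcE sqrtr_ge0 /=; apply: le_trans (normc_le_ReIm _) _.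
by case: (S k) => ? ?; case: L {hR hI h0} => ? ?.
Qed.

(* [limn] is a junk value when the sequence diverges. *)
Definition climit (S : nat -> R[i]) : R[i] :=
  (limn (fun k => complex.Re (S k)) +i* limn (fun k => complex.Im (S k)))%C.

Lemma complex_series_cvg (l : nat -> R) (z : nat -> R[i]) (b : R) : (forall j, 0 <= l j) ->
  (\sum_(j <oo) (l j * ComplexField.Normc.normc (z j))%:E <= b%:E)%E ->
  let S k := \sum_(j < k) (l j)%:C%C * z j in
  [/\ cvgn (fun k => complex.Re (S k)), cvgn (fun k => complex.Im (S k)) &
      ComplexField.Normc.normc (climit S) <= 2 * b].
Proof.
move=> l0 H S.
have ER : (fun k => complex.Re (S k)) = (fun k => \sum_(j < k) l j * complex.Re (z j)).
  apply/funext => k; rewrite /S raddf_sum; apply: eq_bigr => j _.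
  by case: (z j) => ? ? /=; rewrite mul0r subr0.
have EI : (fun k => complex.Im (S k)) = (fun k => \sum_(j < k) l j * complex.Im (z j)).
  apply/funext => k; rewrite /S raddf_sum; apply: eq_bigr => j _.
  by case: (z j) => ? ? /=; rewrite mul0r addr0.
have HR : (\sum_(j <oo) `|l j * complex.Re (z j)|%:E <= b%:E)%E.
  apply: le_trans H; apply: lee_nneseries => j _; first by move=> _; rewrite lee_fin.
  by rewrite lee_fin normrM ger0_norm// ler_wpM2l// normc_Re_le.
have HI : (\sum_(j <oo) `|l j * complex.Im (z j)|%:E <= b%:E)%E.
  apply: le_trans H; apply: lee_nneseries => j _; first by move=> _; rewrite lee_fin.
  by rewrite lee_fin normrM ger0_norm// ler_wpM2l// normc_Im_le.
have [cR bR] := real_series_cvg HR; have [cI bI] := real_series_cvg HI.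
rewrite ER EI; split => //; apply: le_trans (normc_le_ReIm _) _.
by rewrite /climit/= ER EI mulr_natl mulr2n lerD.
Qed.

End series.

Section regular.
Context {R : realType} {n : nat}.
Local Notation mu := (@lebesgue_rV R n).
Local Notation LT := (@lebesgue_space R n).

Lemma cintegral_lin (c : R[i]) (f g : 'rV[R]_n -> R[i]) : cintegrable f -> cintegrable g ->
  cintegral (fun x => c * f x + g x) = c * cintegral f + cintegral g.
Proof.
move=> [f1 f2] [g1 g2]; case: c => a b.
have Z (k : R) (h : 'rV[R]_n -> R) : mu.-integrable [set: LT] (EFin \o h) ->
    mu.-integrable [set: LT] (EFin \o (fun x => k * h x)).
  by move=> ih; exact: (@integrableZl _ LT R mu _ measurableT k _ ih).
have ED (h k : 'rV[R]_n -> R) : mu.-integrable [set: LT] (EFin \o h) ->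
    mu.-integrable [set: LT] (EFin \o k) ->
    mu.-integrable [set: LT] (EFin \o (fun x => h x + k x)).
  move=> ih ik; rewrite (_ : _ \o _ = (fun x => (h x)%:E + (k x)%:E)%E).
    exact: (@integrableD _ LT R mu _ measurableT _ _ ih ik).
  by apply/funext => x.
have L (k1 k2 : R) (h1 h2 h3 : 'rV[R]_n -> R) : mu.-integrable [set: LT] (EFin \o h1) ->
    mu.-integrable [set: LT] (EFin \o h2) -> mu.-integrable [set: LT] (EFin \o h3) ->
    Rintegral mu [set: LT] (fun x => k1 * h1 x + k2 * h2 x + h3 x) =
    k1 * Rintegral mu [set: LT] h1 + k2 * Rintegral mu [set: LT] h2 + Rintegral mu [set: LT] h3.
  move=> i1 i2 i3.
  rewrite (@RintegralD _ LT R mu _ _ _ measurableT (ED _ _ (Z k1 _ i1) (Z k2 _ i2)) i3).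
  rewrite (@RintegralD _ LT R mu _ _ _ measurableT (Z k1 _ i1) (Z k2 _ i2)).
  by rewrite !(@RintegralZl _ LT R mu).
rewrite /cintegral; apply/eqP; rewrite eq_complex /=; apply/andP; split; apply/eqP.
- rewrite -mulNr -(L _ _ _ _ _ f1 f2 g1); congr (Rintegral _ _ _); apply/funext => x.
  by case: (f x) => ? ?; case: (g x) => ? ? /=; rewrite mulNr.
- rewrite -(L _ _ _ _ _ f2 f1 g2); congr (Rintegral _ _ _); apply/funext => x.
  by case: (f x) => ? ?; case: (g x) => ? ?.
Qed.

Lemma cintegrable_mul (f phi : 'rV[R]_n -> R[i]) K (M : R) : vanishing_moments K f ->
  measurable_fun [set: LT] (fun x => complex.Re (phi x)) ->
  measurable_fun [set: LT] (fun x => complex.Im (phi x)) ->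
  (forall x, ComplexField.Normc.normc (phi x) <= M) -> cintegrable (fun x => f x * phi x).
Proof.
move=> hf m1 m2 hM; have [fR fI] := vanishing_real_moments hf.
have iR := real_part_integrable fR; have iI := real_part_integrable fI.
have hR x : `|complex.Re (phi x)| <= M by exact: le_trans (normc_Re_le _) (hM x).
have hI x : `|complex.Im (phi x)| <= M by exact: le_trans (normc_Im_le _) (hM x).
have i11 := @integrable_mul_bounded _ LT R mu _ _ M iR m1 hR.
have i12 := @integrable_mul_bounded _ LT R mu _ _ M iR m2 hI.
have i21 := @integrable_mul_bounded _ LT R mu _ _ M iI m1 hR.
have i22 := @integrable_mul_bounded _ LT R mu _ _ M iI m2 hI.
split.
- have := @integrableB _ LT R mu _ measurableT _ _ i11 i22; congr (mu.-integrable _ _).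
  by apply/funext => x /=; case: (f x) => ? ?; case: (phi x).
- have := @integrableD _ LT R mu _ measurableT _ _ i12 i21; congr (mu.-integrable _ _).
  by apply/funext => x /=; case: (f x) => ? ?; case: (phi x).
Qed.

Lemma schwartz_measurable_bounded (phi : 'rV[R]_n -> R[i]) : schwartz phi ->
  [/\ measurable_fun [set: LT] (fun x => complex.Re (phi x)),
      measurable_fun [set: LT] (fun x => complex.Im (phi x)) &
      exists M, forall x, ComplexField.Normc.normc (phi x) <= M].
Proof.
move=> [s1 s2 /(_ 0%N) s3]; split.
- exact: measurable_continuous_rV (s1 [::]).1.
- exact: measurable_continuous_rV (s2 [::]).1.
exists (fine (schwartz_norm 0 phi)) => x; rewrite -lee_fin.
have h : ((ComplexField.Normc.normc (phi x))%:E <= schwartz_norm 0 phi)%E.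
  apply: ereal_sup_ubound; exists ([::], x) => //=.
  by rewrite expr0 mul1r /cpartial/=; congr (_%:E); case: (phi x).
rewrite fineK// ge0_fin_numE//; apply: le_trans h.
by rewrite lee_fin normcE sqrtr_ge0.
Qed.

Lemma regular_distribution_lin (f phi psi : 'rV[R]_n -> R[i]) K (c : R[i]) :
  vanishing_moments K f -> schwartz phi -> schwartz psi ->
  regular_distribution f (fun x => c * phi x + psi x) =
  c * regular_distribution f phi + regular_distribution f psi.
Proof.
move=> hf /schwartz_measurable_bounded[m1 m2 [M HM]] /schwartz_measurable_bounded[m3 m4 [M' HM']].
rewrite /regular_distribution -cintegral_lin.
- by congr cintegral; apply/funext => x; rewrite mulrDr mulrCA.
- exact: cintegrable_mul hf m1 m2 HM.
- exact: cintegrable_mul hf m3 m4 HM'.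
Qed.

End regular.

Lemma climit_lin (R : realType) (z : R[i]) (S T : nat -> R[i]) :
  cvgn (fun k => complex.Re (S k)) -> cvgn (fun k => complex.Im (S k)) ->
  cvgn (fun k => complex.Re (T k)) -> cvgn (fun k => complex.Im (T k)) ->
  climit (fun k => z * S k + T k) = z * climit S + climit T.
Proof.
have L (a b : R) (f g h : nat -> R) : cvgn f -> cvgn g -> cvgn h ->
    limn (fun k => a * f k + b * g k + h k) = a * limn f + b * limn g + limn h.
  move=> cf cg ch; apply/cvg_lim => //; apply: cvgD => //.
  by apply: cvgD; apply: cvgM => //; exact: cvg_cst.
move=> c1 c2 c3 c4; rewrite /climit; case: z => a b.
apply/eqP; rewrite eq_complex /=; apply/andP; split; apply/eqP.
  rewrite -mulNr -L//; congr (limn _); apply/funext => k.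
  by case: (S k) => ? ?; case: (T k) => ? ? /=; rewrite mulNr.
rewrite -L//; congr (limn _); apply/funext => k.
by case: (S k) => ? ?; case: (T k).
Qed.

Section lv_sums.
Context {R : realType} {n : nat}.
Local Notation mu := (@lebesgue_rV R n).
Local Notation LT := (@lebesgue_space R n).
Variables (v : R) (lambda : nat -> R) (Q : nat -> set 'rV[R]_n).
Hypotheses (v0 : 0 < v) (lambda0 : forall j, 0 <= lambda j).

Lemma lv_sum_ge0 x : (0 <= lv_sum v lambda Q x)%E.
Proof. exact: poweR_ge0. Qed.

Lemma measurable_lv_sum : (forall j, measurable (Q j : set LT)) ->
  measurable_fun [set: LT] (lv_sum v lambda Q).
Proof.
move=> mQ; apply: (@measurableT_comp _ _ _ LT _ _ (fun x : \bar R => x `^ v^-1)%E).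
  exact: measurable_poweR.
apply: (@ge0_emeasurable_sum _ LT R) => [j x _ _|j _]; first by rewrite lee_fin powR_ge0.
apply/measurable_EFinP; apply: (@measurableT_comp _ _ _ LT _ _ (fun x : R => x `^ v)).
  exact: measurable_powR.
apply: (@measurable_funM _ LT R); first exact: measurable_cst.
exact: (@measurable_indic _ LT R).
Qed.

(** The embedding of l^v into l^w; it makes the given square-type function control sums of w-th
    powers. *)
Lemma lv_sum_power (w : R) x : v <= w ->
  (\sum_(j <oo) (lambda j `^ w * \1_(Q j) x)%:E <= lv_sum v lambda Q x `^ w)%E.
Proof.
move=> vw; have w0 : 0 < w by exact: lt_le_trans vw.
rewrite /lv_sum -poweRrM; apply: le_trans (nneseries_power_le _ _).
- apply: lee_nneseries => j _; first by move=> _; rewrite lee_fin mulr_ge0 ?powR_ge0.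
  rewrite poweR_EFin -powRrM mulrA divff ?gt_eqF// mul1r lee_fin.
  by rewrite indicE; case: (x \in Q j); rewrite ?mulr1// mulr0 powR_ge0.
- by rewrite mulrC ler_pdivlMr// mul1r.
- by move=> j; rewrite lee_fin powR_ge0.
Qed.

End lv_sums.

Section atom_powers.
Context {R : realType} {n : nat}.
Local Notation mu := (@lebesgue_rV R n).
Local Notation LT := (@lebesgue_space R n).

Lemma measurable_atom_power (f : 'rV[R]_n -> R[i]) K gam rho c w k :
  measurable_fun [set: LT] (atom_power f K gam rho c w k).
Proof.
case: k => [|k] /=.
  apply: measurable_cut; first exact: measurable_qb.
  exact: measurable_maximal_power.
apply/measurable_funeM/measurable_fun_EFin_indic; exact: measurable_qb.
Qed.

Lemma atom_power_supp (f : 'rV[R]_n -> R[i]) K gam rho c w k x :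
  ~ qb c (gam * (2 ^+ k * rho)) x -> atom_power f K gam rho c w k x = 0%E.
Proof.
case: k => [|k] /= nx; first by rewrite cut_out//; move: nx; rewrite expr0 mul1r.
by rewrite indicE memNset// mule0.
Qed.

(** For k = 0 this is the Kolmogorov bound. For k > 0 the integrand is constant on a dilate, and t^n
    is split so that nw/s of its powers are bounded through t <= gam 2^k rho. *)
Lemma atom_power_integral (w s gam : R) K : 0 < w -> w < 1 -> 1 <= s -> 1 <= gam ->
  exists C : R, 0 < C /\ forall (A1 rho : R) (f : 'rV[R]_n -> R[i]) (c : 'rV[R]_n),
  cmeasurable f -> 1 <= A1 -> 0 < rho ->
  (forall x t, 0 < t -> (\int[mu]_(y in qb x t) modulus f y <=
    (A1 * t `^ (n%:R - n%:R / s) * rho `^ (n%:R / s))%:E)%E) ->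
  forall k x t, 0 < t -> t <= gam * (2 ^+ k * rho) ->
  (\int[mu]_(z in qb x t) atom_power f K gam rho c w k z <=
    (C * A1 `^ w * 2 `^ (- (k%:R * (w * (n + K.+1)%:R))) *
      t `^ (n%:R - n%:R * w / s) * (2 ^+ k * rho) `^ (n%:R * w / s))%:E)%E.
Proof.
move=> w0 w1 s1 gam1; have [C1 [C10 HC1]] := @integral_maximal_power R n w s gam w0 w1 s1 gam1.
have s0 : 0 < s by exact: lt_le_trans s1.
have gam0 : 0 < gam by exact: lt_le_trans gam1.
have C20 : 0 < 2 ^+ n * gam `^ (n%:R * w / s) by rewrite mulr_gt0 ?exprn_gt0 ?powR_gt0.
exists (C1 + 2 ^+ n * gam `^ (n%:R * w / s)); split; first exact: addr_gt0.
move=> A1 rho f c mf A11 rho0 gavg [|k] x t t0 tr.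
  rewrite mul0r oppr0 powRr0 mulr1 expr0 mul1r in tr *.
  apply: (@le_trans _ _ (\int[mu]_(z in qb x t) maximal_power w (modulus f) z)%E).
    apply: ge0_le_integral_nomeas => z _; first exact: atom_power_ge0.
    have [zQ|zQ] := pselect (qb c (gam * rho) z); first by rewrite /= cut_in.
    by rewrite /= cut_out//; exact: maximal_power_ge0.
  apply: le_trans (HC1 _ _ _ (measurable_modulus mf) (modulus_ge0 f) A11 rho0 gavg x t t0 tr) _.
  by rewrite lee_fin !ler_wpM2r ?powR_ge0// lerDl ltW.
have mS : measurable (qb x t : set LT) by exact: measurable_qb.
have mE : measurable (qb c (gam * (2 ^+ k.+1 * rho)) : set LT) by exact: measurable_qb.
rewrite /= (@integral_cst_indic _ LT R mu _ _ _ mS mE) ?lee_fin ?powR_ge0//.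
set b := 2 `^ _; have b0 : 0 <= b by exact: powR_ge0.
apply: (@le_trans _ _ (b%:E * ((2 * t) ^+ n)%:E)%E).
  by rewrite lee_wpmul2l ?lee_fin// -(mu_qb x (ltW t0)); exact: le_mu.
rewrite -EFinM lee_fin; set X := 2 ^+ k.+1 * rho in tr *.
have X0 : 0 < X by rewrite mulr_gt0 ?exprn_gt0.
have ns0 : 0 <= n%:R * w / s by rewrite divr_ge0 ?mulr_ge0// ltW.
have E : t ^+ n = t `^ (n%:R - n%:R * w / s) * t `^ (n%:R * w / s).
  by rewrite expr_expR// !powR_expR// -expRD; congr expR; ring.
have h : t `^ (n%:R * w / s) <= gam `^ (n%:R * w / s) * X `^ (n%:R * w / s).
  by rewrite -powRM ?(ltW gam0) ?(ltW X0)// ler_powR2 ?(ltW t0).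
apply: (@le_trans _ _ (2 ^+ n * gam `^ (n%:R * w / s) * b * t `^ (n%:R - n%:R * w / s) * X `^ (n%:R * w / s))).
  rewrite exprMn E.
  have -> : 2 ^+ n * gam `^ (n%:R * w / s) * b * t `^ (n%:R - n%:R * w / s) * X `^ (n%:R * w / s) =
    b * (2 ^+ n * (t `^ (n%:R - n%:R * w / s) * (gam `^ (n%:R * w / s) * X `^ (n%:R * w / s)))) by ring.
  by rewrite ler_wpM2l// ler_wpM2l ?exprn_ge0// ler_wpM2l ?powR_ge0.
have A1w : 1 <= A1 `^ w by rewrite powR_ge1// ltW.
rewrite !ler_wpM2r ?powR_ge0// (@le_trans _ _ (C1 + 2 ^+ n * gam `^ (n%:R * w / s)))//.
  by rewrite lerDr ltW.
by rewrite ler_peMr// addr_ge0// ltW.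
Qed.

End atom_powers.

Section atomic_sums.
Context {R : realType} {n : nat}.
Local Notation mu := (@lebesgue_rV R n).
Local Notation LT := (@lebesgue_space R n).
Local Notation normc := ComplexField.Normc.normc.
Hypothesis n_gt0 : (0 < n)%N.
Local Notation gam := (4 * n%:R : R).
Variables (K : nat) (A1 w : R) (lambda rho : nat -> R).
Variables (a : nat -> 'rV[R]_n -> R[i]) (c : nat -> 'rV[R]_n).
Hypotheses (w0 : 0 < w) (w1 : w <= 1) (A1_ge1 : 1 <= A1).
Hypotheses (lambda0 : forall j, 0 <= lambda j) (rho0 : forall j, 0 < rho j).
Hypothesis a_moments : forall j, vanishing_moments K (a j).
Hypothesis a_supp : forall j y, ~ qb (c j) (rho j) y -> a j y = 0.
Hypothesis a_mass : forall j,
  (\int[mu]_(y in qb (c j) (rho j)) modulus (a j) y <= (A1 * rho j ^+ n)%:E)%E.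

Let gam1 : 1 <= gam.
Proof. by rewrite -natrM ler1n muln_gt0. Qed.

Let A10 : 0 < A1. Proof. exact: lt_le_trans A1_ge1. Qed.

Definition atomic_majorant (x : 'rV[R]_n) : \bar R :=
  ((\sum_(j <oo) \sum_(k <oo)
    ((lambda j `^ w)%:E * atom_power (a j) K gam (rho j) (c j) w k x)) `^ w^-1)%E.

(** A pointwise limit, defined for every test function. Heat kernels are thus treated directly by
    their kernel bounds, at points where the majorant is finite. *)
Definition atomic_sum (phi : 'rV[R]_n -> R[i]) : R[i] :=
  climit (fun k => \sum_(j < k) (lambda j)%:C%C * regular_distribution (a j) phi).

Lemma atomic_majorant_ge0 x : (0 <= atomic_majorant x)%E.
Proof. exact: poweR_ge0. Qed.

Lemma atomic_majorant_power x : (atomic_majorant x `^ w = \sum_(j <oo) \sum_(k <oo)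
  ((lambda j `^ w)%:E * atom_power (a j) K gam (rho j) (c j) w k x))%E.
Proof.
rewrite poweRVK ?gt_eqF//; apply: nneseries_ge0 => j _ _; apply: nneseries_ge0 => k _ _.
by rewrite mule_ge0 ?atom_power_ge0// lee_fin powR_ge0.
Qed.

Let atom_const_gt0 : 0 < @atom_const R n K.
Proof. by rewrite mulr_gt0// addr_gt0 ?mulr_gt0 ?exprn_gt0. Qed.

Section action.
Variables (A0 t : R) (x : 'rV[R]_n) (phi : 'rV[R]_n -> R[i]).
Hypotheses (A00 : 0 < A0) (t0 : 0 < t).
Hypothesis re_phi : forall j,
  kernel_bound K gam (c j) (rho j) A0 t x (fun y => complex.Re (phi y)).
Hypothesis im_phi : forall j,
  kernel_bound K gam (c j) (rho j) A0 t x (fun y => complex.Im (phi y)).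

(** As w <= 1, the sum of the actions is at most the w-th root of the sum of their w-th powers, to
    which the atomwise estimate applies. *)
Lemma atomic_action_le :
  (\sum_(j <oo) (lambda j * normc (regular_distribution (a j) phi))%:E <=
   (@atom_const R n K * A0 * A1)%:E * atomic_majorant x)%E.
Proof.
have n0 (z : R[i]) : 0 <= normc z by rewrite normcE sqrtr_ge0.
set C := @atom_const R n K * A0 * A1; have C0 : 0 < C by rewrite !mulr_gt0.
pose u j := lambda j * (normc (regular_distribution (a j) phi) / C).
have u0 j : 0 <= u j by rewrite mulr_ge0// divr_ge0// ltW.
apply: (@le_trans _ _ (\sum_(j <oo) (C%:E * (u j)%:E))%E).
  apply: lee_nneseries => j _; first by move=> _; rewrite lee_fin mulr_ge0.
  by rewrite -EFinM lee_fin /u mulrCA [C * _]mulrC divfK ?gt_eqF.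
rewrite nneseriesZl; last by move=> j _; rewrite lee_fin.
apply: lee_wpmul2l; first by rewrite lee_fin ltW.
apply: le_trans (nneseries_le_power w0 w1 u0) _; apply: lee_poweR.
- by rewrite invr_ge0 ltW.
- by apply: nneseries_ge0 => j _ _; rewrite lee_fin powR_ge0.
apply: lee_nneseries => j _; first by move=> _; rewrite lee_fin powR_ge0.
rewrite nneseriesZl; last by move=> k _; exact: atom_power_ge0.
rewrite /u powRM ?divr_ge0 ?(ltW C0)// EFinM lee_wpmul2l ?lee_fin ?powR_ge0//.
exact: (atom_estimate gam1 (rho0 j) A1_ge1 (a_moments j) (@a_supp j) (a_mass j) A00 t0).
Qed.

Lemma atomic_sum_cvg (b : R) : atomic_majorant x = b%:E ->
  let S k := \sum_(j < k) (lambda j)%:C%C * regular_distribution (a j) phi in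
  [/\ cvgn (fun k => complex.Re (S k)), cvgn (fun k => complex.Im (S k)) &
      normc (atomic_sum phi) <= 2 * (@atom_const R n K * A0 * A1 * b)].
Proof.
move=> E; have := atomic_action_le; rewrite E -EFinM.
exact: complex_series_cvg.
Qed.

End action.

Lemma atomic_sum_tempered x : `|x| <= 1 -> (atomic_majorant x < +oo)%E ->
  tempered_distribution atomic_sum /\
  tempered_cvg (fun k phi => \sum_(j < k) (lambda j)%:C%C * regular_distribution (a j) phi)
    atomic_sum.
Proof.
move=> x1 Goo; pose b := fine (atomic_majorant x).
have Gb : atomic_majorant x = b%:E by rewrite fineK// ge0_fin_numE// atomic_majorant_ge0.
have b0 : 0 <= b by rewrite fine_ge0// atomic_majorant_ge0.
pose N := (n + K.+1)%N.
pose C : R := 3 ^+ n.+1 + n%:R ^+ K.+1 * 4 ^+ N.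
have C0 : 0 < C by rewrite ltr_pwDl ?exprn_gt0// mulr_ge0 ?exprn_ge0.
(* The kernel bounds are used with a strictly positive constant, whereas the Schwartz norm may
   vanish; the excess [e] is arbitrary and disappears in the final inequality. *)
have main phi (e : R) : schwartz phi -> 0 < e -> exists A' : R,
    [/\ 0 < A', schwartz_norm N phi = (A' - e)%:E,
      forall j, kernel_bound K gam (c j) (rho j) (C * A') 1 x (fun y => complex.Re (phi y)) &
      forall j, kernel_bound K gam (c j) (rho j) (C * A') 1 x (fun y => complex.Im (phi y))].
  move=> [s1 s2 s3] e0.
  have h s z : (size s <= N)%N ->
      ((japanese z ^+ N * normc (cpartial s phi z))%:E <= schwartz_norm N phi)%E.
    by move=> sN; apply: ereal_sup_ubound; exists (s, z).
  have j0 z : 0 <= @japanese R n z ^+ N by rewrite exprn_ge0// sqrtr_ge0.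
  have S0 : (0 <= schwartz_norm N phi)%E.
    by apply: le_trans (h [::] 0 _) => //; rewrite lee_fin mulr_ge0// normcE sqrtr_ge0.
  have Sfin : schwartz_norm N phi = (fine (schwartz_norm N phi))%:E.
    by rewrite fineK// ge0_fin_numE.
  have F0 : 0 <= fine (schwartz_norm N phi) by rewrite fine_ge0.
  pose A' := fine (schwartz_norm N phi) + e.
  have A'0 : 0 < A' by rewrite ltr_wpDl.
  have hA s z : (size s <= N)%N -> japanese z ^+ N * normc (cpartial s phi z) <= A'.
    move=> sN; have := h s z sN; rewrite Sfin lee_fin => /le_trans; apply.
    by rewrite lerDl ltW.
  exists A'; split; first exact: A'0.
  - by rewrite /A' addrK.
  - move=> j; apply: kernel_bound_smooth => //; first exact: ltW.
    move=> s z sN; apply: le_trans (hA s z sN); rewrite ler_wpM2l//.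
    exact: (normc_Re_le (cpartial s phi z)).
  - move=> j; apply: kernel_bound_smooth => //; first exact: ltW.
    move=> s z sN; apply: le_trans (hA s z sN); rewrite ler_wpM2l//.
    exact: (normc_Im_le (cpartial s phi z)).
pose S phi k := \sum_(j < k) (lambda j)%:C%C * regular_distribution (a j) phi.
have cvS phi : schwartz phi -> cvgn (fun k => complex.Re (S phi k)) /\
    cvgn (fun k => complex.Im (S phi k)).
  move=> sphi; have [A' [A'0 _ h1 h2]] := main phi 1 sphi ltr01.
  by have [] := atomic_sum_cvg (mulr_gt0 C0 A'0) ltr01 h1 h2 Gb.
split; last first.
  by move=> phi sphi; have [c1 c2] := cvS phi sphi; exact: normc_sum_lim.
split.
  move=> z phi psi sphi spsi; have [c1 c2] := cvS _ sphi; have [c3 c4] := cvS _ spsi.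
  have SE k : S (fun x => z * phi x + psi x) k = z * S phi k + S psi k.
    rewrite /S mulr_sumr -big_split/=; apply: eq_bigr => j _.
    by rewrite (regular_distribution_lin _ (a_moments j) sphi spsi) mulrDr mulrCA.
  rewrite /atomic_sum -(climit_lin z c1 c2 c3 c4); congr climit.
  by apply/funext => k; exact: SE.
pose M := 2 * (@atom_const R n K * C * A1 * b).
have M0 : 0 <= M by rewrite !mulr_ge0// ltW.
exists N, M => phi sphi; apply/lee_addgt0Pr => e e0.
have [A' [A'0 E h1 h2]] := main phi (e / (M + 1)) sphi (divr_gt0 e0 (ltr_wpDl M0 ltr01)).
have [_ _ h] := atomic_sum_cvg (mulr_gt0 C0 A'0) ltr01 h1 h2 Gb.
rewrite E -EFinM -EFinD lee_fin (le_trans h)//.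
have -> : 2 * (@atom_const R n K * (C * A') * A1 * b) = M * A' by rewrite /M; ring.
rewrite mulrBr -addrA lerDl addrC subr_ge0 mulrA ler_pdivrMr ?ltr_wpDl//.
by rewrite mulrC mulrDr mulr1 lerDl ltW.
Qed.

Lemma heat_maximal_atomic_sum (Ag : R) : 0 < Ag ->
  (forall t x c rho, 0 < t -> 0 < rho ->
    kernel_bound K gam c rho Ag (Num.sqrt t) x (@gaussian R n t x)) ->
  forall x, (heat_maximal atomic_sum x <= (2 * @atom_const R n K * Ag * A1)%:E * atomic_majorant x)%E.
Proof.
move=> Ag0 Hg x; have C0 : 0 < 2 * @atom_const R n K * Ag * A1 by rewrite !mulr_gt0.
have [->|Goo] := eqVneq (atomic_majorant x) +oo%E; first by rewrite gt0_muley ?lte_fin// leey.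
have Gb : atomic_majorant x = (fine (atomic_majorant x))%:E.
  by rewrite fineK// ge0_fin_numE ?ltey// atomic_majorant_ge0.
apply: ge_ereal_sup => _ [t /= t0 <-].
have st0 : 0 < Num.sqrt t by rewrite sqrtr_gt0.
have h1 j := Hg t x (c j) (rho j) t0 (rho0 j).
have h2 j := kernel_bound0 K (c j) x (ltW Ag0) (rho0 j) st0.
have [_ _ h] := @atomic_sum_cvg Ag (Num.sqrt t) x (heat_kernel t x) Ag0 st0 h1 h2 _ Gb.
by rewrite Gb -EFinM lee_fin -!mulrA in h *.
Qed.

End atomic_sums.

(** * Conclusion *)

Section lorentz_transfer.
Context {R : realType} {n : nat}.
Local Notation mu := (@lebesgue_rV R n).
Local Notation LT := (@lebesgue_space R n).

Lemma lorentz_norm_ge0 (q : R) (r : \bar R) (g : 'rV[R]_n -> \bar R) :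
  (0 <= lorentz_norm q r g)%E.
Proof.
case: r => [r| |] //=; first exact: poweR_ge0.
apply: (@le_trans _ _ ((1 `^ q^-1)%:E * rearrangement g 1)%E).
  by rewrite mule_ge0 ?rearrangement_ge0// lee_fin powR_ge0.
by apply: ereal_sup_ubound; exists 1 => //=; exact: ltr01.
Qed.

Lemma morrey_lorentz_norm_ge0 (p q : R) (r : \bar R) (g : 'rV[R]_n -> \bar R) :
  (0 <= morrey_lorentz_norm p q r g)%E.
Proof.
apply: le_trans (ereal_sup_ubound _); last first.
  by exists (cube 0 1) => //; exists 0, 1; split => //; exact: ltr01.
by rewrite mule_ge0 ?poweR_ge0// lorentz_norm_ge0.
Qed.

(** The return from discrete bounds on cubes to the norm. The factor 2^(n/p - n/q) arises because a
    cube of radius rho has side 2 rho. *)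
Lemma morrey_lorentz_norm_le (p q C M : R) (r : \bar R) (g G : 'rV[R]_n -> \bar R) :
  0 < q -> (0 < r)%E -> 0 < C -> 0 <= M ->
  (forall x, 0 <= g x)%E -> (forall x, g x <= C%:E * G x)%E -> (forall x, 0 <= G x)%E ->
  (forall x rho, 0 < rho -> dyadic_lorentz q r (rearrangement2 (cut (qb x rho) G))
    (M * rho `^ (n%:R / q - n%:R / p))) ->
  (morrey_lorentz_norm p q r g <= (2 `^ q^-1 * 2 `^ (n%:R / p - n%:R / q) * C * M)%:E)%E.
Proof.
move=> q0 r0 C0 M0 g0 gG G0 H; apply: ge_ereal_sup => _ [_ [c [l [l0 ->]] <-]].
have l2 : 0 < l / 2 by rewrite divr_gt0.
rewrite cube_qb ?(ltW l0)//; set c' := \row__ _; set rho := l / 2 in l2 *.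
have a0 : 0 <= M * rho `^ (n%:R / q - n%:R / p) by rewrite mulr_ge0 ?powR_ge0.
have h0 l' : (0 <= rearrangement2 (cut (qb c' rho) G) l')%E by exact: rearrangement2_ge0.
have HC := dyadic_lorentz_scale a0 (ltW C0) h0 (H c' rho l2).
have b0 : 0 <= C * (M * rho `^ (n%:R / q - n%:R / p)) by rewrite mulr_ge0// ltW.
have Hg : dyadic_lorentz q r (rearrangement2 (cut (qb c' rho) g))
    (C * (M * rho `^ (n%:R / q - n%:R / p))).
  apply: (dyadic_lorentz_le r0 b0 (lexx _) _ HC) => m; rewrite rearrangement2_ge0/=.
  apply: le_trans (rearrangementZ_le _ _ C0); apply: le_rearrangement => x.
  have [xQ|xQ] := pselect (qb c' rho x).
    by rewrite !cut_in// !gee0_abs// mule_ge0// lee_fin ltW.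
  by rewrite !cut_out// mule0.
have := dyadic_lorentz_norm q0 r0 b0 Hg => hn.
rewrite mu_qb ?(ltW l2)// poweR_EFin.
apply: (@le_trans _ _ ((((2 * rho) ^+ n) `^ (p^-1 - q^-1))%:E *
    (2 `^ q^-1 * (C * (M * rho `^ (n%:R / q - n%:R / p))))%:E)%E).
  by rewrite lee_wpmul2l// lee_fin powR_ge0.
rewrite -EFinM lee_fin; apply: le_of_eq.
have E : ((2 * rho) ^+ n) `^ (p^-1 - q^-1) * rho `^ (n%:R / q - n%:R / p) =
    2 `^ (n%:R / p - n%:R / q).
  have h : 0 < 2 * rho by rewrite mulr_gt0.
  rewrite (expr_expR n h) !powR_expR ?expR_gt0// expRK lnM ?posrE// -expRD.
  by congr expR; ring.
by rewrite -E; ring.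
Qed.

(** Otherwise the cut function would be infinite on a cube of volume 2^n > 1, contradicting the
    finite weak bound on its rearrangement at t = 1. *)
Lemma exists_fin_num (q M : R) (r : \bar R) (G : 'rV[R]_n -> \bar R) : (0 < n)%N ->
  0 < q -> (0 < r)%E -> 0 <= M -> (forall x, 0 <= G x)%E ->
  dyadic_lorentz q r (rearrangement2 (cut (qb 0 1) G)) M ->
  exists x, `|x| <= 1 /\ (G x < +oo)%E.
Proof.
move=> n_gt0 q0 r0 M0 G0 H; apply: contrapT => nex.
have := weak_dyadic q0 r0 M0 ltr01 H; set b := 2 `^ _ * _ * _ => hb.
have : (rearrangement (cut (qb 0 1) G) 1 < (b + 1)%:E)%E.
  by apply: le_lt_trans hb _; rewrite lte_fin ltrDl.
move=> /rearrangement_lt; apply/negP; rewrite -ltNge.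
apply: (@lt_le_trans _ _ (mu (qb 0 1))).
  by rewrite mu_qb// mulr1 lte_fin exprn_egt1 ?ltr1n// -lt0n.
apply: le_mu => x xQ /=; rewrite cut_in//.
suff -> : G x = +oo%E by rewrite ltry.
apply/eqP; rewrite -leye_eq leNgt; apply/negP => Gx; apply: nex; exists x; split => //.
by move: xQ; rewrite /qb/= subr0.
Qed.

End lorentz_transfer.

(** At w = q the last inequality reads n < q D, which holds since D > n/v > n/q. It is strict, so w
    = q (1 + eta) works for small [eta]: [e1] protects this inequality and [e2] the bound w < 1. *)
Lemma lebesgue_exponent (R : realType) (n : nat) (q v : R) : (0 < n)%N ->
  0 < q -> q < 1 -> 0 < v -> v < q -> v <= 1 ->
  let K := Num.truncn (n%:R * (v^-1 - 1)) in
  exists w : R, [/\ q < w, w < 1 & n.+1%:R * w / q < w * (n + K.+1)%:R + 1].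
Proof.
move=> n_gt0 q0 q1 v0 vq v1 K; have n0 : 0 < n%:R :> R by rewrite ltr0n.
have hK : n%:R * (v^-1 - 1) < K.+1%:R by exact: truncnS_gt.
pose D : R := (n + K.+1)%:R.
have hD : n%:R < q * D.
  have : n%:R / v < D by rewrite /D natrD; move: hK; rewrite mulrBr mulr1; lra.
  rewrite ltr_pdivrMr// => h; apply: lt_trans h _.
  by rewrite mulrC ltr_pM2r// ltr0n addn_gt0 n_gt0.
pose e1 := (q * D - n%:R) / n.+1%:R; pose e2 := q^-1 - 1.
have e10 : 0 < e1 by rewrite divr_gt0 ?ltr0n// subr_gt0.
have e20 : 0 < e2 by rewrite subr_gt0 invf_gt1.
pose eta := Num.min e1 e2 / 2.
have m0 : 0 < Num.min e1 e2 by rewrite lt_min e10.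
have eta0 : 0 < eta by rewrite divr_gt0.
have h1 : eta < e1 by rewrite (@lt_le_trans _ _ (Num.min e1 e2)) ?ge_min ?lexx// /eta; lra.
have h2 : eta < e2 by rewrite (@lt_le_trans _ _ (Num.min e1 e2)) ?ge_min ?lexx ?orbT// /eta; lra.
exists (q * (1 + eta)); split.
- by rewrite ltr_pMr// ltrDl.
- by rewrite -ltr_pdivlMl// mulr1 -ltrBrDl.
have -> : n.+1%:R * (q * (1 + eta)) / q = n.+1%:R * (1 + eta) by field; rewrite gt_eqF.
have : eta * n.+1%:R < q * D - n%:R by rewrite -ltr_pdivlMr ?ltr0n.
have : 0 <= eta * (q * D) by rewrite mulr_ge0 ?(ltW eta0)// mulr_ge0// ltW.
rewrite -/D -natr1; lra.
Qed.

Theorem theorem1p8 (R : realType) (n : nat) (p q s v : R) (r : \bar R)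
    (n_gt0 : (0 < n)%N)
    (q_gt0 : 0 < q) (q_le_p : q <= p) (r_gt0 : (0 < r)%E) (s_ge1 : 1 <= s)
    (v_gt0 : 0 < v) (v_le1 : v <= 1) (q_lt1 : q < 1) (p_lt_s : p < s)
    (v_lt_qr : (v%:E < Order.min q%:E r)%E) :
  exists C : R, 0 < C /\
  forall (Q : nat -> set 'rV[R]_n) (a : nat -> 'rV[R]_n -> R[i])
      (lambda : nat -> R),
    (forall j, cubes (Q j)) ->
    (forall j, morrey s 1 (a j)) ->
    (forall j, vanishing_moments (Num.truncn (n%:R * (v^-1 - 1))) (a j)) ->
    (forall j, 0 <= lambda j) ->
    (forall j, (morrey_norm s 1 (a j) <= lebesgue_rV n (Q j) `^ s^-1)%E) ->
    (forall j, csupport (a j) `<=` Q j) ->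
    (morrey_lorentz_norm p q r (lv_sum v lambda Q) < +oo)%E ->
  exists f : ('rV[R]_n -> R[i]) -> R[i],
    [/\ tempered_distribution f,
        tempered_cvg
          (fun k phi => \sum_(j < k)
             (lambda j)%:C%C * regular_distribution (a j) phi) f &
        (hardy_morrey_lorentz_norm p q r f <=
           C%:E * morrey_lorentz_norm p q r (lv_sum v lambda Q))%E].
Proof.
have vq : v < q by move: v_lt_qr; rewrite lt_min lte_fin => /andP[].
set K := Num.truncn _.
have [w [qw w1 decay]] := lebesgue_exponent n_gt0 q_gt0 q_lt1 v_gt0 vq v_le1.
rewrite -/K in decay.
have w0 : 0 < w by exact: lt_trans qw.
have gam1 : 1 <= 4 * n%:R :> R by rewrite -natrM ler1n muln_gt0.
have s0 : 0 < s by exact: lt_le_trans s_ge1.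
have [Cm [Cm1 HCm]] := @morrey_one_integral R n s s_ge1.
have Cm0 : 0 < Cm by exact: lt_le_trans Cm1.
(* The power of 2 converts |Q_j|^(1/s) into rho_j^(n/s), as the side of the cube is twice its
   radius. *)
pose A1 := Cm * 2 `^ (n%:R / s).
have A11 : 1 <= A1.
  by rewrite -[leLHS]mulr1 ler_pM// powR_ge1 ?ler1n// divr_ge0// ltW.
have A10 : 0 < A1 by exact: lt_le_trans A11.
have [Ci [Ci0 HCi]] := @atom_power_integral R n w s _ K w0 w1 s_ge1 gam1.
have [Ag [Ag0 HAg]] := @kernel_bound_gaussian R n n_gt0 K.
pose A := Ci * A1 `^ w.
have A_ge0 : 0 <= A by rewrite mulr_ge0 ?powR_ge0// ltW.
have [Cc [Cc0 HCc]] := @core_estimate R n p q w s _ A _ r q_gt0 q_le_p r_gt0 qw p_lt_s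
  A_ge0 gam1 decay n_gt0.
pose Ch := 2 * @atom_const R n K * Ag * A1.
have Ch0 : 0 < Ch by rewrite !mulr_gt0// addr_gt0 ?mulr_gt0 ?exprn_gt0.
exists (2 `^ q^-1 * 2 `^ (n%:R / p - n%:R / q) * Ch * Cc); split.
  by rewrite !mulr_gt0 ?powR_gt0.
move=> Q a lambda cQ ma va lambda0 na sa Noo.
have hQ j : exists crho : 'rV[R]_n * R, 0 < crho.2 /\ Q j = qb crho.1 crho.2.
  have [c [l [l0 ->]]] := cQ j.
  exists (\row_i (c ord0 i + l / 2), l / 2); split; first by rewrite divr_gt0.
  by rewrite cube_qb// ltW.
have [crho hcrho] := choice hQ.
pose c j := (crho j).1; pose rho j := (crho j).2.
have rho0 j : 0 < rho j by exact: (hcrho j).1.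
have QE j : Q j = qb (c j) (rho j) by exact: (hcrho j).2.
have cm j : cmeasurable (a j) by have [] := va j.
have gavg j x t : 0 < t -> (\int[lebesgue_rV n]_(y in qb x t) modulus (a j) y <=
    (A1 * t `^ (n%:R - n%:R / s) * rho j `^ (n%:R / s))%:E)%E.
  move=> t0; pose N := ((2 * rho j) ^+ n) `^ s^-1.
  have hN : (morrey_norm s 1 (a j) <= N%:E)%E.
    by apply: le_trans (na j) _; rewrite QE mu_qb ?(ltW (rho0 j))// poweR_EFin.
  apply: le_trans (HCm (a j) N (cm j) (powR_ge0 _ _) hN x t t0) _.
  rewrite lee_fin; apply: le_of_eq.
  have -> : N = 2 `^ (n%:R / s) * rho j `^ (n%:R / s).
    by rewrite -powRM ?(ltW (rho0 j))// powRrM powR_mulrn// mulr_ge0// ltW.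
  by rewrite /A1; ring.
have a_supp j y : ~ qb (c j) (rho j) y -> a j y = 0.
  rewrite -QE => ny; apply: contrapT => /eqP ay; apply: ny; apply: sa.
  exact: subset_closure.
have a_mass j : (\int[lebesgue_rV n]_(y in qb (c j) (rho j)) modulus (a j) y <=
    (A1 * rho j ^+ n)%:E)%E.
  apply: le_trans (gavg j _ _ (rho0 j)) _; rewrite lee_fin -mulrA -powRD.
    by rewrite subrK powR_mulrn// ltW.
  by rewrite (gt_eqF (rho0 j)) implybT.
pose N := fine (morrey_lorentz_norm p q r (lv_sum v lambda Q)).
have n0 := morrey_lorentz_norm_ge0 p q r (lv_sum v lambda Q).
have NE : morrey_lorentz_norm p q r (lv_sum v lambda Q) = N%:E.
  by rewrite fineK// ge0_fin_numE.
have N0 : 0 <= N by rewrite fine_ge0.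
have cd : core_data p q w s (n + K.+1)%:R A (4 * n%:R) r c rho (fun j => lambda j `^ w)
    (fun j k => atom_power (a j) K (4 * n%:R) (rho j) (c j) w k) (lv_sum v lambda Q) N.
  split.
  - exact: rho0.
  - by move=> j; exact: powR_ge0.
  - by move=> j k x; exact: atom_power_ge0.
  - by move=> j k; exact: measurable_atom_power.
  - by move=> j k x; exact: atom_power_supp.
  - move=> j k x t t0 tr; exact: (HCi A1 (rho j) (a j) (c j) (cm j) A11 (rho0 j) (gavg j) k x t t0 tr).
  - by apply: measurable_lv_sum => j; rewrite QE; exact: measurable_qb.
  - exact: lv_sum_ge0.
  - move=> x; under eq_eseriesr do rewrite -QE.
    by apply: lv_sum_power => //; exact: ltW (lt_trans vq qw).
  - exact: N0.
  - by rewrite NE.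
pose G := @atomic_majorant R n K w lambda rho a c.
have G0 x : (0 <= G x)%E by exact: atomic_majorant_ge0.
have HG x rho1 : 0 < rho1 -> dyadic_lorentz q r (rearrangement2 (cut (qb x rho1) G))
    (Cc * (N * rho1 `^ (n%:R / q - n%:R / p))).
  apply: (HCc _ _ _ _ _ _ G cd G0) => z.
  by rewrite /G atomic_majorant_power.
have M0 : 0 <= Cc * N by rewrite mulr_ge0// ltW.
(* A single point, chosen before any test function, carries both convergence and continuity. *)
have [x [x1 Gx]] : exists x, `|x| <= 1 /\ (G x < +oo)%E.
  apply: (exists_fin_num n_gt0 q_gt0 r_gt0 M0 G0).
  by have := HG 0 1 ltr01; rewrite powR1 mulr1.
have [td tc] := @atomic_sum_tempered R n n_gt0 K A1 w lambda rho a c w0 (ltW w1) A11 lambda0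
  rho0 va a_supp a_mass x x1 Gx.
exists (atomic_sum lambda a); split => //.
have hmax := @heat_maximal_atomic_sum R n n_gt0 K A1 w lambda rho a c w0 (ltW w1) A11 lambda0
  rho0 va a_supp a_mass Ag Ag0 HAg.
have h0 x' : (0 <= heat_maximal (atomic_sum lambda a) x')%E.
  apply: le_trans (ereal_sup_ubound _); last by exists 1 => //=; exact: ltr01.
  by rewrite lee_fin sqrtr_ge0.
rewrite NE -EFinM (_ : _ * N = 2 `^ q^-1 * 2 `^ (n%:R / p - n%:R / q) * Ch * (Cc * N)); last by ring.
apply: (morrey_lorentz_norm_le q_gt0 r_gt0 Ch0 M0 h0 hmax G0) => x' rho1 rho10.
by rewrite -mulrA; exact: HG.
Qed.
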